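(* Let $N\ge1$, let $V$ be a fixed $N\times N$ unitary matrix, let $(U_t)_{t\ge0}$ be the unitary Brownian motion started at $U_0=V$, and fix $j\in\{1,\dots,N\}$. For integers $p\ge1$ and $t\ge0$ let $y_p(t)=\mathbb E|U_t^{j1}|^{2p}$, and let $y_0\equiv1$. Then for every $p\ge1$ the function $y_p$ satisfies on $[0,\infty)$ the ordinary differential equation $$y_p'=-\Lambda_py_p+\frac{p^2}{N}y_{p-1},\qquad \Lambda_p=p+\frac{p(p-1)}{N}.$$ The solution of this system can be expressed as $$y_p(t)=p!\sum_{n=0}^p\binom{p}{p-n}\frac{a_n}{(N+2n)_{p-n}}\,e^{-\Lambda_nt},$$ where $(a_n)_{n\ge0}$ is the real sequence, depending on the initial value $c=|U_0^{j1}|^2$, defined in the context.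
   Context: Hermitian Brownian motion $(H_t)_{t\ge0}$: the continuous centered Gaussian process in the real vector space of $N\times N$ Hermitian matrices, with $H_0=0$, such that $\mathbb E[\langle A,H_s\rangle\langle B,H_t\rangle]=\min(s,t)\langle A,B\rangle$ for all Hermitian $A,B$, where $\langle A,B\rangle=N\,\mathrm{Tr}(AB)$. The unitary Brownian motion started at a unitary matrix $V$ is the solution of the It\^o stochastic differential equation $dU_t=i(dH_t)U_t-\frac12U_t\,dt$, $U_0=V$; it takes values in the group of $N\times N$ unitary matrices. $U_t^{jk}$ denotes the $(j,k)$ entry of $U_t$. The Pochhammer symbol is $(x)_n=x(x+1)\cdots(x+n-1)$, $(x)_0=1$. The sequence $(a_n)_{n\ge0}$ consists of the coefficients in the expansion $\mathbb E\exp(\lambda|U_t^{j1}|^2)=\sum_{n\ge0}a_ne^{-\Lambda_nt}\lambda^n\,{}_1F_1(n+1;N+2n;\lambda)$, where $\Lambda_n=n+\frac{n(n-1)}N$ and ${}_1F_1(a;b;z)=\sum_{k\ge0}\frac{(a)_kz^k}{(b)_kk!}$; it is determined by the infinite triangular linear system $\sum_{n=0}^pa_n\binom pn\frac1{(N+2n)_{p-n}}=\frac{c^p}{p!}$ for all $p\ge0$, with $c=|U_0^{j1}|^2$. *)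

(* Defs.v *)
From mathcomp Require Export all_boot all_order all_algebra.
From mathcomp Require Export all_classical all_reals all_analysis.
From mathcomp Require Export complex.
Export Order.TTheory GRing.Theory Num.Theory.
Export numFieldNormedType.Exports.

Set Implicit Arguments.
Unset Strict Implicit.
Unset Printing Implicit Defensive.

Local Open Scope classical_set_scope.
Local Open Scope ring_scope.

Section Matrices.
Context {R : realType} {N : nat}.
Implicit Types A B : 'M[R[i]]_N.

(* The 2 N^2 real coordinates of a complex matrix: [b] selects the imaginary
   part. *)
Definition mxcoord (b : bool) (i j : 'I_N) A : R :=
  if b then complex.Im (A i j) else complex.Re (A i j).

(* Squared Frobenius norm. *)
Definition mxnorm2 A : R := \sum_b \sum_i \sum_j mxcoord b i j A ^+ 2.

(* N Tr(A B) is real when A and B are Hermitian, so that taking the real part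
   loses nothing there. *)
Definition herm_pairing A B : R := N%:R * complex.Re (\tr (A *m B)).

Definition mxRintegral (f : R -> 'M[R[i]]_N) (t : R) : 'M[R[i]]_N :=
  \matrix_(i, j)
    ((\int[lebesgue_measure]_(s in `[0%R, t]) mxcoord false i j (f s)) +i*
     (\int[lebesgue_measure]_(s in `[0%R, t]) mxcoord true i j (f s)))%C.

Definition mx_continuous_path (f : R -> 'M[R[i]]_N) : Prop :=
  forall b i j, {within `[0, +oo[, continuous (fun t => mxcoord b i j (f t))}.

End Matrices.

Section Probability.
Context {d : measure_display} {T : measurableType d} {R : realType} {N : nat}.
Variable P : probability T R.
Implicit Types (X : T -> 'M[R[i]]_N) (F : R -> set (set T)).
Implicit Types (H U : R -> T -> 'M[R[i]]_N).

Definition sigma_mx X : set (set T) :=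
  <<s [set E | exists b i j (B : set R),
         measurable B /\ E = (fun w => mxcoord b i j (X w)) @^-1` B] >>.

Definition indep_sigma (G1 G2 : set (set T)) : Prop :=
  forall E1 E2, G1 E1 -> G2 E2 -> P (E1 `&` E2) = (P E1 * P E2)%E.

Definition is_filtration F : Prop :=
  (forall t, 0 <= t -> sigma_algebra setT (F t) /\ F t `<=` measurable) /\
  (forall s t, 0 <= s -> s <= t -> F s `<=` F t).

Definition adapted F H : Prop := forall t, 0 <= t -> sigma_mx (H t) `<=` F t.

Definition cvg_in_prob (Y : nat -> T -> R) (Z : T -> R) : Prop :=
  forall e : R, 0 < e ->
    P [set w | e <= `|Y n w - Z w|] @[n --> \oo] --> 0%E.

(* Point masses at 0 count as Gaussian. *)
Definition centered_gaussian (X : T -> R) : Prop :=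
  measurable_fun setT X /\
  ({ae P, forall w, X w = 0} \/
   exists2 s : R, 0 < s &
     forall B : set R, measurable B -> P (X @^-1` B) = normal_prob 0 s B).

Definition hermitian_BM H : Prop :=
  [/\ forall t w, 0 <= t -> H t w \is hermsymmx,
      forall w, H 0 w = 0,
      forall w, mx_continuous_path (H ^~ w),
      (forall r : seq (R * 'M[R[i]]_N),
         (forall q, q \in r -> 0 <= q.1 /\ q.2 \is hermsymmx) ->
         centered_gaussian
           (fun w => \sum_(q <- r) herm_pairing q.2 (H q.1 w))) &
      forall (s t : R) (A B : 'M[R[i]]_N),
        0 <= s -> 0 <= t -> A \is hermsymmx -> B \is hermsymmx ->
        ('E_P[fun w => (herm_pairing A (H s w) * herm_pairing B (H t w))%R])%E =
        (Num.min s t * herm_pairing A B)%:E].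

Definition hermitian_BM_wrt F H : Prop :=
  [/\ hermitian_BM H, adapted F H &
      forall s t, 0 <= s -> s <= t ->
        indep_sigma (F s) (sigma_mx (fun w => H t w - H s w))].

(* The process  s |-> \sum_k xi_k 1_(]tau_k, tau_(k+1)])(s)  with bounded,
   F_(tau_k)-measurable coefficients xi_k. *)
Record simple_process F := SimpleProcess {
  sp_size : nat;
  sp_time : nat -> R;
  sp_coef : nat -> T -> 'M[R[i]]_N;
  _ : forall k, 0 <= sp_time k;
  _ : forall k, sp_time k <= sp_time k.+1;
  _ : forall k, sigma_mx (sp_coef k) `<=` F (sp_time k);
  _ : forall k, exists M : R, forall w, mxnorm2 (sp_coef k w) <= M
}.

Definition sp_eval F (S : simple_process F) (s : R) (w : T) : 'M[R[i]]_N :=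
  \sum_(k < sp_size S)
    if sp_time S k < s <= sp_time S k.+1 then sp_coef S k w else 0.

(* \int_0^t (dH) S, with the integrator on the left. *)
Definition sp_integral H F (S : simple_process F) (t : R) (w : T) :
    'M[R[i]]_N :=
  \sum_(k < sp_size S)
    (H (Num.min (sp_time S k.+1) t) w - H (Num.min (sp_time S k) t) w)
      *m sp_coef S k w.

(* [I] is (a version of) the Ito integral \int_0^t (dH_s) X_s: the limit in
   probability of the integrals of simple processes S_n such that
   \int_0^t |S_n - X|^2 ds tends to 0 in probability. *)
Definition is_ito_integral F H (X : R -> T -> 'M[R[i]]_N) (t : R)
    (I : T -> 'M[R[i]]_N) : Prop :=
  sigma_mx I `<=` measurable /\
  exists S : nat -> simple_process F,
    cvg_in_prob
      (fun n w => \int[lebesgue_measure]_(s in `[0%R, t])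
                    mxnorm2 (sp_eval (S n) s w - X s w)) (cst 0) /\
    cvg_in_prob (fun n w => mxnorm2 (sp_integral H (S n) t w - I w)) (cst 0).

(* dU = i (dH) U - U/2 dt, U_0 = V, in integral form. *)
Definition unitary_BM F H (V : 'M[R[i]]_N) U : Prop :=
  [/\ adapted F U,
      forall w, mx_continuous_path (U ^~ w),
      forall w, U 0 w = V &
      exists I : R -> T -> 'M[R[i]]_N,
        forall t, 0 <= t ->
          is_ito_integral F H U t (I t) /\
          {ae P, forall w,
             U t w = V + 'i%C *: I t w - 2^-1 *: mxRintegral (U ^~ w) t}].

End Probability.

(* Limit of the difference quotient within [D]; on D = [0, +oo[ this is the
   right derivative at 0 and the usual derivative elsewhere. *)
Definition derivative_within {R : realType} (D : set R) (f : R -> R)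
    (t l : R) : Prop :=
  (f s - f t) / (s - t) @[s --> within (D `\ t) (nbhs t)] --> l.

Definition pochhammer {R : realType} (x : R) (n : nat) : R :=
  \prod_(k < n) (x + k%:R).

Definition Lambda {R : realType} (N n : nat) : R :=
  n%:R + n%:R * (n%:R - 1) / N%:R.

Definition coef_system {R : realType} (N : nat) (c : R) (a : nat -> R) : Prop :=
  forall p : nat,
    \sum_(n < p.+1)
      a n * 'C(p, n)%:R / pochhammer (N%:R + 2 * n%:R) (p - n) =
    c ^+ p / p`!%:R.

(* Main.v *)
(* A column u of U is a vector of R^(2N) driven by the antisymmetric real matrix
   A of i H, with E (dA)^2 = - dt. Replacing dA on a grid of mesh t/n by its
   Cayley transform gives an orthogonal flow x_0 = u_0, ..., x_n, and x_n tends
   to u_t in probability: W^T u, with W the product of the Cayley transforms, is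
   a telescoping sum of martingale increments and of terms of higher order. In
   particular |u_t| = 1 almost surely, and E f(u_t) is the limit of E f(x_n) for
   f = |u^j|^(2p). This avoids the Ito formula: a second-order Taylor expansion
   of one Cayley step and the covariance of H show that the moments of
   s = |x^j|^2 satisfy the Euler scheme of the announced system up to o(1/n),
   so by induction on p they converge to its explicit solution, the initial
   value being c^p by the definition of (a_n). *)

(* The equation describes [U] only through limits in probability of integrals of simple processes,
   and no norm or moment bound on [U] is known before the end. Errors are therefore measured by
   [rho], the mean of a distance truncated at 1, and the coefficients of Gaussian increments are cut
   off so as to be bounded; outside an event of small probability the cut-offs do nothing. The
   Cayley flow is exactly orthogonal at every mesh, so its moments stay bounded by 1, which the
   plain product of factors [1 + dA - dt/2] would not give. Two grids are used: Riemann sums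
   converge to the Ito integral without any rate, so the number of fine cells is chosen after the
   number of coarse Cayley steps, and this beats the powers of the latter lost in the telescoping
   sum. Passing to R^(2N) leaves a trace of the complex structure: the covariance of the entries
   contains terms in [Jmx], and these cancel the lower-order terms that would otherwise remain in
   [E (dA)^2 = - dt] and in the constant [1/N] of the drift of [|x^j|^2]. *)
Require Import Defs.
From mathcomp Require Import measurable_realfun ring lra.

Set Implicit Arguments.
Unset Strict Implicit.
Unset Printing Implicit Defensive.

Local Open Scope classical_set_scope.
Local Open Scope ring_scope.

(** * Expectations *)

Section Expectation.
Context {d : measure_display} {T : measurableType d} {R : realType}.
Variable P : probability T R.
Implicit Types X Y : T -> R.

(** Real-valued: [fine] sends an infinite integral to [0], which is why additivity and monotonicity
    below carry [L1] hypotheses while nonnegativity does not. *)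
Definition Ex X : R := \int[P]_w X w.
Definition L1 X : Prop := P.-integrable setT (EFin \o X).
Definition L2 X : Prop := measurable_fun setT X /\ L1 (fun w => X w ^+ 2).

Lemma L1_measurable X : L1 X -> measurable_fun setT X.
Proof. by move=> /measurable_int/measurable_EFinP. Qed.

Lemma L1_dom X Y : measurable_fun setT X -> (forall w, `|X w| <= Y w) ->
  L1 Y -> L1 X.
Proof.
move=> mX XY; apply: le_integrable => //; first exact/measurable_EFinP.
by move=> w _ /=; rewrite lee_fin (le_trans (XY w))// ler_norm.
Qed.

Lemma L1_cst c : L1 (fun=> c).
Proof. exact: finite_measure_integrable_cst. Qed.

Lemma L1_bounded X c : measurable_fun setT X -> (forall w, `|X w| <= c) -> L1 X.
Proof. by move=> mX Xc; apply: L1_dom mX Xc (L1_cst c). Qed.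

Lemma L1D X Y : L1 X -> L1 Y -> L1 (fun w => X w + Y w).
Proof. exact: integrableD. Qed.

Lemma L1Z c X : L1 X -> L1 (fun w => c * X w).
Proof. exact: integrableZl. Qed.

Lemma L1N X : L1 X -> L1 (fun w => - X w).
Proof. exact: integrableN. Qed.

Lemma L1B X Y : L1 X -> L1 Y -> L1 (fun w => X w - Y w).
Proof. by move=> lX lY; apply: L1D lX (L1N lY). Qed.

Lemma L1_sum (I : Type) (r : seq I) (Q : pred I) (X : I -> T -> R) :
  (forall i, Q i -> L1 (X i)) -> L1 (fun w => \sum_(i <- r | Q i) X i w).
Proof.
move=> h; rewrite /L1.
have -> : EFin \o (fun w => \sum_(i <- r | Q i) X i w) =
    (fun w => (\sum_(i <- r | Q i) (X i w)%:E)%E).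
  by apply/funext => w; rewrite /= sumEFin.
by apply: integrable_sum.
Qed.

Lemma L1_norm X : L1 X -> L1 (fun w => `|X w|).
Proof. exact: integrable_norm. Qed.

Lemma Ex_EFin X : L1 X -> (\int[P]_w (X w)%:E)%E = (Ex X)%:E.
Proof. by move=> lX; rewrite fineK//; exact: integrable_fin_num. Qed.

Lemma eq_Ex X Y : X =1 Y -> Ex X = Ex Y.
Proof. by move=> /funext ->. Qed.

Lemma ExD X Y : L1 X -> L1 Y -> Ex (fun w => X w + Y w) = Ex X + Ex Y.
Proof. exact: RintegralD. Qed.

Lemma ExB X Y : L1 X -> L1 Y -> Ex (fun w => X w - Y w) = Ex X - Ex Y.
Proof. exact: RintegralB. Qed.

Lemma ExZ c X : L1 X -> Ex (fun w => c * X w) = c * Ex X.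
Proof. exact: RintegralZl. Qed.

Lemma ExN X : L1 X -> Ex (fun w => - X w) = - Ex X.
Proof.
by move=> lX; rewrite -mulN1r -ExZ//; apply: eq_Ex => w; rewrite mulN1r.
Qed.

Lemma Ex_cst c : Ex (fun=> c) = c.
Proof.
rewrite /Ex Rintegral_cst//.
by have /= -> := probability_setT P; rewrite mulr1.
Qed.

Lemma Ex_sum (I : Type) (r : seq I) (Q : pred I) (X : I -> T -> R) :
  (forall i, Q i -> L1 (X i)) ->
  Ex (fun w => \sum_(i <- r | Q i) X i w) = \sum_(i <- r | Q i) Ex (X i).
Proof.
move=> h; elim: r => [|i r IH].
  by rewrite big_nil -[RHS](Ex_cst 0); apply: eq_Ex => w; rewrite big_nil.
rewrite big_cons -IH; case: ifPn => Qi.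
  rewrite -ExD; [|exact: h|exact: L1_sum].
  by apply: eq_Ex => w; rewrite big_cons Qi.
by apply: eq_Ex => w; rewrite big_cons (negbTE Qi).
Qed.

Lemma Ex_ge0 X : (forall w, 0 <= X w) -> 0 <= Ex X.
Proof. by move=> h; apply: Rintegral_ge0. Qed.

Lemma le_Ex X Y : L1 X -> L1 Y -> (forall w, X w <= Y w) -> Ex X <= Ex Y.
Proof. by move=> lX lY XY; apply: le_Rintegral. Qed.

Lemma le_norm_Ex X : L1 X -> `|Ex X| <= Ex (fun w => `|X w|).
Proof. by move=> lX; apply: le_normr_Rintegral. Qed.

Lemma Ex_le_cst X c : L1 X -> (forall w, X w <= c) -> Ex X <= c.
Proof.
by move=> lX Xc; rewrite -[leRHS]Ex_cst; apply: le_Ex => //; exact: L1_cst.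
Qed.

Lemma eq_Ex_ae X Y : L1 X -> L1 Y -> {ae P, forall w, X w = Y w} -> Ex X = Ex Y.
Proof.
move=> lX lY XY; rewrite /Ex /Rintegral; congr fine.
apply: ae_eq_integral => //.
- exact/measurable_EFinP/L1_measurable.
- exact/measurable_EFinP/L1_measurable.
- by apply: filterS XY => w h _ /=; rewrite h.
Qed.

Lemma L2M X Y : L2 X -> L2 Y -> L1 (fun w => X w * Y w).
Proof.
move=> [mX lX] [mY lY].
apply: (@L1_dom _ (fun w => X w ^+ 2 + Y w ^+ 2)); last exact: L1D.
  exact: measurable_funM.
move=> w; rewrite normrM -(real_normK (num_real (X w))).
rewrite -(real_normK (num_real (Y w))).
by have := normr_ge0 (X w); have := normr_ge0 (Y w); nra.
Qed.

Lemma L2_bounded X c : measurable_fun setT X -> (forall w, `|X w| <= c) -> L2 X.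
Proof.
move=> mX Xc; split => //; apply: (@L1_bounded _ (c ^+ 2)).
  exact: measurable_funX.
by move=> w; rewrite normrX ler_sqr ?nnegrE// (le_trans _ (Xc w)).
Qed.

Lemma L2_cst c : L2 (fun=> c).
Proof. exact: (@L2_bounded _ `|c|). Qed.

Lemma L2_L1 X : L2 X -> L1 X.
Proof.
move=> lX; have := L2M lX (L2_cst 1).
by under eq_fun do rewrite mulr1.
Qed.

Lemma L2D X Y : L2 X -> L2 Y -> L2 (fun w => X w + Y w).
Proof.
move=> lX lY; have [mX lX2] := lX; have [mY lY2] := lY.
split; first exact: measurable_funD.
under eq_fun do rewrite sqrrD -mulr_natl.
by apply: L1D => //; apply: L1D => //; apply: L1Z; exact: L2M.
Qed.

Lemma L2bM X Y c : measurable_fun setT X -> (forall w, `|X w| <= c) -> L2 Y ->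
  L2 (fun w => X w * Y w).
Proof.
move=> mX Xc [mY lY]; split; first exact: measurable_funM.
apply: (@L1_dom _ (fun w => c ^+ 2 * Y w ^+ 2)); last exact: L1Z.
  by apply: measurable_funX; exact: measurable_funM.
move=> w; rewrite ger0_norm ?sqr_ge0// exprMn ler_wpM2r ?sqr_ge0//.
rewrite -(real_normK (num_real (X w))) ler_sqr ?nnegrE//.
by rewrite (le_trans _ (Xc w)).
Qed.

Lemma L2Z c X : L2 X -> L2 (fun w => c * X w).
Proof. by apply: (@L2bM (fun=> c) X `|c|). Qed.

Lemma L2_sum (I : Type) (r : seq I) (Q : pred I) (X : I -> T -> R) :
  (forall i, Q i -> L2 (X i)) -> L2 (fun w => \sum_(i <- r | Q i) X i w).
Proof.
move=> h; elim: r => [|i r IH].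
  by under eq_fun do rewrite big_nil; exact: L2_cst.
have [Qi|Qi] := boolP (Q i).
  rewrite (_ : (fun w => _) = (fun w => X i w + \sum_(j <- r | Q j) X j w)).
    by apply: L2D => //; exact: h.
  by apply/funext => w; rewrite big_cons Qi.
rewrite (_ : (fun w => _) = (fun w => \sum_(j <- r | Q j) X j w))//.
by apply/funext => w; rewrite big_cons (negbTE Qi).
Qed.

End Expectation.

(** * Products of independent variables *)

Section Independence.
Context {d : measure_display} {T : measurableType d} {R : realType}.
Variable P : probability T R.
Implicit Types X Y : T -> R.

Section ProductLaw.
Local Open Scope ereal_scope.
Variables X Y : {mfun T >-> R}.
Hypothesis XY : forall A B : set R, measurable A -> measurable B ->
  P (X @^-1` A `&` Y @^-1` B) = P (X @^-1` A) * P (Y @^-1` B).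

Let mZ : measurable_fun setT (fun w => (X w, Y w)).
Proof. exact: measurable_fun_pair. Qed.
Let Z := mfun_Sub (mem_set mZ).
Let PX : probability _ R := distribution P X.
Let PY : probability _ R := distribution P Y.

Let joint_law (A : set (R * R)) : measurable A ->
  (PX \x PY) A = distribution P Z A.
Proof. by apply: product_measure_unique => A1 A2 mA1 mA2; rewrite -XY. Qed.

Let int1 (f : R -> \bar R) : measurable_fun setT f -> (forall x, 0 <= f x) ->
  \int[PX]_x f x = \int[P]_w f (X w).
Proof. by move=> mf f0; rewrite ge0_integral_distribution. Qed.

Let int2 (f : R -> \bar R) : measurable_fun setT f -> (forall x, 0 <= f x) ->
  \int[PY]_x f x = \int[P]_w f (Y w).
Proof. by move=> mf f0; rewrite ge0_integral_distribution. Qed.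

Let mprod : measurable_fun setT (fun z : R * R => (z.1 * z.2)%:E).
Proof. by apply/measurable_EFinP; apply: measurable_funM. Qed.

Hypothesis lX : L1 P X.
Hypothesis lY : L1 P Y.

Let integrable_PX : PX.-integrable setT (EFin \o id).
Proof.
apply: (@integrable_pushforward _ _ _ _ _ X) => //.
by apply/measurable_EFinP.
Qed.

Let integrable_PY : PY.-integrable setT (EFin \o id).
Proof.
apply: (@integrable_pushforward _ _ _ _ _ Y) => //.
by apply/measurable_EFinP.
Qed.

Let integrable_prod :
  (PX \x PY).-integrable setT (fun z : R * R => (z.1 * z.2)%:E).
Proof.
apply: (proj2 (integrable12ltyP PX PY mprod)) => /=.
under eq_integral => x _.
  under eq_integral => y _ do rewrite normrM EFinM.
  rewrite ge0_integralZl//; last first.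
    by apply/measurable_EFinP; exact: normr_measurable.
  over.
have [_ hX] := integrableP _ _ _ integrable_PX.
have [_ hY] := integrableP _ _ _ integrable_PY.
rewrite ge0_integralZr//=; last 2 first.
  by apply/measurable_EFinP; exact: normr_measurable.
  by apply: integral_ge0.
by rewrite lte_mul_pinfty// ?integral_ge0// ge0_fin_numE// integral_ge0.
Qed.

(** A finite measure on the plane is determined by rectangles, so the hypothesis identifies the law
    of [(X, Y)] with the product law; Tonelli gives integrability of the product and Fubini the
    factorization. *)
Lemma mfun_indep : L1 P (fun w => X w * Y w)%R /\
  Ex P (fun w => X w * Y w)%R = (Ex P X * Ex P Y)%R.
Proof.
have eqm (f : R * R -> \bar R) :
    \int[PX \x PY]_z f z = \int[distribution P Z]_z f z.
  by apply: eq_measure_integral => A mA _; exact: joint_law.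
have l1 : L1 P (fun w => X w * Y w)%R.
  have mXY : measurable_fun setT (fun w => X w * Y w)%R by exact: measurable_funM.
  apply/integrableP; split; first exact/measurable_EFinP.
  have [_] := integrableP _ _ _ integrable_prod.
  rewrite eqm (ge0_integral_distribution Z)//.
  by apply: measurableT_comp.
split=> //; rewrite [LHS]/Ex /Rintegral.
have -> : \int[P]_w (X w * Y w)%:E =
    \int[distribution P Z]_z (z.1 * z.2)%:E.
  by rewrite integral_distribution.
rewrite -eqm -integral12_prod_meas1//=.
have h x : \int[PY]_y (x * y)%:E = (x * Ex P Y)%:E.
  under eq_integral => y _ do rewrite EFinM.
  rewrite integralZl// integral_distribution//=.
  by rewrite EFinM -Ex_EFin.
rewrite /fubini_F /=; under eq_integral => x _ do rewrite h mulrC EFinM.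
rewrite integralZl// integral_distribution//= Ex_EFin//.
by rewrite -EFinM /= mulrC.
Qed.

End ProductLaw.

Lemma L1_Ex_indep X Y :
  (forall A B : set R, measurable A -> measurable B ->
     P (X @^-1` A `&` Y @^-1` B) = (P (X @^-1` A) * P (Y @^-1` B))%E) ->
  L1 P X -> L1 P Y ->
  L1 P (fun w => X w * Y w) /\ Ex P (fun w => X w * Y w) = Ex P X * Ex P Y.
Proof.
move=> XY lX lY.
pose X' := mfun_Sub (mem_set (L1_measurable lX)).
pose Y' := mfun_Sub (mem_set (L1_measurable lY)).
exact: (@mfun_indep X' Y').
Qed.

End Independence.

(** * Moments of Gaussian variables *)

Section NormalLaw.
Context {R : realType}.
Local Notation mu := (@lebesgue_measure R).

(** The Radon-Nikodym derivative of [normal_prob 0 s] agrees almost everywhere with [normal_pdf],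
    since both have the same integral over every measurable set. *)
Lemma ge0_integral_normal_prob (s : R) (f : R -> \bar R) :
  measurable_fun setT f -> (forall x, 0 <= f x)%E ->
  (\int[normal_prob 0 s]_x f x = \int[mu]_x (f x * (normal_pdf 0 s x)%:E))%E.
Proof.
move=> mf f0.
have dom := @normal_prob_dominates R 0 s.
rewrite -(Radon_Nikodym_SigmaFinite.change_of_variables dom)//.
have iRN := Radon_Nikodym_SigmaFinite.f_integrable dom.
have mpdf : measurable_fun setT (EFin \o @normal_pdf R 0 s).
  by apply/measurable_EFinP; exact: measurable_normal_pdf.
apply: ae_eq_integral => //.
- by apply: emeasurable_funM => //; exact: measurable_int iRN.
- exact: emeasurable_funM.
- apply: ae_eqe_mul2l; apply: integral_ae_eq => // E _ mE.
  by rewrite -Radon_Nikodym_SigmaFinite.f_integral.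
Qed.

(* Multiplying a Gaussian density by [expR (k' x^2)] gives another Gaussian
   density up to a constant; all moment bounds below come from this. *)
Lemma normal_pdf_tilt (s k x : R) : 0 < s -> 0 < k ->
  expR ((1 - k ^- 2) / (s ^+ 2 *+ 2) * x ^+ 2) * normal_pdf 0 s x =
  k * normal_pdf 0 (k * s) x.
Proof.
move=> s0 k0; have ks0 : 0 < k * s by rewrite mulr_gt0.
rewrite !normal_pdfE ?gt_eqF//.
have -> : normal_peak (k * s) = k^-1 * normal_peak s.
  rewrite /normal_peak exprMn -mulrA -mulrnAr sqrtrM ?sqr_ge0//.
  by rewrite sqrtr_sqr gtr0_norm// invfM.
rewrite -(mulrA k^-1) mulVKf ?gt_eqF// mulrCA; congr (_ * _).
rewrite /normal_fun -expRD; congr expR; rewrite subr0.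
by field; rewrite ?gt_eqF.
Qed.

Lemma normal_prob_opp (s : R) (A : set R) : 0 < s -> measurable A ->
  normal_prob 0 s (-%R @^-1` A) = normal_prob 0 s A.
Proof.
move=> s0 mA; rewrite /normal_prob.
have even (x : R) : normal_pdf 0 s (- x) = normal_pdf 0 s x :> R.
  by rewrite !normal_pdfE ?gt_eqF// /normal_fun !subr0 sqrrN.
have mpdf : measurable_fun setT (EFin \o @normal_pdf R 0 s).
  by apply/measurable_EFinP; exact: measurable_normal_pdf.
under eq_integral do rewrite -even.
transitivity (\int[pushforward mu (-%R : _ -> measurableTypeR R)]_(x in A)
    (normal_pdf 0 s x)%:E)%E.
  rewrite ge0_integral_pushforward//; first exact: measurable_funTS.
  by move=> x _; rewrite lee_fin normal_pdf_ge0.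
by apply: eq_measure_integral => //= B mB _; exact: lebesgue_measureN.
Qed.

End NormalLaw.

Section GaussianMoments.
Context {d : measure_display} {T : measurableType d} {R : realType}.
Variable P : probability T R.
Local Notation mu := (@lebesgue_measure R).

Section NormalVariable.
Variables (X : {mfun T >-> R}) (s : R).
Hypothesis s0 : 0 < s.
Hypothesis lawX : forall B : set R, measurable B ->
  P (X @^-1` B) = normal_prob 0 s B.

Let integral_law (f : R -> \bar R) :
  measurable_fun setT f -> (forall x, 0 <= f x)%E ->
  (\int[P]_w f (X w) = \int[mu]_x (f x * (normal_pdf 0 s x)%:E))%E.
Proof.
move=> mf f0; rewrite -ge0_integral_normal_prob//.
pose PX := pushforward P (X : T -> measurableTypeR R).
transitivity (\int[PX]_x f x)%E.
  rewrite (@ge0_integral_pushforward _ _ _ (measurableTypeR R))//.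
  exact: (measurable_funP X).
apply: eq_measure_integral => [|mX A mA _]; last exact: lawX.
exact: (measurable_funP X).
Qed.

Let integral_tilt (k : R) : 0 < k ->
  (\int[P]_w (expR ((1 - k ^- 2) / (s ^+ 2 *+ 2) * X w ^+ 2))%:E = k%:E)%E.
Proof.
move=> k0; set c := _ / _.
have mf : measurable_fun setT (fun x : R => (expR (c * x ^+ 2))%:E).
  apply/measurable_EFinP; apply: measurableT_comp => //.
  by apply: measurable_funM => //; exact: measurable_funX.
rewrite (integral_law mf); last by move=> x; rewrite lee_fin expR_ge0.
under eq_integral do rewrite -EFinM normal_pdf_tilt// EFinM.
rewrite integralZl//; last exact: integrable_normal_pdf.
by rewrite integral_normal_pdf mule1.
Qed.

Let L1_tilt (k : R) : 0 < k ->
  L1 P (fun w => expR ((1 - k ^- 2) / (s ^+ 2 *+ 2) * X w ^+ 2)).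
Proof.
move=> k0; apply/integrableP; split.
  apply/measurable_EFinP; apply: measurableT_comp => //.
  by apply: measurable_funM => //; exact: measurable_funX.
under eq_integral do rewrite /= ger0_norm ?expR_ge0//.
by rewrite integral_tilt// ltry.
Qed.

Let Ex_tilt (k : R) : 0 < k ->
  Ex P (fun w => expR ((1 - k ^- 2) / (s ^+ 2 *+ 2) * X w ^+ 2)) = k.
Proof. by move=> k0; rewrite /Ex /Rintegral integral_tilt. Qed.

(** With [k = 2] the exponent is [y = 3 x^2 / (8 s^2)], so [x^4 = (64/9) s^4 y^2]. Squaring
    [y / 2 <= expR (y / 2)] gives [y^2 <= 4 expR y], and 29 exceeds 256/9. *)
Let tilt_bound (w : T) :
  X w ^+ 4 <= 29 * s ^+ 4 * expR ((1 - 2 ^- 2) / (s ^+ 2 *+ 2) * X w ^+ 2).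
Proof.
set y := _ * X w ^+ 2.
have y0 : 0 <= y.
  rewrite mulr_ge0 ?sqr_ge0// divr_ge0 ?mulrn_wge0 ?sqr_ge0//; lra.
have e1 : y ^+ 2 / 4 <= expR y.
  have -> : y = y / 2 + y / 2 by field.
  rewrite expRD; have := expR_ge1Dx (y / 2).
  by set E := expR _; nra.
have -> : X w ^+ 4 = s ^+ 4 * (64 / 9 * y ^+ 2).
  by rewrite /y; field; rewrite gt_eqF.
have -> : 29 * s ^+ 4 * expR y = s ^+ 4 * (29 * expR y) by ring.
rewrite ler_pM2l ?exprn_gt0//.
have := sqr_ge0 y; lra.
Qed.

Lemma normal_var_L4 : L1 P (fun w => X w ^+ 4).
Proof.
apply: (@L1_dom _ _ _ _ _ (fun w => 29 * s ^+ 4 *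
  expR ((1 - 2 ^- 2) / (s ^+ 2 *+ 2) * X w ^+ 2))).
- exact: measurable_funX.
- by move=> w; rewrite ger0_norm ?tilt_bound// exprn_even_ge0.
- exact/L1Z/L1_tilt.
Qed.

Lemma normal_var_L2 : L2 P X.
Proof.
split=> //; apply: (@L1_dom _ _ _ _ _ (fun w => 1 + X w ^+ 4)).
- exact: measurable_funX.
- move=> w; rewrite ger0_norm ?sqr_ge0//.
  have -> : X w ^+ 4 = (X w ^+ 2) ^+ 2 by rewrite -exprM.
  by set z := X w ^+ 2; nra.
- by apply: L1D; [exact: L1_cst|exact: normal_var_L4].
Qed.

(** [X] and [- X] have the same law, so the mean equals its opposite. *)
Lemma normal_var_Ex : Ex P X = 0.
Proof.
have lX := L2_L1 normal_var_L2.
pose NX := mfun_Sub (mem_set (L1_measurable (L1N lX))).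
have lawN (B : set R) : measurable B -> P (NX @^-1` B) = normal_prob 0 s B.
  move=> mB; rewrite -normal_prob_opp// -lawX//.
  by rewrite -[X in measurable X]setTI; exact: oppr_measurable.
have h : Ex P X = Ex P (fun w => - X w).
  rewrite /Ex /Rintegral.
  rewrite -(@integral_distribution _ _ _ _ _ P X EFin)//.
  rewrite -(@integral_distribution _ _ _ _ _ P NX EFin)//; last exact: L1N.
  congr fine; apply: eq_measure_integral => A mA _ /=.
  by rewrite /distribution /pushforward lawX// -lawN.
by move: h; rewrite ExN//; lra.
Qed.

(** A crude substitute for the exact factor 3: the tilt [k = 2] gives [E X^4 <= 58 s^4], the tilt
    [k = 1/2] with [1 + y <= expR y] gives [s^2 <= 3 E X^2], and [522 = 58 * 9]. *)
Lemma normal_var_kurtosis :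
  Ex P (fun w => X w ^+ 4) <= 522 * Ex P (fun w => X w ^+ 2) ^+ 2.
Proof.
have [mX lX2] := normal_var_L2.
have h1 : Ex P (fun w => X w ^+ 4) <= 58 * s ^+ 4.
  have -> : 58 * s ^+ 4 = Ex P (fun w => 29 * s ^+ 4 *
      expR ((1 - 2 ^- 2) / (s ^+ 2 *+ 2) * X w ^+ 2)).
    by rewrite ExZ ?Ex_tilt//; [ring|exact: L1_tilt].
  by apply: le_Ex; [exact: normal_var_L4|exact/L1Z/L1_tilt|exact: tilt_bound].
have h2 : s ^+ 2 <= 3 * Ex P (fun w => X w ^+ 2).
  have k0 : 0 < 2^-1 :> R by [].
  have := Ex_tilt k0; set c := _ / _ => e.
  have cE : c = - (3 / 2) / s ^+ 2.
    by rewrite /c; field; rewrite gt_eqF.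
  have : 1 + c * Ex P (fun w => X w ^+ 2) <= 2^-1.
    rewrite -[leRHS]e -ExZ// -[X in X + _](Ex_cst P) -ExD.
    - apply: le_Ex => //; last by move=> w; exact: expR_ge1Dx.
      + by apply: L1D; [exact: L1_cst|exact: L1Z].
      + exact: L1_tilt.
    - exact: L1_cst.
    - exact: L1Z.
  rewrite cE mulrAC; set m := Ex _ _ => h.
  have : 2^-1 <= 3 / 2 * m / s ^+ 2 by lra.
  by rewrite ler_pdivlMr ?exprn_gt0//; lra.
apply: (le_trans h1); have -> : s ^+ 4 = (s ^+ 2) ^+ 2 by rewrite -exprM.
have := sqr_ge0 s; set m := Ex _ _ in h2 *; set z := s ^+ 2 in h2 * => z0.
nra.
Qed.

End NormalVariable.

Lemma centered_gaussian_moments (X : T -> R) : centered_gaussian P X ->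
  [/\ L2 P X, L1 P (fun w => X w ^+ 4), Ex P X = 0 &
      Ex P (fun w => X w ^+ 4) <= 522 * Ex P (fun w => X w ^+ 2) ^+ 2].
Proof.
move=> [mX [X0|[s s0 lawX]]]; last first.
  pose X' : {mfun T >-> R} := mfun_Sub (mem_set mX).
  split; [exact: (@normal_var_L2 X' s)|exact: (@normal_var_L4 X' s)|
    exact: (@normal_var_Ex X' s)|exact: (@normal_var_kurtosis X' s)].
(* Degenerate law: [X] vanishes almost everywhere, hence so do its positive powers. *)
have zero (k : nat) : (0 < k)%N ->
    L1 P (fun w => X w ^+ k) /\ Ex P (fun w => X w ^+ k) = 0.
  move=> k0; have mXk : measurable_fun setT (fun w => X w ^+ k).
    exact: measurable_funX.
  have X0k : {ae P, forall w, X w ^+ k = 0}.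
    by apply: filterS X0 => w ->; rewrite expr0n gtn_eqF.
  have l : L1 P (fun w => X w ^+ k).
    apply/integrableP; split; first exact/measurable_EFinP.
    rewrite (@ae_eq_integral _ _ _ P setT (cst 0%E))//.
    - by rewrite integral0.
    - by apply: measurableT_comp => //; exact/measurable_EFinP.
    - by apply: filterS X0k => w h _ /=; rewrite h normr0.
  split=> //; rewrite -[RHS](Ex_cst P); apply: eq_Ex_ae => //.
  exact: L1_cst.
have [l1 e1] := zero 1%N isT; have [l2 e2] := zero 2%N isT.
have [l4 e4] := zero 4%N isT.
by split=> //; rewrite e4 e2 expr0n mulr0.
Qed.

End GaussianMoments.

(** * Convergence in probability *)

Section Truncation.
Context {d : measure_display} {T : measurableType d} {R : realType}.
Variable P : probability T R.
Implicit Types Q : T -> R.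

(* For [Q = |X_n - X|^2] this quantity metrizes convergence in probability. *)
Definition rho Q : R := Ex P (fun w => Num.min 1 (Q w)).

Lemma measurable_min1 Q : measurable_fun setT Q ->
  measurable_fun setT (fun w => Num.min 1 (Q w)).
Proof. by move=> mQ; apply: measurable_minr. Qed.

Lemma min1_bounded (x : R) : 0 <= x -> `|Num.min 1 x| <= 1.
Proof.
move=> x0; rewrite ger0_norm ?ge_min ?lexx//.
by rewrite le_min ler01.
Qed.

Lemma L1_min1 Q : measurable_fun setT Q -> (forall w, 0 <= Q w) ->
  L1 P (fun w => Num.min 1 (Q w)).
Proof.
move=> mQ Q0; apply: (@L1_bounded _ _ _ _ _ 1); first exact: measurable_min1.
by move=> w; exact: min1_bounded.
Qed.

Lemma rho_ge0 Q : (forall w, 0 <= Q w) -> 0 <= rho Q.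
Proof. by move=> Q0; apply: Ex_ge0 => w; rewrite le_min ler01/=. Qed.

Lemma rho_le Q Q' : measurable_fun setT Q -> measurable_fun setT Q' ->
  (forall w, 0 <= Q w) -> (forall w, Q w <= Q' w) -> rho Q <= rho Q'.
Proof.
move=> mQ mQ' Q0 QQ'; apply: le_Ex.
- exact: L1_min1.
- by apply: L1_min1 => // w; exact: le_trans (QQ' w).
- by move=> w; rewrite le_min !ge_min lexx/= QQ' orbT.
Qed.

Lemma rhoD Q Q' : measurable_fun setT Q -> measurable_fun setT Q' ->
  (forall w, 0 <= Q w) -> (forall w, 0 <= Q' w) ->
  rho (fun w => Q w + Q' w) <= rho Q + rho Q'.
Proof.
move=> mQ mQ' Q0 Q'0; rewrite /rho -ExD; try exact: L1_min1.
apply: le_Ex.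
- by apply: L1_min1 => [|w]; [exact: measurable_funD|exact: addr_ge0].
- by apply: L1D; exact: L1_min1.
- move=> w; have := Q0 w; have := Q'0 w.
  by rewrite /Num.min; do ! case: ifPn; rewrite -?leNgt; lra.
Qed.

Lemma rhoZ (c : R) Q : 1 <= c -> measurable_fun setT Q ->
  (forall w, 0 <= Q w) -> rho (fun w => c * Q w) <= c * rho Q.
Proof.
move=> c1 mQ Q0; rewrite /rho -ExZ; last exact: L1_min1.
apply: le_Ex.
- apply: L1_min1 => [|w]; first exact: measurable_funM.
  by rewrite mulr_ge0// (le_trans ler01).
- exact/L1Z/L1_min1.
- move=> w; have := Q0 w; rewrite /Num.min.
  by do ! case: ifPn; rewrite -?leNgt => *; nra.
Qed.

Lemma rho_sum (I : Type) (r : seq I) (Q : I -> T -> R) :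
  (forall i, measurable_fun setT (Q i)) -> (forall i w, 0 <= Q i w) ->
  rho (fun w => \sum_(i <- r) Q i w) <= \sum_(i <- r) rho (Q i).
Proof.
move=> mQ Q0; elim: r => [|i r IH].
  rewrite big_nil /rho (@eq_Ex _ _ _ _ _ (fun=> 0)) ?Ex_cst//.
  by move=> w; rewrite big_nil min_r// ler01.
rewrite big_cons; apply: (@le_trans _ _
    (rho (fun w => Q i w + \sum_(j <- r) Q j w))).
  rewrite le_eqVlt; apply/orP; left; apply/eqP; apply: eq_Ex => w.
  by rewrite big_cons.
apply: (le_trans (rhoD _ _ _ _)) => //.
- by apply: measurable_sum => j; exact: mQ.
- by move=> w; apply: sumr_ge0 => j _; exact: Q0.
- by rewrite lerD2l.
Qed.

Lemma rho_Ex Q : L1 P Q -> (forall w, 0 <= Q w) -> rho Q <= Ex P Q.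
Proof.
move=> lQ Q0; apply: le_Ex => //; last by move=> w; rewrite ge_min lexx orbT.
by apply: L1_min1 => //; exact: L1_measurable lQ.
Qed.

Definition Pr (B : set T) : R := Ex P \1_B.

Lemma L1_indic (B : set T) : measurable B -> L1 P \1_B.
Proof.
by move=> mB; apply: (@L1_bounded _ _ _ _ _ 1) => // w;
  rewrite indicE; case: (_ \in _); rewrite ?normr1 ?normr0.
Qed.

Lemma PrE (B : set T) : measurable B -> P B = (Pr B)%:E.
Proof.
move=> mB; rewrite /Pr -Ex_EFin; last exact: L1_indic.
by rewrite integral_indic// setIT.
Qed.

(** An exceptional event costs only its probability, because the integrand of [rho] is at most 1. *)
Lemma rho_off_rho (B : set T) Q Q' : measurable B -> measurable_fun setT Q ->
  measurable_fun setT Q' -> (forall w, 0 <= Q w) -> (forall w, 0 <= Q' w) ->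
  (forall w, ~ B w -> Q w <= Q' w) -> rho Q <= Pr B + rho Q'.
Proof.
move=> mB mQ mQ' Q0 Q'0 QQ'; rewrite /rho /Pr -ExD//; last 2 first.
  exact: L1_indic.
  exact: L1_min1.
apply: le_Ex; [exact: L1_min1|apply: L1D; [exact: L1_indic|exact: L1_min1]|].
move=> w; rewrite indicE; have [Bw|Bw] := pselect (B w).
  rewrite mem_set//= ge_min; apply/orP; left.
  by rewrite lerDl le_min ler01 Q'0.
by rewrite memNset//= add0r le_min !ge_min lexx QQ' ?orbT.
Qed.

Lemma rho_off (B : set T) Q Q' : measurable B -> measurable_fun setT Q ->
  L1 P Q' -> (forall w, 0 <= Q w) -> (forall w, 0 <= Q' w) ->
  (forall w, ~ B w -> Q w <= Q' w) -> rho Q <= Pr B + Ex P Q'.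
Proof.
move=> mB mQ lQ' Q0 Q'0 QQ'; rewrite /rho /Pr -ExD//; last exact: L1_indic.
apply: le_Ex; [exact: L1_min1|by apply: L1D => //; exact: L1_indic|].
move=> w; rewrite indicE; have [Bw|Bw] := pselect (B w).
  rewrite mem_set//= ge_min; apply/orP; left.
  by have := Q'0 w; lra.
by rewrite memNset//= add0r ge_min QQ' ?orbT.
Qed.

Lemma rho_eq_ae Q Q' : measurable_fun setT Q -> measurable_fun setT Q' ->
  (forall w, 0 <= Q w) -> (forall w, 0 <= Q' w) ->
  {ae P, forall w, Q w = Q' w} -> rho Q = rho Q'.
Proof.
move=> mQ mQ' Q0 Q'0 QQ'; apply: eq_Ex_ae; [exact: L1_min1..|].
by apply: filterS QQ' => w ->.
Qed.

Lemma rho_eq0 Q : measurable_fun setT Q -> (forall w, 0 <= Q w) ->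
  rho Q = 0 -> {ae P, forall w, Q w = 0}.
Proof.
move=> mQ Q0 r0; have l := L1_min1 mQ Q0.
have i0 : (\int[P]_w (Num.min 1 (Q w))%:E = 0)%E by rewrite Ex_EFin// -/(rho Q) r0.
have m1 : measurable_fun setT (fun w => (Num.min 1 (Q w))%:E).
  by apply/measurable_EFinP; exact: measurable_min1.
have : (\int[P]_w `|(Num.min 1 (Q w))%:E| = 0)%E.
  rewrite -[RHS]i0; apply: eq_integral => w _.
  by rewrite gee0_abs// lee_fin le_min ler01/=.
move=> /(ae_eq_integral_abs P measurableT m1).
apply: filterS => w /(_ I) [] /=; have := Q0 w.
by rewrite /Num.min; case: ifPn; rewrite -?leNgt; lra.
Qed.

(** One-sided: it is applied to nonnegative sequences, where it means convergence to 0, and only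
    upper bounds have to be proved. *)
Definition null_seq (r : nat -> R) : Prop :=
  forall e, 0 < e -> exists M, forall n, (M <= n)%N -> r n <= e.

Lemma Ex_null_seq (X : nat -> T -> R) :
  (forall n, measurable_fun setT (X n)) -> (forall n w, 0 <= X n w <= 1) ->
  (forall w, null_seq (X ^~ w)) -> null_seq (fun n => Ex P (X n)).
Proof.
move=> mX X01 X0 e e0.
have cX w : X n w @[n --> \oo] --> (0 : R).
  apply/cvgrPdist_le => /= u u0; have [M hM] := X0 w u u0.
  near=> n; rewrite sub0r normrN ger0_norm; last by case/andP: (X01 n w).
  by apply: hM; near: n; exact: nbhs_infty_ge.
have [] := @dominated_convergence _ _ _ P setT measurableT
  (fun n w => (X n w)%:E) (cst 0%E) (cst 1%E).
- by move=> n; exact/measurable_EFinP.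
- exact: measurable_cst.
- by apply: aeW => w _; apply/fine_cvgP; split; [exact: nearW|exact: cX].
- exact: (finite_measure_integrable_cst P 1).
- apply: aeW => w n _; rewrite lee_fin ger0_norm; by case/andP: (X01 n w).
move=> _ _; rewrite integral0 => /fine_cvg /cvgrPdist_le /(_ e e0) [M _ hM].
exists M => n /hM /=; rewrite sub0r normrN.
exact: le_trans (ler_norm _).
Unshelve. all: by end_near. Qed.

(** Truncation at 1 supplies the dominating function, so pointwise convergence suffices without
    integrability. *)
Lemma rho_null_pointwise (Q : nat -> T -> R) :
  (forall n, measurable_fun setT (Q n)) -> (forall n w, 0 <= Q n w) ->
  (forall w, null_seq (Q ^~ w)) -> null_seq (fun n => rho (Q n)).
Proof.
move=> mQ Q0 h; apply: Ex_null_seq.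
- by move=> n; exact: measurable_min1.
- by move=> n w; rewrite le_min ler01 Q0/= ge_min lexx.
- move=> w e e0; have [M hM] := h w e e0; exists M => n /hM.
  by rewrite ge_min => ->; rewrite orbT.
Qed.

Lemma Pr_null_pointwise (B : nat -> set T) : (forall n, measurable (B n)) ->
  (forall w, exists M, forall n, (M <= n)%N -> ~ B n w) ->
  null_seq (fun n => Pr (B n)).
Proof.
move=> mB h; apply: Ex_null_seq.
- by move=> n; exact: measurable_indic.
- by move=> n w; rewrite indicE; case: (_ \in _); rewrite ?lexx ?ler01.
- move=> w e e0; have [M hM] := h w; exists M => n /hM Bn.
  by rewrite indicE memNset//= ltW.
Qed.

(** Off the event [e / 2 <= |Y n - Z|] the distance is below [e / 2], and the probability of that
    event is eventually at most [e / 2]. *)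
Lemma rho_null_in_prob (Y : nat -> T -> R) (Z : T -> R) :
  (forall n, measurable_fun setT (Y n)) -> measurable_fun setT Z ->
  cvg_in_prob P Y Z -> null_seq (fun n => rho (fun w => `|Y n w - Z w|)).
Proof.
move=> mY mZ h e e0.
have e20 : 0 < e / 2 by lra.
have mD n : measurable_fun setT (fun w => `|Y n w - Z w|).
  by apply: measurableT_comp => //; exact: measurable_funB.
have mB n : measurable [set w | e / 2 <= `|Y n w - Z w|].
  have := mD n measurableT _ (measurable_itv `[e / 2, +oo[).
  rewrite setTI; congr measurable; apply/seteqP; split=> w /=;
  by rewrite in_itv/= andbT.
have := h _ e20; under eq_fun do rewrite PrE//.
move=> /fine_cvg /cvgrPdist_le /(_ _ e20) [M _ hM].
exists M => n /hM /=; rewrite sub0r normrN => hn.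
have -> : e = e / 2 + e / 2 by field.
apply: (le_trans (@rho_off _ _ (fun=> e / 2) (mB n) _ _ _ _ _)) => //.
- exact: L1_cst.
- by move=> w; exact: ltW.
- by move=> w /negP; rewrite -ltNge => /ltW.
- by rewrite Ex_cst lerD2r (le_trans (ler_norm _)).
Qed.

End Truncation.

(** * The Cayley transform *)

Section Norms.
Context {R : realFieldType}.

(** Expanding [sum_i (q a_i - s b_i)^2 >= 0] gives [q (q p - s^2) >= 0]; when [q = 0] all [b i]
    vanish. *)
Lemma CauchySchwarz_sum (I : finType) (a b : I -> R) :
  (\sum_i a i * b i) ^+ 2 <= (\sum_i a i ^+ 2) * (\sum_i b i ^+ 2).
Proof.
set s := \sum_i _ * _; set p := \sum_i a i ^+ 2; set q := \sum_i b i ^+ 2.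
have q0 : 0 <= q by apply: sumr_ge0 => i _; exact: sqr_ge0.
have h : 0 <= \sum_i (q * a i - s * b i) ^+ 2.
  by apply: sumr_ge0 => i _; exact: sqr_ge0.
have e : \sum_i (q * a i - s * b i) ^+ 2 = q * (q * p - s ^+ 2).
  have -> : \sum_i (q * a i - s * b i) ^+ 2 =
      \sum_i (q ^+ 2 * a i ^+ 2 - (2 * q * s) * (a i * b i) + s ^+ 2 * b i ^+ 2).
    by apply: eq_bigr => i _; ring.
  by rewrite big_split/= sumrB -!mulr_sumr -/p -/q -/s; ring.
move: h; rewrite e; move: q0; rewrite le_eqVlt => /orP[/eqP q0 _|q0 h].
  have b0 i : b i = 0.
    apply/eqP; rewrite -sqrf_eq0; apply/eqP.
    by apply: (psumr_eq0P _ (esym q0)) => // j _; exact: sqr_ge0.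
  by rewrite /s big1 ?expr0n -?q0 ?mulr0// => i _; rewrite b0 mulr0.
by rewrite -subr_ge0 mulrC -(pmulr_rge0 _ q0).
Qed.

Lemma sqr_sum_le (I : finType) (a : I -> R) :
  (\sum_i a i) ^+ 2 <= #|I|%:R * \sum_i a i ^+ 2.
Proof.
have := CauchySchwarz_sum a (fun=> 1).
under eq_bigr do rewrite mulr1.
by under [X in _ * X]eq_bigr do rewrite expr1n; rewrite sumr_const mulrC.
Qed.

Context {D : nat}.
Implicit Types (u v : 'cV[R]_D) (B : 'M[R]_D).

(** Norms are kept squared, so that all estimates stay polynomial and can be integrated directly. *)
Definition nsq v : R := \sum_i v i 0 ^+ 2.
Definition fsq B : R := \sum_i \sum_j B i j ^+ 2.

Lemma nsqE v : nsq v = (v^T *m v) 0 0.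
Proof. by rewrite mxE; apply: eq_bigr => i _; rewrite mxE expr2. Qed.

Lemma nsq_ge0 v : 0 <= nsq v.
Proof. by apply: sumr_ge0 => i _; exact: sqr_ge0. Qed.

Lemma fsq_ge0 B : 0 <= fsq B.
Proof. by apply: sumr_ge0 => i _; apply: sumr_ge0 => j _; exact: sqr_ge0. Qed.

Lemma sqr_le_nsq v i : v i 0 ^+ 2 <= nsq v.
Proof.
by rewrite /nsq (bigD1 i)//= lerDl; apply: sumr_ge0 => k _; exact: sqr_ge0.
Qed.

Lemma nsqD u v : nsq (u + v) <= 2 * nsq u + 2 * nsq v.
Proof.
rewrite /nsq !mulr_sumr -big_split/=; apply: ler_sum => i _; rewrite mxE.
by have := sqr_ge0 (u i 0 - v i 0); nra.
Qed.

Lemma nsqZ c v : nsq (c *: v) = c ^+ 2 * nsq v.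
Proof.
by rewrite /nsq mulr_sumr; apply: eq_bigr => i _; rewrite mxE exprMn.
Qed.

Lemma nsqN v : nsq (- v) = nsq v.
Proof. by apply: eq_bigr => i _; rewrite mxE sqrrN. Qed.

Lemma nsq0 : nsq 0 = 0.
Proof. by rewrite /nsq big1// => i _; rewrite mxE expr0n. Qed.

Lemma nsq_eq0 v : nsq v = 0 -> v = 0.
Proof.
move=> h; apply/colP => i; rewrite mxE.
apply/eqP; rewrite -sqrf_eq0; apply/eqP.
by apply: (psumr_eq0P _ h) => // j _; exact: sqr_ge0.
Qed.

Lemma nsq_mulmx B v : nsq (B *m v) <= fsq B * nsq v.
Proof.
rewrite /fsq mulr_suml; apply: ler_sum => i _; rewrite mxE.
exact: CauchySchwarz_sum.
Qed.

Lemma nsq_orthogonal B v : B^T *m B = 1%:M -> nsq (B *m v) = nsq v.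
Proof. by move=> oB; rewrite !nsqE trmx_mul mulmxA -(mulmxA v^T) oB mulmx1. Qed.

Lemma nsqB u v : nsq (u - v) = nsq u + nsq v - 2 * (u^T *m v) 0 0.
Proof.
rewrite mxE mulr_sumr /nsq -big_split -sumrB/=; apply: eq_bigr => i _.
by rewrite !mxE; ring.
Qed.

Lemma nsq_sum (I : finType) (f : I -> 'cV[R]_D) :
  nsq (\sum_i f i) <= #|I|%:R * \sum_i nsq (f i).
Proof.
rewrite /nsq exchange_big/= mulr_sumr; apply: ler_sum => i _.
by rewrite summxE; exact: sqr_sum_le.
Qed.

Lemma fsqN B : fsq (- B) = fsq B.
Proof.
by apply: eq_bigr => i _; apply: eq_bigr => j _; rewrite mxE sqrrN.
Qed.

End Norms.

Section Cayley.
Context {R : realFieldType} {D : nat}.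
Implicit Types (v : 'cV[R]_D) (B : 'M[R]_D).

Definition half B := 2^-1 *: B.
Definition cayley B : 'M[R]_D := invmx (1%:M - half B) *m (1%:M + half B).

Lemma antisym_form B v : B^T = - B -> v^T *m B *m v = 0.
Proof.
move=> aB; set x := v^T *m B *m v.
have xT : x^T = - x by rewrite /x !trmx_mul trmxK aB mulNmx mulmxN -mulmxA.
have e : x 0 0 = - x 0 0.
  by have := congr1 (fun M : 'M[R]_1 => M 0 0) xT; rewrite [LHS]mxE [RHS]mxE.
by apply/matrixP => i j; rewrite !ord1 [RHS]mxE; lra.
Qed.

Lemma nsq_1B B v : B^T = - B -> nsq ((1%:M - B) *m v) = nsq v + nsq (B *m v).
Proof.
move=> aB; rewrite mulmxBl mul1mx nsqB mulmxA antisym_form// mxE.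
by rewrite mulr0 subr0.
Qed.

(** [|(1 - B) v|^2 = |v|^2 + |B v|^2] by [nsq_1B], so the kernel is trivial. [kermx] consists of row
    vectors, whence the passage to [u^T] and [- B]. *)
Lemma unitmx_1B B : B^T = - B -> 1%:M - B \in unitmx.
Proof.
move=> aB; rewrite -row_free_unit -kermx_eq0; apply/rowV0P => u /sub_kermxP uB.
have e : (1%:M - (- B)) *m u^T = 0.
  by rewrite -aB -(trmx1 _ D) -linearB/= -trmx_mul uB trmx0.
have := nsq_1B u^T (_ : (- B)^T = - - B); rewrite e nsq0 linearN/= aB => /(_ erefl).
have := nsq_ge0 u^T; have := nsq_ge0 (- B *m u^T) => h1 h2 h3.
have /nsq_eq0 : nsq u^T = 0 by lra.
by move=> /(congr1 trmx); rewrite trmxK trmx0.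
Qed.

Lemma unitmx_1D B : B^T = - B -> 1%:M + B \in unitmx.
Proof.
move=> aB; have aN : (- B)^T = - - B by rewrite linearN/= aB.
by rewrite -[X in _ + X]opprK; exact: unitmx_1B.
Qed.

Lemma nsq_inv1B B v : B^T = - B -> nsq (invmx (1%:M - B) *m v) <= nsq v.
Proof.
move=> aB; have uB := unitmx_1B aB.
rewrite -[X in _ <= nsq X](mulKVmx uB v) (nsq_1B _ aB) lerDl.
exact: nsq_ge0.
Qed.

Lemma tr_half B : B^T = - B -> (half B)^T = - half B.
Proof. by move=> aB; rewrite /half linearZ/= aB scalerN. Qed.

Lemma halfE B : B = half B + half B.
Proof. by rewrite /half -scalerDl -[LHS]scale1r; congr (_ *: _); field. Qed.

(** Transposition exchanges [1 - h] and [1 + h]; these commute, and so do their inverses. *)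
Lemma cayley_orthogonal B : B^T = - B -> (cayley B)^T *m cayley B = 1%:M.
Proof.
move=> aB; have ah := tr_half aB; rewrite /cayley; set h := half B in ah *.
have u1 := unitmx_1B ah.
have u2 : 1%:M + h \in unitmx.
  exact: unitmx_1D.
rewrite trmx_mul trmx_inv linearB linearD/= !trmx1 ah opprK.
have cm : invmx (1%:M + h) *m invmx (1%:M - h) =
    invmx (1%:M - h) *m invmx (1%:M + h).
  have c : (1%:M - h) *m (1%:M + h) = (1%:M + h) *m (1%:M - h).
    rewrite mulmxBl mulmxDl !mulmxDr !mulmxN !mul1mx !mulmx1.
    by move: (h *m h) => X; apply/matrixP => i j; rewrite !mxE; ring.
  apply: (can_inj (mulKmx u1)); apply: (can_inj (mulKmx u2)).
  by rewrite (mulKVmx u1) (mulmxV u2) mulmxA -c -mulmxA (mulKVmx u2) mulmxV.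
rewrite !mulmxA -(mulmxA (1%:M - h)) cm !mulmxA mulmxV// mul1mx.
exact: mulVmx.
Qed.

Lemma cayley_sub1 B : B^T = - B ->
  cayley B - 1%:M = invmx (1%:M - half B) *m B.
Proof.
move=> aB; have u := unitmx_1B (tr_half aB).
rewrite -{1}(mulVmx u) /cayley -mulmxBr; congr (_ *m _).
by apply/matrixP => i j; rewrite [in RHS](halfE B) !mxE; ring.
Qed.

Lemma nsq_cayley_sub1 B v : B^T = - B ->
  nsq ((cayley B - 1%:M) *m v) <= fsq B * nsq v.
Proof.
move=> aB; rewrite cayley_sub1// -mulmxA.
apply: (le_trans (nsq_inv1B _ (tr_half aB))); exact: nsq_mulmx.
Qed.

Lemma tr_cayley B : B^T = - B -> (cayley B)^T = cayley (- B).
Proof.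
move=> aB; have o := cayley_orthogonal aB.
have aN : (- B)^T = - - B by rewrite linearN/= aB.
have o' : cayley (- B) *m cayley B = 1%:M.
  rewrite /cayley /half scalerN opprK -/(half B); set h := half B.
  have ah := tr_half aB; have u1 := unitmx_1B ah.
  have u2 : 1%:M + h \in unitmx.
    exact: unitmx_1D.
  by rewrite -mulmxA (mulmxA (1%:M - h)) mulmxV// mul1mx mulVmx.
have uE : cayley B \in unitmx by case/mulmx1_unit: o.
by apply: (can_inj (mulmxK uE)); rewrite o.
Qed.

Lemma nsq_tr_cayley_sub1 B v : B^T = - B ->
  nsq (((cayley B)^T - 1%:M) *m v) <= fsq B * nsq v.
Proof.
move=> aB; rewrite tr_cayley// -(fsqN B); apply: nsq_cayley_sub1.
by rewrite linearN/= aB.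
Qed.

Definition cayley_rem B : 'M[R]_D := cayley B - 1%:M - B - 2^-1 *: (B *m B).

(** Multiplying by [1 - B / 2] turns the second-order remainder into exactly [B^3 / 4]. The inverse
    being a contraction, the resulting bound holds for every antisymmetric [B], however large. *)
Lemma cayley_remE B : B^T = - B ->
  cayley_rem B = invmx (1%:M - half B) *m (4^-1 *: (B *m B *m B)).
Proof.
move=> aB; have u := unitmx_1B (tr_half aB).
apply: (can_inj (mulKmx u)); rewrite mulKVmx//.
rewrite /cayley_rem cayley_sub1// !mulmxBr mulKVmx// !mulmxBl !mul1mx.
rewrite /half -!scalemxAl -!scalemxAr -!mulmxA.
set X := B *m B; set Y := B *m X.
by apply/matrixP => i j; rewrite !mxE; field.
Qed.

Lemma nsq_cayley_rem B v : B^T = - B ->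
  nsq (cayley_rem B *m v) <= fsq B ^+ 3 * nsq v.
Proof.
move=> aB; rewrite cayley_remE// -[_ *m v]mulmxA.
apply: (le_trans (nsq_inv1B _ (tr_half aB))).
rewrite -scalemxAl nsqZ -!mulmxA.
have f0 := fsq_ge0 B; have v0 := nsq_ge0 v.
have h1 := nsq_mulmx B v; have h2 := nsq_mulmx B (B *m v).
have h3 := nsq_mulmx B (B *m (B *m v)).
have h : nsq (B *m (B *m (B *m v))) <= fsq B ^+ 3 * nsq v.
  apply: (le_trans h3); rewrite exprS -mulrA ler_wpM2l//.
  by apply: (le_trans h2); rewrite expr2 -mulrA ler_wpM2l.
have n0 := nsq_ge0 (B *m (B *m (B *m v))).
lra.
Qed.

End Cayley.

(** * Martingale transforms *)

Section Adapted.
Context {d : measure_display} {T : measurableType d} {R : realType}.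
Implicit Types (G : set (set T)) (X : T -> R).

(** Going through [g_sigma_algebraType] makes every closure lemma on [measurable_fun] available for
    adaptedness. *)
Definition mes_wrt G X : Prop :=
  measurable_fun [set: g_sigma_algebraType G] (X : g_sigma_algebraType G -> R).

Lemma mes_wrtP G X : sigma_algebra setT G ->
  mes_wrt G X <-> forall B : set R, measurable B -> G (X @^-1` B).
Proof.
move=> sG; split=> [mX B mB|h _ B mB].
  have := mX measurableT B mB; rewrite setTI.
  by rewrite /measurable/= sigma_algebra_id.
by rewrite setTI; apply: sub_sigma_algebra; exact: h.
Qed.

Lemma mes_wrt_sub G G' X : G `<=` G' -> mes_wrt G X -> mes_wrt G' X.
Proof.
move=> GG' mX _ B mB; have := mX measurableT B mB.
have h : <<s G >> `<=` <<s G' >>.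
  apply: smallest_sub; first exact: smallest_sigma_algebra.
  by move=> A /GG'; exact: sub_sigma_algebra.
exact: h.
Qed.

Lemma mes_wrt_measurable G X : G `<=` measurable -> mes_wrt G X ->
  measurable_fun setT X.
Proof.
move=> Gm mX _ B mB; have := mX measurableT B mB.
apply: smallest_sub => //; exact: sigma_algebra_measurable.
Qed.

End Adapted.

Section MartingaleTransform.
Context {d : measure_display} {T : measurableType d} {R : realType}.
Variable P : probability T R.
Variable F : R -> set (set T).
Hypothesis hF : is_filtration F.

Lemma mes_wrt_filtration s t (X : T -> R) : 0 <= s -> s <= t ->
  mes_wrt (F s) X -> mes_wrt (F t) X.
Proof. by move=> s0 st; apply: mes_wrt_sub; exact: (hF.2). Qed.

Lemma mes_filtration s (X : T -> R) : 0 <= s ->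
  mes_wrt (F s) X -> measurable_fun setT X.
Proof. by move=> s0; apply: mes_wrt_measurable; case: (hF.1 _ s0). Qed.

(** Stands in for conditional expectations: [noise_Ex] says [E [Y | F s] = 0] and [noise_sqr] says
    [E [Y^2 | F s] <= kappa], both tested against past variables. *)
Record noise (s t kappa : R) (Y : T -> R) : Prop := Noise {
  noise_mes : mes_wrt (F t) Y;
  noise_L2 : L2 P Y;
  noise_Ex : forall X, mes_wrt (F s) X -> L2 P X ->
    Ex P (fun w => X w * Y w) = 0;
  noise_sqr : forall X c, mes_wrt (F s) X -> (forall w, `|X w| <= c) ->
    Ex P (fun w => (X w * Y w) ^+ 2) <= kappa * Ex P (fun w => X w ^+ 2) }.

Lemma noise_comb_Ex (I : finType) (s t kappa c : R) (Y g : I -> T -> R) :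
  0 <= s -> 0 <= kappa -> (forall i, noise s t kappa (Y i)) ->
  (forall i, mes_wrt (F s) (g i)) -> (forall i w, `|g i w| <= c) ->
  Ex P (fun w => (\sum_i g i w * Y i w) ^+ 2) <=
  #|I|%:R * kappa * \sum_i Ex P (fun w => g i w ^+ 2).
Proof.
move=> s0 k0 nY mg gc.
have L2gY i : L2 P (fun w => g i w * Y i w).
  apply: (@L2bM _ _ _ _ _ _ c) => //; first exact: mes_filtration s0 (mg i).
  exact: noise_L2 (nY i).
have L1gY i : L1 P (fun w => (g i w * Y i w) ^+ 2) by case: (L2gY i).
apply: (@le_trans _ _ (Ex P (fun w => #|I|%:R * \sum_i (g i w * Y i w) ^+ 2))).
  apply: le_Ex; last by move=> w; exact: sqr_sum_le.
  - have [] // : L2 P (fun w => \sum_i g i w * Y i w).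
    by apply: L2_sum => i _; exact: L2gY.
  - by apply: L1Z; apply: L1_sum.
rewrite ExZ; last exact: L1_sum.
rewrite -mulrA ler_wpM2l// Ex_sum// mulr_sumr; apply: ler_sum => i _.
exact: (noise_sqr (nY i) (mg i) (gc i)).
Qed.

(** Past coefficients keep the combination centred given the past; the constant comes from [(sum_i
    g_i Y_i)^2 <= |I| sum_i (g_i Y_i)^2]. *)
Lemma noise_comb (I : finType) (s t kappa M : R) (Y g : I -> T -> R) :
  0 <= s -> s <= t -> 0 <= kappa -> (forall i, noise s t kappa (Y i)) ->
  (forall i, mes_wrt (F s) (g i)) -> (forall w, \sum_i g i w ^+ 2 <= M) ->
  noise s t (#|I|%:R * kappa * M) (fun w => \sum_i g i w * Y i w).
Proof.
move=> s0 st k0 nY mg gM.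
(* [x <= x^2 + 1] turns a bound on the square into one on the absolute value. *)
have gc i w : `|g i w| <= M + 1.
  have : g i w ^+ 2 <= M.
    apply: le_trans (gM w); rewrite (bigD1 i)//= lerDl.
    by apply: sumr_ge0 => j _; exact: sqr_ge0.
  have := normr_ge0 (g i w); rewrite -(real_normK (num_real (g i w))).
  by set x := `|_|; nra.
have mg' i : measurable_fun setT (g i) by exact: mes_filtration s0 (mg i).
have L2gY i : L2 P (fun w => g i w * Y i w).
  by apply: (@L2bM _ _ _ _ _ _ (M + 1)) => //; exact: noise_L2 (nY i).
split.
- apply: measurable_sum => i; apply: measurable_funM.
    exact: mes_wrt_filtration s0 st (mg i).
  exact: noise_mes (nY i).
- by apply: L2_sum => i _.
- move=> X mX lX.
  rewrite (@eq_Ex _ _ _ _ _ (fun w => \sum_i (g i w * X w) * Y i w)).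
    rewrite Ex_sum => [|i _]; last first.
      apply: L2M; last exact: noise_L2 (nY i).
      exact: (@L2bM _ _ _ _ _ _ (M + 1)).
    apply: big1 => i _; apply: (noise_Ex (nY i)).
      by apply: measurable_funM => //; exact: mg.
    exact: (@L2bM _ _ _ _ _ _ (M + 1)).
  by move=> w; rewrite mulr_sumr; apply: eq_bigr => i _; ring.
- move=> X c mX Xc.
  have mX' : measurable_fun setT X by exact: mes_filtration s0 mX.
  have lX : L2 P X by exact: L2_bounded mX' Xc.
  have mXg i : mes_wrt (F s) (fun w => X w * g i w).
    by apply: measurable_funM => //; exact: mg.
  rewrite (@eq_Ex _ _ _ _ _ (fun w => (\sum_i (X w * g i w) * Y i w) ^+ 2)).
    apply: (le_trans (@noise_comb_Ex I s t kappa (c * (M + 1)) _ _ s0 k0 nY mXg _)).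
      by move=> i w; rewrite normrM ler_pM.
    have l1 i : L1 P (fun w => (X w * g i w) ^+ 2).
      have [] // : L2 P (fun w => X w * g i w).
      apply: (@L2_bounded _ _ _ _ _ (c * (M + 1))); first exact: measurable_funM.
      by move=> w; rewrite normrM ler_pM.
    rewrite -!mulrA; do 2 rewrite ler_wpM2l//.
    rewrite -Ex_sum// -ExZ; last by case: lX.
    apply: le_Ex; [exact: L1_sum|by apply: L1Z; case: lX|].
    move=> w; under eq_bigr do rewrite exprMn.
    by rewrite -mulr_sumr mulrC ler_wpM2r ?sqr_ge0.
  move=> w; congr (_ ^+ 2); rewrite mulr_sumr.
  by apply: eq_bigr => i _; rewrite mulrA.
Qed.

Section NoiseSum.
Variables (tau kappa : nat -> R) (Y : nat -> T -> R).
Hypothesis tau0 : forall k, 0 <= tau k.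
Hypothesis tauS : forall k, tau k <= tau k.+1.
Hypothesis noiseY : forall k, noise (tau k) (tau k.+1) (kappa k) (Y k).

Let S n w := \sum_(k < n) Y k w.

Let SS n : S n.+1 = (fun w => S n w + Y n w).
Proof. by apply/funext => w; rewrite /S big_ord_recr. Qed.

Let S0 : S 0 = (fun=> 0).
Proof. by apply/funext => w; rewrite /S big_ord0. Qed.

Let tau_ge n : tau 0 <= tau n.
Proof. by elim: n => // n IH; exact: le_trans (tauS n). Qed.

Let mS n : mes_wrt (F (tau n)) (S n).
Proof.
elim: n => [|n IH]; first by rewrite S0; exact: measurable_cst.
rewrite SS; apply: measurable_funD; last exact: noise_mes (@noiseY n).
exact: (mes_wrt_filtration (tau0 n) (tauS n) IH).
Qed.

Let lS n : L2 P (S n).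
Proof.
elim: n => [|n IH]; first by rewrite S0; exact: L2_cst.
by rewrite SS; apply: L2D => //; exact: noise_L2 (@noiseY n).
Qed.

(** The weight [X], known at the initial time, is carried along because [noise_sqr] of the whole sum
    requires it. The cross terms vanish since [X^2 S n] is known at time [tau n]. *)
Let orthogonal X c n : mes_wrt (F (tau 0)) X -> (forall w, `|X w| <= c) ->
  Ex P (fun w => (X w * S n w) ^+ 2) =
  \sum_(k < n) Ex P (fun w => (X w * Y k w) ^+ 2).
Proof.
move=> mX Xc; have mX' : measurable_fun setT X.
  exact: mes_filtration (tau0 0) mX.
elim: n => [|n IH].
  rewrite big_ord0 -[RHS](Ex_cst P); apply: eq_Ex => w.
  by rewrite S0 mulr0 expr0n.
rewrite big_ord_recr/= -IH.
have lXS : L2 P (fun w => X w * S n w) by exact: L2bM mX' Xc (lS n).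
have lY := noise_L2 (@noiseY n).
have lXY : L2 P (fun w => X w * Y n w) by exact: L2bM mX' Xc lY.
have lXXS : L2 P (fun w => X w * (X w * S n w)) by exact: L2bM mX' Xc lXS.
have cross : Ex P (fun w => 2 * ((X w * (X w * S n w)) * Y n w)) = 0.
  rewrite ExZ; last exact: L2M.
  rewrite (noise_Ex (@noiseY n)) ?mulr0//.
  have mXn : mes_wrt (F (tau n)) X.
    exact: (mes_wrt_filtration (tau0 0) (tau_ge n) mX).
  by do 2 apply: measurable_funM => //; exact: mS.
transitivity (Ex P (fun w => (X w * S n w) ^+ 2 +
    2 * ((X w * (X w * S n w)) * Y n w) + (X w * Y n w) ^+ 2)).
  by rewrite SS; apply: eq_Ex => w; ring.
have l2 : L1 P (fun w => 2 * ((X w * (X w * S n w)) * Y n w)).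
  by apply: L1Z; exact: L2M.
rewrite ExD; [|by apply: L1D => //; case: lXS|by case: lXY].
by rewrite ExD ?cross ?addr0//; case: lXS.
Qed.

Lemma noise_sum n :
  noise (tau 0) (tau n) (\sum_(k < n) kappa k) (fun w => \sum_(k < n) Y k w).
Proof.
split.
- exact: mS.
- exact: lS.
- move=> X mX lX; elim: n => [|n IH].
    rewrite -[RHS](Ex_cst P); apply: eq_Ex => w.
    by rewrite big_ord0 mulr0.
  transitivity (Ex P (fun w => X w * S n w + X w * Y n w)).
    by apply: eq_Ex => w; rewrite -/(S n.+1 w) SS mulrDr.
  have lY := noise_L2 (@noiseY n).
  rewrite ExD; [|exact: L2M|exact: L2M].
  rewrite IH (noise_Ex (@noiseY n)) ?addr0//.
  exact: (mes_wrt_filtration (tau0 0) (tau_ge n) mX).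
- move=> X c mX Xc; rewrite (orthogonal n mX Xc) mulr_suml.
  apply: ler_sum => k _; apply: (noise_sqr (@noiseY k)) Xc.
  exact: (mes_wrt_filtration (tau0 0) (tau_ge k) mX).
Qed.

Lemma noise_sum_Ex n : Ex P (fun w => (\sum_(k < n) Y k w) ^+ 2) =
  \sum_(k < n) Ex P (fun w => Y k w ^+ 2).
Proof.
have := @orthogonal (fun=> 1) 1 n (@measurable_cst _ _ _ _ _ _).
under eq_Ex do rewrite mul1r.
move=> -> //; last by move=> w; rewrite normr1.
by apply: eq_bigr => k _; apply: eq_Ex => w; rewrite mul1r.
Qed.

End NoiseSum.

Lemma noise_Ex_sqr s t kappa Y : noise s t kappa Y ->
  Ex P (fun w => Y w ^+ 2) <= kappa.
Proof.
move=> nY; have := @noise_sqr _ _ _ _ nY (fun=> 1) 1 (@measurable_cst _ _ _ _ _ _).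
rewrite (@eq_Ex _ _ _ _ (fun w => (1 * Y w) ^+ 2) (fun w => Y w ^+ 2)); last first.
  by move=> w; rewrite mul1r.
by rewrite expr1n Ex_cst mulr1; apply => w; rewrite normr1.
Qed.

End MartingaleTransform.

(** * Measurability of matrix operations *)

Section MatrixMeasurable.
Context {d : measure_display} {T : measurableType d} {R : realType}.

Lemma measurable_prodr (I : Type) (r : seq I) (f : I -> T -> R) :
  (forall i, measurable_fun setT (f i)) ->
  measurable_fun setT (fun w => \prod_(i <- r) f i w).
Proof.
move=> mf; elim: r => [|i r IH].
  by under eq_fun do rewrite big_nil; exact: measurable_cst.
by under eq_fun do rewrite big_cons; exact: measurable_funM.
Qed.

(** [x * expR (- ln (x^2))] is [x^-1] for nonzero [x], and at 0 both sides are 0. *)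
Lemma measurable_funV (f : T -> R) : measurable_fun setT f ->
  measurable_fun setT (fun w => (f w)^-1).
Proof.
move=> mf.
have -> : (fun w => (f w)^-1) = (fun w => f w * expR (- ln (f w ^+ 2))).
  apply/funext => w; have [->|f0] := eqVneq (f w) 0; first by rewrite invr0 mul0r.
  rewrite expRN lnK ?posrE ?exprn_even_gt0//.
  by field.
apply: measurable_funM => //; apply: measurableT_comp => //.
apply: measurableT_comp => //; apply: measurableT_comp => //.
exact: measurable_funX.
Qed.

Definition mx_measurable (m n : nat) (M : T -> 'M[R]_(m, n)) : Prop :=
  forall i j, measurable_fun setT (fun w => M w i j).

Lemma mx_measurable_cst m n (M : 'M[R]_(m, n)) : mx_measurable (fun=> M).
Proof. by move=> i j; exact: measurable_cst. Qed.

Lemma mx_measurableD m n (M M' : T -> 'M[R]_(m, n)) :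
  mx_measurable M -> mx_measurable M' -> mx_measurable (fun w => M w + M' w).
Proof.
move=> mM mM' i j; under eq_fun do rewrite mxE.
by apply: measurable_funD; [exact: mM|exact: mM'].
Qed.

Lemma mx_measurableZ m n (f : T -> R) (M : T -> 'M[R]_(m, n)) :
  measurable_fun setT f -> mx_measurable M ->
  mx_measurable (fun w => f w *: M w).
Proof.
move=> mf mM i j; under eq_fun do rewrite mxE.
by apply: measurable_funM => //; exact: mM.
Qed.

Lemma mx_measurableN m n (M : T -> 'M[R]_(m, n)) :
  mx_measurable M -> mx_measurable (fun w => - M w).
Proof.
by move=> mM i j; under eq_fun do rewrite mxE; apply: measurable_funN; exact: mM.
Qed.

Lemma mx_measurableB m n (M M' : T -> 'M[R]_(m, n)) :
  mx_measurable M -> mx_measurable M' -> mx_measurable (fun w => M w - M' w).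
Proof. by move=> mM mM'; apply: mx_measurableD => //; exact: mx_measurableN. Qed.

Lemma mx_measurable_sum m n (I : Type) (r : seq I) (M : I -> T -> 'M[R]_(m, n)) :
  (forall i, mx_measurable (M i)) ->
  mx_measurable (fun w => \sum_(i <- r) M i w).
Proof.
move=> mM i j; under eq_fun do rewrite summxE.
by apply: measurable_sum => k; exact: mM.
Qed.

Lemma mx_measurableM m n p (M : T -> 'M[R]_(m, n)) (M' : T -> 'M[R]_(n, p)) :
  mx_measurable M -> mx_measurable M' -> mx_measurable (fun w => M w *m M' w).
Proof.
move=> mM mM' i j; under eq_fun do rewrite mxE.
apply: measurable_sum => k; apply: measurable_funM; [exact: mM|exact: mM'].
Qed.

Lemma mx_measurable_tr m n (M : T -> 'M[R]_(m, n)) :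
  mx_measurable M -> mx_measurable (fun w => (M w)^T).
Proof. by move=> mM i j; under eq_fun do rewrite mxE; exact: mM. Qed.

Lemma measurable_det n (M : T -> 'M[R]_n) : mx_measurable M ->
  measurable_fun setT (fun w => \det (M w)).
Proof.
move=> mM; apply: measurable_sum => s; apply: measurable_funM => //.
by apply: measurable_prodr => i; exact: mM.
Qed.

(** Cofactor formula: each entry is a polynomial in the entries divided by the determinant. *)
Lemma mx_measurable_inv n (M : T -> 'M[R]_n) : mx_measurable M ->
  (forall w, M w \in unitmx) -> mx_measurable (fun w => invmx (M w)).
Proof.
move=> mM uM i j.
under eq_fun do rewrite /invmx uM mxE mxE.
apply: measurable_funM; first exact/measurable_funV/measurable_det.
apply: measurable_funM => //; apply: measurable_det => k l.
by under eq_fun do rewrite !mxE; exact: mM.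
Qed.

Lemma mx_measurable_cayley n (M : T -> 'M[R]_n) : mx_measurable M ->
  (forall w, (M w)^T = - M w) -> mx_measurable (fun w => cayley (M w)).
Proof.
move=> mM aM.
have mh : mx_measurable (fun w => half (M w)).
  by apply: mx_measurableZ => //; exact: measurable_cst.
apply: mx_measurableM; last by apply: mx_measurableD => //; exact: mx_measurable_cst.
apply: mx_measurable_inv.
  by apply: mx_measurableB => //; exact: mx_measurable_cst.
by move=> w; apply/unitmx_1B/tr_half.
Qed.

Lemma measurable_nsq n (v : T -> 'cV[R]_n) : mx_measurable v ->
  measurable_fun setT (fun w => nsq (v w)).
Proof.
by move=> mv; apply: measurable_sum => i; apply: measurable_funX; exact: mv.
Qed.

Lemma measurable_fsq n (M : T -> 'M[R]_n) : mx_measurable M ->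
  measurable_fun setT (fun w => fsq (M w)).
Proof.
move=> mM; apply: measurable_sum => i; apply: measurable_sum => j.
by apply: measurable_funX; exact: mM.
Qed.

End MatrixMeasurable.

(** * The Cayley flow *)

Section Driver.
Context {d : measure_display} {T : measurableType d} {R : realType}.
Variable P : probability T R.
Variable F : R -> set (set T).
Hypothesis hF : is_filtration F.

Definition mx_adapted (G : set (set T)) m n (M : T -> 'M[R]_(m, n)) : Prop :=
  @mx_measurable _ (g_sigma_algebraType G) R m n M.

Lemma mx_adapted_le s t m n (M : T -> 'M[R]_(m, n)) : 0 <= s -> s <= t ->
  mx_adapted (F s) M -> mx_adapted (F t) M.
Proof. by move=> s0 st mM i j; exact: (mes_wrt_filtration hF s0 st (mM i j)). Qed.

Lemma mx_adapted_measurable s m n (M : T -> 'M[R]_(m, n)) : 0 <= s ->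
  mx_adapted (F s) M -> mx_measurable M.
Proof. by move=> s0 mM i j; exact: (mes_filtration hF s0 (mM i j)). Qed.

Variable D : nat.
Variable A : R -> T -> 'M[R]_D.
Variable K : R.

Definition inc s t w := A t w - A s w.

(* The properties of a Brownian motion in the antisymmetric matrices that the
   convergence proof uses; [drv_quad] says that [E (dA)^2 = - dt]. *)
Record antisym_driver : Prop := AntisymDriver {
  drv_K : 0 <= K;
  drv_anti : forall t w, 0 <= t -> (A t w)^T = - A t w;
  drv_mes : forall t, 0 <= t -> mx_adapted (F t) (A t);
  drv_lin : forall s t i j, 0 <= s -> s <= t ->
    noise P F s t (K * (t - s)) (fun w => inc s t w i j);
  drv_quad : forall s t i j, 0 <= s -> s <= t ->
    noise P F s t (K * (t - s) ^+ 2)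
      (fun w => (inc s t w *m inc s t w + (t - s)%:M) i j);
  drv_four : forall s t, 0 <= s -> s <= t ->
    L1 P (fun w => fsq (inc s t w) ^+ 2) /\
    Ex P (fun w => fsq (inc s t w) ^+ 2) <= K * (t - s) ^+ 2 }.

Hypothesis hA : antisym_driver.

Lemma inc_anti s t w : 0 <= s -> 0 <= t -> (inc s t w)^T = - inc s t w.
Proof.
by move=> s0 t0; rewrite /inc linearB/= !(drv_anti hA)// opprB opprK addrC.
Qed.

Lemma inc_adapted s t : 0 <= s -> s <= t -> mx_adapted (F t) (inc s t).
Proof.
move=> s0 st; apply: mx_measurableB; first exact: drv_mes hA _ (le_trans s0 st).
exact: (mx_adapted_le s0 st (drv_mes hA s0)).
Qed.

Lemma L1_fsq_inc s t : 0 <= s -> s <= t -> L1 P (fun w => fsq (inc s t w)).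
Proof.
move=> s0 st; apply: L1_sum => i _; apply: L1_sum => j _.
by case: (noise_L2 (drv_lin hA i j s0 st)).
Qed.

Lemma Ex_fsq_inc s t : 0 <= s -> s <= t ->
  Ex P (fun w => fsq (inc s t w)) <= D%:R ^+ 2 * K * (t - s).
Proof.
move=> s0 st; rewrite Ex_sum => [|i _]; last first.
  by apply: L1_sum => j _; case: (noise_L2 (drv_lin hA i j s0 st)).
apply: (@le_trans _ _ (\sum_(i < D) \sum_(j < D) K * (t - s))).
  apply: ler_sum => i _; rewrite Ex_sum => [|j _]; last first.
    by case: (noise_L2 (drv_lin hA i j s0 st)).
  apply: ler_sum => j _; exact: (noise_Ex_sqr (drv_lin hA i j s0 st)).
rewrite !sumr_const !card_ord -(mulr_natl (_ *+ _)) -(mulr_natl (K * _)).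
by rewrite expr2 !mulrA.
Qed.

Section Flow.
Variable tau : nat -> R.
Hypothesis tau0 : forall k, 0 <= tau k.
Hypothesis tauS : forall k, tau k <= tau k.+1.

Definition step k w := inc (tau k) (tau k.+1) w.

Fixpoint flow (k : nat) (w : T) : 'M[R]_D :=
  if k is k'.+1 then cayley (step k' w) *m flow k' w else 1%:M.

Lemma step_anti k w : (step k w)^T = - step k w.
Proof. exact: inc_anti. Qed.

Lemma flow_orthogonal k w : (flow k w)^T *m flow k w = 1%:M.
Proof.
elim: k => [|k IH] /=; first by rewrite trmx1 mulmx1.
rewrite trmx_mul mulmxA -(mulmxA _ (cayley _)^T) cayley_orthogonal ?mulmx1//.
exact: step_anti.
Qed.

Lemma flow_trK k w : flow k w *m (flow k w)^T = 1%:M.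
Proof. exact: mulmx1C (flow_orthogonal k w). Qed.

Lemma nsq_flow_tr k w v : nsq ((flow k w)^T *m v) = nsq v.
Proof. by apply: nsq_orthogonal; rewrite trmxK flow_trK. Qed.

Lemma nsq_flow k w v : nsq (flow k w *m v) = nsq v.
Proof. by apply: nsq_orthogonal; exact: flow_orthogonal. Qed.

Lemma flow_col_sqr k w a : \sum_j flow k w j a ^+ 2 = 1.
Proof.
have /matrixP/(_ a a) := flow_orthogonal k w.
have -> : (1%:M : 'M[R]_D) a a = 1 by rewrite mxE eqxx.
move=> <-; rewrite mxE; apply: eq_bigr => j _.
by rewrite mxE expr2.
Qed.

Lemma flow_adapted k : mx_adapted (F (tau k)) (flow k).
Proof.
elim: k => [|k IH] /=; first exact: mx_measurable_cst.
apply: mx_measurableM; last exact: (mx_adapted_le (tau0 k) (tauS k) IH).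
apply: mx_measurable_cayley; last by move=> w; exact: step_anti.
exact: inc_adapted (tau0 k) (tauS k).
Qed.

Lemma flow_measurable k : mx_measurable (flow k).
Proof. exact: (mx_adapted_measurable (tau0 k) (@flow_adapted k)). Qed.

Lemma step_measurable k : mx_measurable (step k).
Proof.
exact: (mx_adapted_measurable (tau0 k.+1) (inc_adapted (tau0 k) (tauS k))).
Qed.

(** Each column of [flow k] is a unit vector known at time [tau k], so every coordinate of [V] is a
    sum of [n] noises of variance at most [D kappa]. Orthogonality keeps the growth linear in
    [n]. *)
Lemma flow_noise_sum (kappa : R) (N : nat -> 'I_D -> T -> R) n : 0 <= kappa ->
  (forall k i, noise P F (tau k) (tau k.+1) kappa (N k i)) ->
  let V w := \sum_(k < n) (flow k w)^T *m (\col_i N k i w) in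
  L1 P (fun w => nsq (V w)) /\
  Ex P (fun w => nsq (V w)) <= D%:R ^+ 2 * n%:R * kappa.
Proof.
move=> k0 nN V.
have VE a w : V w a 0 = \sum_(k < n) \sum_j flow k w j a * N k j w.
  rewrite /V summxE; apply: eq_bigr => k _; rewrite mxE.
  by apply: eq_bigr => j _; rewrite !mxE.
have nY a k : noise P F (tau k) (tau k.+1) (D%:R * kappa)
    (fun w => \sum_j flow k w j a * N k j w).
  have := @noise_comb _ _ _ P F hF _ (tau k) (tau k.+1) kappa 1 (N k)
    (fun j w => flow k w j a) (tau0 k) (tauS k) k0 (nN k).
  rewrite card_ord mulr1; apply => [j|w]; first exact: flow_adapted.
  by rewrite flow_col_sqr.
have nV a := noise_sum hF tau0 tauS (nY a) n.
have lV a : L1 P (fun w => V w a 0 ^+ 2).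
  by under eq_fun do rewrite VE; case: (noise_L2 (nV a)).
split; first exact: L1_sum.
rewrite Ex_sum//; apply: (@le_trans _ _ (\sum_(a < D) n%:R * (D%:R * kappa))).
  apply: ler_sum => a _; rewrite (@eq_Ex _ _ _ _ _
    (fun w => (\sum_(k < n) \sum_j flow k w j a * N k j w) ^+ 2)); last first.
    by move=> w; rewrite VE.
  have := noise_Ex_sqr (nV a).
  by rewrite sumr_const card_ord -[X in _ <= X]mulr_natl.
rewrite sumr_const card_ord -mulr_natl.
by rewrite le_eqVlt; apply/orP; left; apply/eqP; ring.
Qed.

End Flow.

End Driver.

(** * Sums controlled by first moments only *)

Section WeightedSum.
Context {d : measure_display} {T : measurableType d} {R : realType}.
Variable P : probability T R.

(** With [s] the right-hand side, [x y <= s^2] by the arithmetic-geometric mean; then either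
    [1 <= s] or [s^2 <= s]. *)
Lemma min1_mul_le (x y lam : R) : 0 <= x -> 0 <= y -> 0 < lam ->
  Num.min 1 (x * y) <= (lam * x + y / lam) / 2.
Proof.
move=> x0 y0 l0; set s := _ / 2.
have [yl0 lx0] : 0 <= y / lam /\ 0 <= lam * x.
  by rewrite divr_ge0 ?mulr_ge0// ltW.
have s0 : 0 <= s by rewrite /s; lra.
have zs : x * y <= s ^+ 2.
  have -> : x * y = (lam * x) * (y / lam) by field; rewrite gt_eqF.
  rewrite /s; set a := lam * x; set c := y / lam.
  by have := sqr_ge0 (a - c); nra.
rewrite ge_min; have [s1|s1] := leP 1 s; first by [].
by apply/orP; right; nra.
Qed.

Context {D : nat}.
Implicit Types (v : nat -> 'cV[R]_D).

(** Cauchy-Schwarz with weights [sqrt (al k)]. The convention for the inverse of 0 is harmless, as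
    [al k = 0] forces [v k = 0]. *)
Lemma nsq_sum_CS n v (al be : nat -> R) :
  (forall k, 0 <= al k) -> (forall k, 0 <= be k) ->
  (forall k, nsq (v k) <= al k * be k) ->
  nsq (\sum_(k < n) v k) <= (\sum_(k < n) al k) * (\sum_(k < n) be k).
Proof.
move=> al0 be0 h.
have vE k i : v k i 0 = Num.sqrt (al k) * (v k i 0 / Num.sqrt (al k)).
  have [a0|a0] := eqVneq (Num.sqrt (al k)) 0; last by field.
  have : al k = 0.
    by apply/eqP; rewrite eq_le al0 andbT -sqrtr_eq0 a0.
  move=> e; have := h k; rewrite e mul0r => n0.
  have /nsq_eq0 -> : nsq (v k) = 0 by apply/eqP; rewrite eq_le n0 nsq_ge0.
  by rewrite mxE mul0r mulr0.
have be_ge k : \sum_i (v k i 0 / Num.sqrt (al k)) ^+ 2 <= be k.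
  have [a0|a0] := eqVneq (al k) 0.
    by rewrite big1// => i _; rewrite a0 sqrtr0 invr0 mulr0 expr0n.
  have ap : 0 < al k by rewrite lt_neqAle eq_sym a0 al0.
  under eq_bigr do rewrite expr_div_n sqr_sqrtr//.
  by rewrite -mulr_suml ler_pdivrMr// mulrC; exact: h.
apply: (@le_trans _ _ (\sum_i (\sum_(k < n) al k) *
    (\sum_(k < n) (v k i 0 / Num.sqrt (al k)) ^+ 2))).
  apply: ler_sum => i _; rewrite summxE.
  under eq_bigr do rewrite vE.
  apply: (le_trans (CauchySchwarz_sum _ _)).
  by under eq_bigr do rewrite sqr_sqrtr//.
rewrite -mulr_sumr ler_wpM2l//; first exact: sumr_ge0.
by rewrite exchange_big/=; apply: ler_sum => k _.
Qed.

(** Integrating [al k * be k] would require moments of the driver beyond the fourth. Inside [rho],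
    [min1_mul_le] asks only for [E al] and [E be] separately, at the price of the free parameter
    [lam]. *)
Lemma rho_nsq_sum n (v : nat -> T -> 'cV[R]_D) (al be : nat -> T -> R)
    (lam a b : R) : 0 < lam ->
  (forall k, mx_measurable (v k)) ->
  (forall k, L1 P (al k)) -> (forall k, L1 P (be k)) ->
  (forall k w, 0 <= al k w) -> (forall k w, 0 <= be k w) ->
  (forall k w, nsq (v k w) <= al k w * be k w) ->
  (forall k, Ex P (al k) <= a) -> (forall k, Ex P (be k) <= b) ->
  rho P (fun w => nsq (\sum_(k < n) v k w)) <=
  (lam * (n%:R * a) + n%:R * b / lam) / 2.
Proof.
move=> l0 mv la lb al0 be0 h ha hb.
have lS : L1 P (fun w => (lam * (\sum_(k < n) al k w) +
    (\sum_(k < n) be k w) / lam) / 2).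
  rewrite (_ : (fun w => _) = (fun w => 2^-1 * (lam * (\sum_(k < n) al k w) +
    lam^-1 * (\sum_(k < n) be k w)))).
    by apply: L1Z; apply: L1D; apply: L1Z; apply: L1_sum.
  by apply/funext => w; rewrite mulrC [_ / lam]mulrC.
apply: (@le_trans _ _ (Ex P (fun w => (lam * (\sum_(k < n) al k w) +
    (\sum_(k < n) be k w) / lam) / 2))).
  apply: le_Ex => //.
    apply: L1_min1 => [|w]; last exact: nsq_ge0.
    apply: measurable_nsq; apply: mx_measurable_sum => k; exact: mv.
  move=> w; apply: le_trans (min1_mul_le _ _ l0); last 2 first.
  - by apply: sumr_ge0 => k _; exact: al0.
  - by apply: sumr_ge0 => k _; exact: be0.
  rewrite le_min ge_min lexx/= ge_min; apply/orP; right.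
  by apply: (@nsq_sum_CS n (fun k => v k w) (al ^~ w) (be ^~ w)).
rewrite (@eq_Ex _ _ _ _ _ (fun w => 2^-1 * (lam * (\sum_(k < n) al k w) +
    lam^-1 * (\sum_(k < n) be k w)))); last first.
  by move=> w; rewrite mulrC [_ / lam]mulrC.
have lA : L1 P (fun w => \sum_(k < n) al k w) by apply: L1_sum.
have lB : L1 P (fun w => \sum_(k < n) be k w) by apply: L1_sum.
rewrite ExZ; last by apply: L1D; apply: L1Z.
rewrite ExD ?ExZ//; try exact: L1Z.
rewrite !Ex_sum// [leRHS]mulrC ler_wpM2l ?invr_ge0//.
have hS (x : nat -> R) (c : R) : (forall k, x k <= c) ->
    \sum_(k < n) x k <= n%:R * c.
  move=> xc; apply: (@le_trans _ _ (\sum_(k < n) c)); first exact: ler_sum.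
  by rewrite sumr_const card_ord mulr_natl.
apply: lerD; first by rewrite ler_pM2l//; exact: hS (fun k => Ex P (al k)) _ ha.
rewrite mulrC ler_pM2r ?invr_gt0//; exact: hS (fun k => Ex P (be k)) _ hb.
Qed.

End WeightedSum.

Section Truncate.
Context {R : realType} {D : nat}.

(** Bounds the coefficients of a noise without any moment assumption on [u]; it is the identity on
    the event where the estimates are wanted. *)
Definition trunc (c : R) (v : 'cV[R]_D) : 'cV[R]_D :=
  if nsq v <= c then v else 0.

Lemma nsq_trunc c v : 0 <= c -> nsq (trunc c v) <= c.
Proof. by move=> c0; rewrite /trunc; case: ifP => // _; rewrite nsq0. Qed.

Lemma truncE c v : nsq v <= c -> trunc c v = v.
Proof. by rewrite /trunc => ->. Qed.

Lemma mx_measurable_trunc d (T : measurableType d) (c : R) (v : T -> 'cV[R]_D) :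
  mx_measurable v -> mx_measurable (fun w => trunc c (v w)).
Proof.
move=> mv i j.
have -> : (fun w => trunc c (v w) i j) =
    (fun w => if nsq (v w) <= c then v w i j else 0).
  by apply/funext => w; rewrite /trunc; case: ifP => // _; rewrite mxE.
apply: measurable_fun_ifT => //.
by apply: measurable_fun_ler => //; exact: measurable_nsq.
Qed.

End Truncate.

Lemma cayley_expand (R : realFieldType) D (B : 'M[R]_D) (v : 'cV[R]_D) :
  cayley B *m v =
  v + B *m v + 2^-1 *: (B *m B *m v) + cayley_rem B *m v.
Proof.
rewrite /cayley_rem !mulmxBl mul1mx -scalemxAl.
set a := _ *m v; set x := B *m v; set y := _ *: _.
by apply/matrixP => i j; rewrite !mxE; ring.
Qed.

(** [E] depends on the current increment, so [E^T z] need not be a martingale increment when [z] is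
    one. Writing it as [z + (E^T - 1) z] isolates the martingale part from a term of higher
    order. *)
Lemma orthogonal_step (R : realFieldType) D (E : 'M[R]_D) (x e z c : 'cV[R]_D) :
  E^T *m E = 1%:M ->
  E^T *m (E *m x + e + z - c) =
  x + E^T *m e + z + ((E^T - 1%:M) *m z - E^T *m c).
Proof.
move=> oE; rewrite mulmxBr !mulmxDr mulmxA oE mul1mx mulmxBl mul1mx.
set x1 := E^T *m e; set x3 := E^T *m z; set x4 := E^T *m c.
by apply/matrixP => i j; rewrite !mxE; ring.
Qed.

Lemma mulmx_step (R : realFieldType) D (W : 'M[R]_D) (x e z y c : 'cV[R]_D) :
  W *m (x + e + (z - 2^-1 *: y) + c) =
  W *m x + W *m e + W *m z - 2^-1 *: (W *m y) + W *m c.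
Proof. by rewrite !mulmxDr mulmxN -scalemxAr !addrA. Qed.

Section FlowTelescope.
Context {d : measure_display} {T : measurableType d} {R : realType} {D : nat}.
Variables (A : R -> T -> 'M[R]_D) (tau : nat -> R) (w : T).
Hypothesis tau0 : forall k, 0 <= tau k.
Hypothesis antiA : forall t, 0 <= t -> (A t w)^T = - A t w.

Local Notation b k := (step A tau k w).
Local Notation W k := (flow A tau k w).

(* [W^T q] is nearly constant: each term of the right-hand side is small, the
   stochastic ones by orthogonality of increments. *)
Lemma flow_telescope (q Je Jt : nat -> 'cV[R]_D) (h : R) n :
  (forall k, (k < n)%N ->
     q k.+1 = q k + b k *m q k - (h / 2) *: q k + Je k + Jt k) ->
  let Y k := (b k *m b k + h%:M) *m q k in
  (W n)^T *m q n - q 0 =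
    (\sum_(k < n) (W k.+1)^T *m Je k + \sum_(k < n) (W k)^T *m Jt k) +
    (\sum_(k < n) (W k)^T *m
       (((cayley (b k))^T - 1%:M) *m (Jt k - 2^-1 *: Y k) -
        (cayley (b k))^T *m (cayley_rem (b k) *m q k)) -
     2^-1 *: \sum_(k < n) (W k)^T *m Y k).
Proof.
move=> hq Y.
have ab k : (b k)^T = - b k.
  by rewrite /step /inc linearB/= !antiA// opprB opprK addrC.
elim: n hq => [|n IH] hq.
  by rewrite !big_ord0 trmx1 mul1mx subrr scaler0 subrr !addr0.
rewrite !big_ord_recr/=.
set S1 := \sum_(k < n) _ in IH *; set S2 := \sum_(k < n) _ in IH *.
set S3 := \sum_(k < n) _ in IH *; set S4 := \sum_(k < n) _ in IH *.
have {IH} e : (W n)^T *m q n - q 0 = (S1 + S2) + (S3 - 2^-1 *: S4).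
  by apply: IH => k kn; apply: hq; exact: ltnW.
set E := cayley (b n).
have oE : E^T *m E = 1%:M by exact: cayley_orthogonal.
have Eq := cayley_expand (b n) (q n); rewrite -/E in Eq.
(* The term [b^2 q / 2] of the Cayley step and the drift [- (h / 2) q] differ by [Y / 2], which is
   centred when [E b^2 = - h]. *)
have {}Eq : q n.+1 = E *m q n + Je n + (Jt n - 2^-1 *: Y n) -
    cayley_rem (b n) *m q n.
  rewrite hq// Eq /Y mulmxDl mul_scalar_mx.
  set x := b n *m q n; set y := b n *m b n *m q n; set z := _ *m q n.
  by apply/matrixP => i j; rewrite !mxE; field.
rewrite trmx_mul -mulmxA Eq.
rewrite (orthogonal_step _ _ _ _ oE) mulmx_step.
have -> : (W n)^T *m q n = q 0 + ((S1 + S2) + (S3 - 2^-1 *: S4)).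
  by rewrite -e addrC subrK.
rewrite mulmxA.
set y1 := _ *m Je n; set y2 := _ *m Jt n; set y3 := _ *m Y n.
set y4 := (W n)^T *m _.
by apply/matrixP => i j; rewrite !mxE; field.
Qed.

End FlowTelescope.

(** * Error of the Cayley flow on given grids *)

Section FlowEstimate.
Context {d : measure_display} {T : measurableType d} {R : realType}.
Variable P : probability T R.
Variable F : R -> set (set T).
Hypothesis hF : is_filtration F.
Variables (D : nat) (A : R -> T -> 'M[R]_D) (K : R).
Hypothesis hA : antisym_driver P F A K.
Variable u : R -> T -> 'cV[R]_D.
Hypothesis mu_ : forall t, 0 <= t -> mx_adapted (F t) (u t).

Variables (n r : nat) (dl eps M : R).
Hypothesis dl0 : 0 <= dl.
Hypothesis eps0 : 0 <= eps.
Hypothesis M0 : 0 <= M.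

Let h := r%:R * dl.
Let h0 : 0 <= h. Proof. by rewrite mulr_ge0. Qed.
Let K0 : 0 <= K. Proof. exact: drv_K hA. Qed.

(** A coarse cell, of length [h], is one Cayley step and contains [r] fine cells of the Riemann
    sums. On the good event [eps] bounds the squared oscillation of [u] in a coarse cell and [M] its
    squared size at the coarse nodes. *)
Definition fine_time (m : nat) : R := m%:R * dl.
Definition coarse_time (k : nat) : R := (k * r)%:R * dl.
Local Notation sig k l := (fine_time (k * r + l)).
Local Notation tau := coarse_time.

Let fine0 m : 0 <= fine_time m. Proof. by rewrite mulr_ge0. Qed.
Let fineS m : fine_time m <= fine_time m.+1.
Proof. by rewrite ler_wpM2r// ler_nat. Qed.
Let fineB m : fine_time m.+1 - fine_time m = dl.
Proof. by rewrite /fine_time -mulrBl -natrB// subSnn mul1r. Qed.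
Let tau0 k : 0 <= tau k. Proof. exact: fine0. Qed.
Let tauB k : tau k.+1 - tau k = h.
Proof. by rewrite /coarse_time mulSn natrD mulrDl addrK. Qed.
Let tauS k : tau k <= tau k.+1.
Proof. by rewrite -subr_ge0 tauB. Qed.
Let sig_tau k l : tau k <= sig k l.
Proof. by rewrite ler_wpM2r// ler_nat leq_addr. Qed.

Let q k w := u (tau k) w.
Let xi k l w := trunc eps (u (sig k l) w - q k w).
Let qt k w := trunc M (q k w).
Local Notation dA k l w := (inc A (sig k l) (sig k l.+1) w).
Local Notation b k w := (step A tau k w).
Local Notation W k w := (flow A tau k w).

Let q_adapted k : mx_adapted (F (tau k)) (q k). Proof. exact: mu_. Qed.
Let qt_adapted k : mx_adapted (F (tau k)) (qt k).
Proof. exact: mx_measurable_trunc (@q_adapted k). Qed.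
Let xi_adapted k l : mx_adapted (F (sig k l)) (xi k l).
Proof.
apply: mx_measurable_trunc; apply: mx_measurableB; first exact: mu_.
exact: (mx_adapted_le hF (tau0 k) (sig_tau k l) (@q_adapted k)).
Qed.

(** The error of freezing [u] at the left end of a coarse cell in the stochastic sum: a martingale
    transform of variance of order [h * eps]. *)
Let N k i w := \sum_(l < r) \sum_j xi k l w j 0 * dA k l w i j.
Let kN := D%:R * K * h * eps.

Let kN0 : 0 <= kN. Proof. by rewrite !mulr_ge0. Qed.

Let noiseN k i : noise P F (tau k) (tau k.+1) kN (N k i).
Proof.
have nY l : noise P F (sig k l) (sig k l.+1) (D%:R * (K * dl) * eps)
    (fun w => \sum_j xi k l w j 0 * dA k l w i j).
  have Kd0 : 0 <= K * dl by rewrite mulr_ge0.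
  have := @noise_comb _ _ _ P F hF _ (sig k l) (sig k l.+1) (K * dl) eps
    (fun j w => dA k l w i j) (fun j w => xi k l w j 0) (fine0 _) _ Kd0.
  rewrite card_ord; apply.
  - by rewrite addnS; exact: fineS.
  - move=> j; have := drv_lin hA i j (fine0 (k * r + l)) (fineS _).
    by rewrite fineB -addnS.
  - by move=> j; exact: xi_adapted.
  - by move=> w; exact: nsq_trunc.
have sS l : sig k l <= sig k l.+1 by rewrite addnS; exact: fineS.
have := noise_sum hF (fun l => fine0 (k * r + l)) sS nY r.
rewrite addn0 sumr_const card_ord -(mulr_natl (_ * eps)).
have -> : r%:R * (D%:R * (K * dl) * eps) = kN by rewrite /kN /h; ring.
by have -> : sig k r = tau k.+1 by rewrite /coarse_time mulSn addnC.
Qed.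

Let Yq k i w :=
  \sum_j qt k w j 0 * (b k w *m b k w + h%:M) i j.
Let kY := D%:R * K * h ^+ 2 * M.

Let kY0 : 0 <= kY. Proof. by rewrite !mulr_ge0// sqr_ge0. Qed.

Let noiseY k i : noise P F (tau k) (tau k.+1) kY (Yq k i).
Proof.
have Kh0 : 0 <= K * h ^+ 2 by rewrite mulr_ge0// sqr_ge0.
have := @noise_comb _ _ _ P F hF _ (tau k) (tau k.+1) (K * h ^+ 2) M
  (fun j w => (b k w *m b k w + h%:M) i j) (fun j w => qt k w j 0)
  (tau0 _) (tauS _) Kh0.
rewrite card_ord (mulrA D%:R K) -/kY; apply.
- by move=> j; have := drv_quad hA i j (tau0 k) (tauS _); rewrite tauB.
- by move=> j; exact: qt_adapted.
- by move=> w; exact: nsq_trunc.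
Qed.

Let Nv k w : 'cV[R]_D := \col_i N k i w.
Let Yv k w : 'cV[R]_D := \col_i Yq k i w.
Let dd k w : 'cV[R]_D := (dl / 2) *: \sum_(l < r) xi k l w.
Let Jt k w := Nv k w - dd k w.

Let YvE k w : Yv k w = (b k w *m b k w + h%:M) *m qt k w.
Proof.
apply/matrixP => i j; rewrite !mxE ord1; apply: eq_bigr => l _.
by rewrite mulrC.
Qed.

Let NvE k w : Nv k w = \sum_(l < r) dA k l w *m xi k l w.
Proof.
apply/matrixP => i j; rewrite !mxE summxE; apply: eq_bigr => l _.
by rewrite !mxE ord1; apply: eq_bigr => m _; rewrite mulrC.
Qed.

Let dd_le k w : nsq (dd k w) <= h ^+ 2 * eps / 4.
Proof.
rewrite /dd nsqZ.
have h1 : nsq (\sum_(l < r) xi k l w) <= r%:R * (r%:R * eps).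
  apply: (le_trans (nsq_sum _)); rewrite card_ord ler_wpM2l//.
  apply: (@le_trans _ _ (\sum_(l < r) eps)); last first.
    by rewrite sumr_const card_ord mulr_natl.
  by apply: ler_sum => l _; exact: nsq_trunc.
have -> : h ^+ 2 * eps / 4 = (dl / 2) ^+ 2 * (r%:R * (r%:R * eps)).
  by rewrite /h; field.
by rewrite ler_wpM2l// sqr_ge0.
Qed.

Let mx_meas_noise (X : nat -> 'I_D -> T -> R) kappa k :
  (forall i, noise P F (tau k) (tau k.+1) kappa (X k i)) ->
  mx_measurable (fun w => \col_i X k i w).
Proof.
move=> nX i j; under eq_fun do rewrite mxE.
by case: (noise_L2 (nX i)).
Qed.

Let nsq_col (X : nat -> 'I_D -> T -> R) kappa k :
  (forall i, noise P F (tau k) (tau k.+1) kappa (X k i)) ->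
  L1 P (fun w => nsq (\col_i X k i w)) /\
  Ex P (fun w => nsq (\col_i X k i w)) <= D%:R * kappa.
Proof.
move=> nX.
have E : (fun w => nsq (\col_i X k i w)) = (fun w => \sum_i X k i w ^+ 2).
  by apply/funext => w; apply: eq_bigr => i _; rewrite mxE.
rewrite E; have l i : L1 P (fun w => X k i w ^+ 2) by case: (noise_L2 (nX i)).
split; first exact: L1_sum.
rewrite Ex_sum//; apply: (@le_trans _ _ (\sum_(i < D) kappa)).
  by apply: ler_sum => i _; exact: noise_Ex_sqr (nX i).
by rewrite sumr_const card_ord mulr_natl.
Qed.

Let vv k w := ((cayley (b k w))^T - 1%:M) *m (Jt k w - 2^-1 *: Yv k w) -
  (cayley (b k w))^T *m (cayley_rem (b k w) *m qt k w).

Let antib k w : (b k w)^T = - b k w.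
Proof. by apply: (step_anti hA). Qed.

(** The cofactor of [fsq (b k w)] in the bound of [vv]; each term has expectation [h] times a
    quantity that vanishes with [eps] and [h]. *)
Let be k w := 8 * nsq (Nv k w) + 2 * h ^+ 2 * eps + nsq (Yv k w) +
  2 * M * fsq (b k w) ^+ 2.

Let vv_le k w : nsq ((W k w)^T *m vv k w) <= fsq (b k w) * be k w.
Proof.
rewrite (nsq_flow_tr hA)// /vv.
set x := Jt k w - _.
have oE := cayley_orthogonal (antib k w).
have oT : ((cayley (b k w))^T)^T *m (cayley (b k w))^T = 1%:M.
  by rewrite trmxK; exact: mulmx1C.
have h1 := nsq_tr_cayley_sub1 x (antib k w).
have h2 := nsq_cayley_rem (qt k w) (antib k w).
have h3 : nsq (qt k w) <= M by exact: nsq_trunc.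
have h4 : nsq x <= 4 * nsq (Nv k w) + h ^+ 2 * eps + 2^-1 * nsq (Yv k w).
  have := nsqD (Jt k w) (- (2^-1 *: Yv k w)); rewrite -/x nsqN nsqZ.
  have := nsqD (Nv k w) (- dd k w); rewrite -/(Jt k w) nsqN.
  by have := dd_le k w; lra.
have := nsqD (((cayley (b k w))^T - 1%:M) *m x)
  (- ((cayley (b k w))^T *m (cayley_rem (b k w) *m qt k w))).
rewrite nsqN [nsq ((cayley (b k w))^T *m (_ *m _))](nsq_orthogonal _ oT).
move=> h5; apply: (le_trans h5).
have f0 := fsq_ge0 (b k w).
have h6 : fsq (b k w) * nsq x <= fsq (b k w) *
  (4 * nsq (Nv k w) + h ^+ 2 * eps + 2^-1 * nsq (Yv k w)) by rewrite ler_wpM2l.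
have h7 : fsq (b k w) ^+ 3 * nsq (qt k w) <= fsq (b k w) ^+ 3 * M.
  by rewrite ler_wpM2l// exprn_ge0.
rewrite /be.
have -> : fsq (b k w) * (8 * nsq (Nv k w) + 2 * h ^+ 2 * eps + nsq (Yv k w) +
    2 * M * fsq (b k w) ^+ 2) =
  2 * (fsq (b k w) * (4 * nsq (Nv k w) + h ^+ 2 * eps +
    2^-1 * nsq (Yv k w))) + 2 * (fsq (b k w) ^+ 3 * M) by field.
lra.
Qed.

(** Defect of the Riemann-sum form of the equation at a coarse node. It has no martingale structure,
    so only its size is used. *)
Let rr k w := u (tau k) w - u 0 w - \sum_(m < k * r)
  (inc A (fine_time m) (fine_time m.+1) w - (dl / 2)%:M) *m u (fine_time m) w.
Let Je k w := rr k.+1 w - rr k w.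

Let recursion k w : nsq (q k w) <= M ->
  (forall l, (l < r)%N -> nsq (u (sig k l) w - q k w) <= eps) ->
  q k.+1 w = q k w + b k w *m q k w - (h / 2) *: q k w + Je k w + Jt k w.
Proof.
move=> qM xe.
have xiE (l : 'I_r) : xi k l w = u (sig k l) w - q k w.
  by rewrite /xi truncE// xe.
have incE : \sum_(l < r) dA k l w = b k w.
  rewrite /step /inc.
  transitivity (A (sig k r) w - A (sig k 0) w).
    by rewrite -(telescope_sumr (fun l => A (sig k l) w) (leq0n r)) big_mkord.
  by rewrite addn0 /coarse_time mulSn addnC.
have NE : Nv k w = \sum_(l < r) dA k l w *m u (sig k l) w - b k w *m q k w.
  rewrite NvE -incE mulmx_suml -sumrB; apply: eq_bigr => l _.
  by rewrite xiE mulmxBr.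
have dE : dd k w = (dl / 2) *: (\sum_(l < r) u (sig k l) w) - (h / 2) *: q k w.
  rewrite /dd; under eq_bigr do rewrite xiE.
  rewrite sumrB sumr_const card_ord scalerBr; congr (_ - _).
  by apply/matrixP => i j; rewrite !mxE mulmxnE -mulr_natl /h; field.
have JeE : Je k w = q k.+1 w - q k w -
    (\sum_(l < r) dA k l w *m u (sig k l) w -
     (dl / 2) *: (\sum_(l < r) u (sig k l) w)).
  rewrite /Je /rr mulSn addnC big_split_ord/=.
  set S := \sum_(i < k * r) _; set S' := \sum_(i < r) _.
  have -> : \sum_(l < r) dA k l w *m u (sig k l) w -
     (dl / 2) *: (\sum_(l < r) u (sig k l) w) = S'.
    rewrite scaler_sumr -sumrB; apply: eq_bigr => l _ /=.
    by rewrite [RHS](mulmxBl _ (dl / 2)%:M) mul_scalar_mx addnS.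
  have -> : u (tau k.+1) w = q k.+1 w by [].
  have -> : u (tau k) w = q k w by [].
  by apply/matrixP => i j; rewrite !mxE; ring.
rewrite JeE /Jt NE dE.
set s1 := \sum_(l < r) _; set s2 := _ *: \sum_(l < r) _; set s3 := _ *m q k w.
set s4 := _ *: q k w.
by apply/matrixP => i j; rewrite !mxE; ring.
Qed.

Variable B : set T.
Hypothesis mB : measurable B.
Hypothesis goodq : forall w, ~ B w -> forall k, (k < n)%N -> nsq (q k w) <= M.
Hypothesis goodx : forall w, ~ B w -> forall k l, (k < n)%N -> (l < r)%N ->
  nsq (u (sig k l) w - q k w) <= eps.

Let S1 w := \sum_(k < n) (W k.+1 w)^T *m Je k w.
Let S2 w := \sum_(k < n) (W k w)^T *m Nv k w.
Let S2' w := \sum_(k < n) (W k w)^T *m dd k w.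
Let S3 w := \sum_(k < n) (W k w)^T *m vv k w.
Let S4 w := \sum_(k < n) (W k w)^T *m Yv k w.

(** The constants come from repeated use of [nsqD]; the factor [2^-1] in front of [S4] brings its 8
    down to 2. *)
Let decomposition w : ~ B w ->
  nsq (u (tau n) w - W n w *m u 0 w) <=
  2 * nsq (S1 w) + (8 * nsq (S2 w) + (8 * nsq (S2' w) + (8 * nsq (S3 w) +
  2 * nsq (S4 w)))).
Proof.
move=> Bw.
have qtE (k : 'I_n) : qt k w = q k w by rewrite /qt truncE// goodq.
have := @flow_telescope _ T R D A tau w tau0 (fun t => drv_anti hA w (t := t))
  (q ^~ w) (Je ^~ w) (Jt ^~ w) h n
  (fun k kn => recursion (goodq Bw kn) (fun l lr => goodx Bw kn lr)).
cbv zeta.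
have -> : q 0 w = u 0 w by rewrite /q /coarse_time mul0n mul0r.
move=> e.
have -> : nsq (u (tau n) w - W n w *m u 0 w) =
    nsq ((W n w)^T *m q n w - u 0 w).
  rewrite -(nsq_flow_tr hA tau0 n w (u (tau n) w - _)) mulmxBr mulmxA.
  by rewrite (flow_orthogonal hA tau0) mul1mx.
have {}e : (W n w)^T *m q n w - u 0 w =
    S1 w + ((S2 w + - S2' w) + (S3 w + - (2^-1 *: S4 w))).
  have eA : \sum_(k < n) (W k w)^T *m Jt k w = S2 w - S2' w.
    by rewrite -sumrB; apply: eq_bigr => k _; rewrite /Jt mulmxBr.
  have eC : \sum_(k < n) (W k w)^T *m ((b k w *m b k w + h%:M) *m q k w) = S4 w.
    by apply: eq_bigr => k _; rewrite YvE qtE.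
  have eB : \sum_(k < n) (W k w)^T *m (((cayley (b k w))^T - 1%:M) *m
      (Jt k w - 2^-1 *: ((b k w *m b k w + h%:M) *m q k w)) -
      (cayley (b k w))^T *m (cayley_rem (b k w) *m q k w)) = S3 w.
    by apply: eq_bigr => k _; rewrite /vv YvE qtE.
  by rewrite [LHS]e eA eB eC [RHS]addrA.
rewrite e.
have h1 := nsqD (S1 w) ((S2 w + - S2' w) + (S3 w + - (2^-1 *: S4 w))).
have h2 := nsqD (S2 w + - S2' w) (S3 w + - (2^-1 *: S4 w)).
have h3 := nsqD (S2 w) (- S2' w); rewrite nsqN in h3.
have h4 := nsqD (S3 w) (- (2^-1 *: S4 w)); rewrite nsqN nsqZ in h4.
lra.
Qed.

Let mW k : mx_measurable (flow A tau k).
Proof. exact: (flow_measurable hF hA tau0 tauS). Qed.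
Let mWT k : mx_measurable (fun w => (W k w)^T).
Proof. exact: mx_measurable_tr. Qed.
Let mu0 t : 0 <= t -> mx_measurable (u t).
Proof. by move=> t0; exact: (mx_adapted_measurable hF t0 (mu_ t0)). Qed.
Let mrr k : mx_measurable (rr k).
Proof.
apply: mx_measurableB; first by apply: mx_measurableB; exact: mu0.
apply: mx_measurable_sum => m; apply: mx_measurableM; last exact: mu0.
apply: mx_measurableB; last exact: mx_measurable_cst.
exact: (mx_adapted_measurable hF (fine0 _) (inc_adapted hF hA (fine0 m) (fineS m))).
Qed.
Let mNv k : mx_measurable (Nv k).
Proof. exact: (mx_meas_noise (@noiseN k)). Qed.
Let mYv k : mx_measurable (Yv k).
Proof. exact: (mx_meas_noise (@noiseY k)). Qed.
Let mdd k : mx_measurable (dd k).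
Proof.
apply: mx_measurableZ; first exact: measurable_cst.
apply: mx_measurable_sum => l.
exact: (mx_adapted_measurable hF (fine0 _) (@xi_adapted k l)).
Qed.
Let mb k : mx_measurable (step A tau k).
Proof. exact: (step_measurable hF hA tau0 tauS). Qed.
Let mqt k : mx_measurable (qt k).
Proof. exact: (mx_adapted_measurable hF (tau0 k) (@qt_adapted k)). Qed.
Let mcay k : mx_measurable (fun w => cayley (b k w)).
Proof. by apply: mx_measurable_cayley => // w; exact: antib. Qed.
Let mrem k : mx_measurable (fun w => cayley_rem (b k w)).
Proof.
apply: mx_measurableB; last first.
  by apply: mx_measurableZ; [exact: measurable_cst|exact: mx_measurableM].
by apply: mx_measurableB => //; apply: mx_measurableB.
Qed.
Let mvv k : mx_measurable (vv k).
Proof.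
apply: mx_measurableB; last first.
  apply: mx_measurableM; first exact: mx_measurable_tr.
  exact: mx_measurableM.
apply: mx_measurableM.
  apply: mx_measurableB; last exact: mx_measurable_cst.
  exact: mx_measurable_tr.
apply: mx_measurableB; first exact: mx_measurableB.
by apply: mx_measurableZ; [exact: measurable_cst|].
Qed.

Let mS (X : nat -> T -> 'cV[R]_D) : (forall k, mx_measurable (X k)) ->
  mx_measurable (fun w => \sum_(k < n) (W k w)^T *m X k w).
Proof. by move=> mX; apply: mx_measurable_sum => k; exact: mx_measurableM. Qed.

Let mS1 : mx_measurable S1.
Proof.
apply: mx_measurable_sum => k; apply: mx_measurableM; first exact: (mWT k.+1).
exact: mx_measurableB.
Qed.

(** Loses a factor [n] on top of the sum over the nodes; the choice of [r] after [n] compensates for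
    both. *)
Let rhoS1 : (0 < n)%N -> rho P (fun w => nsq (S1 w)) <=
  4 * n%:R * \sum_(k < n.+1) rho P (fun w => nsq (rr k w)).
Proof.
move=> n0.
have c1 : 1 <= 4 * n%:R :> R.
  have : 1 <= n%:R :> R by rewrite ler1n.
  by lra.
have msum : measurable_fun setT (fun w => \sum_(k < n.+1) nsq (rr k w)).
  by apply: measurable_sum => k; exact: measurable_nsq.
have psum w : 0 <= \sum_(k < n.+1) nsq (rr k w).
  by apply: sumr_ge0 => k _; exact: nsq_ge0.
apply: (@le_trans _ _ (rho P (fun w => 4 * n%:R * \sum_(k < n.+1) nsq (rr k w)))).
  apply: rho_le.
  - exact: measurable_nsq.
  - exact: measurable_funM.
  - by move=> w; exact: nsq_ge0.
  - move=> w; apply: (le_trans (nsq_sum _)); rewrite card_ord.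
    rewrite [4 * _]mulrC -mulrA ler_wpM2l//.
    apply: (@le_trans _ _ (\sum_(k < n) (2 * nsq (rr k.+1 w) + 2 * nsq (rr k w)))).
      apply: ler_sum => k _; rewrite (nsq_flow_tr hA tau0 k.+1).
      by have := nsqD (rr k.+1 w) (- rr k w); rewrite nsqN.
    rewrite big_split/= -!mulr_sumr.
    have h1 : \sum_(k < n) nsq (rr k.+1 w) <= \sum_(k < n.+1) nsq (rr k w).
      by rewrite big_ord_recl/= lerDr nsq_ge0.
    have h2 : \sum_(k < n) nsq (rr k w) <= \sum_(k < n.+1) nsq (rr k w).
      by rewrite big_ord_recr/= lerDl nsq_ge0.
    lra.
apply: (le_trans (rhoZ P c1 msum psum)); rewrite ler_wpM2l//.
apply: (@rho_sum _ _ _ P _ _ (fun (k : 'I_n.+1) w => nsq (rr k w))) => k.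
  exact: measurable_nsq.
by move=> w; exact: nsq_ge0.
Qed.

Let t := n%:R * h.

Let S2_le : L1 P (fun w => nsq (S2 w)) /\
  Ex P (fun w => nsq (S2 w)) <= D%:R ^+ 3 * K * t * eps.
Proof.
have [l e] := flow_noise_sum hF hA tau0 tauS n kN0 noiseN.
split=> //; apply: (le_trans e); rewrite /kN /t.
by rewrite le_eqVlt; apply/orP; left; apply/eqP; ring.
Qed.

Let S4_le : L1 P (fun w => nsq (S4 w)) /\
  Ex P (fun w => nsq (S4 w)) <= D%:R ^+ 3 * K * t * h * M.
Proof.
have [l e] := flow_noise_sum hF hA tau0 tauS n kY0 noiseY.
split=> //; apply: (le_trans e); rewrite /kY /t.
by rewrite le_eqVlt; apply/orP; left; apply/eqP; ring.
Qed.

Let S2'_le w : nsq (S2' w) <= t ^+ 2 * eps / 4.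
Proof.
apply: (le_trans (nsq_sum _)); rewrite card_ord.
apply: (@le_trans _ _ (n%:R * \sum_(k < n) h ^+ 2 * eps / 4)).
  rewrite ler_wpM2l//; apply: ler_sum => k _.
  by rewrite (nsq_flow_tr hA tau0 k) dd_le.
rewrite sumr_const card_ord -[_ *+ n]mulr_natl /t.
by rewrite le_eqVlt; apply/orP; left; apply/eqP; field.
Qed.

Let Ex_be k : L1 P (be k) /\ Ex P (be k) <=
  h * (8 * D%:R ^+ 2 * K * eps + 2 * h * eps + D%:R ^+ 2 * K * h * M +
       2 * M * K * h).
Proof.
have [lN eN] := nsq_col (@noiseN k); have [lY eY] := nsq_col (@noiseY k).
have [lf ef] := drv_four hA (tau0 k) (tauS k); rewrite tauB in ef.
have l1 : L1 P (fun w => 8 * nsq (Nv k w)) by exact: L1Z.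
have l2 : L1 P (fun w => 8 * nsq (Nv k w) + 2 * h ^+ 2 * eps).
  by apply: L1D => //; exact: L1_cst.
have l3 : L1 P (fun w => 8 * nsq (Nv k w) + 2 * h ^+ 2 * eps + nsq (Yv k w)).
  exact: L1D.
have l4 : L1 P (fun w => 2 * M * fsq (b k w) ^+ 2) by exact: L1Z.
split; first exact: L1D.
have e1 : Ex P (fun w => 8 * nsq (Nv k w)) = 8 * Ex P (fun w => nsq (Nv k w)).
  exact: ExZ.
have e3 : Ex P (fun w => 2 * M * fsq (b k w) ^+ 2) =
  2 * M * Ex P (fun w => fsq (b k w) ^+ 2) by exact: ExZ.
rewrite /be ExD// ExD// ExD//; last exact: L1_cst.
rewrite e1 e3 Ex_cst.
have e2 : 2 * M * Ex P (fun w => fsq (b k w) ^+ 2) <= 2 * M * (K * h ^+ 2).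
  by rewrite ler_wpM2l// mulr_ge0.
have -> : h * (8 * D%:R ^+ 2 * K * eps + 2 * h * eps + D%:R ^+ 2 * K * h * M +
   2 * M * K * h) = 8 * (D%:R * kN) + 2 * h ^+ 2 * eps + D%:R * kY +
   2 * M * (K * h ^+ 2) by rewrite /kN /kY; ring.
by apply: lerD => //; apply: lerD => //; rewrite lerD2r ler_wpM2l.
Qed.

Let rhoS3 lam : 0 < lam -> rho P (fun w => nsq (S3 w)) <=
  (lam * (D%:R ^+ 2 * K * t) + t * (8 * D%:R ^+ 2 * K * eps + 2 * h * eps +
    D%:R ^+ 2 * K * h * M + 2 * M * K * h) / lam) / 2.
Proof.
move=> l0.
have := @rho_nsq_sum _ T R P D n (fun k w => (W k w)^T *m vv k w)
  (fun k w => fsq (b k w)) be lam (D%:R ^+ 2 * K * h) _ l0 _ _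
  (fun k => (Ex_be k).1) _ _ vv_le _ (fun k => (Ex_be k).2).
have -> : n%:R * (D%:R ^+ 2 * K * h) = D%:R ^+ 2 * K * t by rewrite /t; ring.
rewrite [n%:R * (h * _)]mulrA; apply.
- by move=> k; exact: mx_measurableM.
- by move=> k; exact: (L1_fsq_inc hA (tau0 k) (tauS k)).
- by move=> k w; exact: fsq_ge0.
- move=> k w; rewrite /be !addr_ge0// ?mulr_ge0 ?nsq_ge0 ?sqr_ge0 ?fsq_ge0//.
- by move=> k; have := Ex_fsq_inc hA (tau0 k) (tauS k); rewrite tauB.
Qed.

(** [lam] stays free: the term [lam * (D^2 K t)] is made small first, and the terms divided by [lam]
    afterwards through [eps] and [h]. *)
Lemma flow_estimate lam : (0 < n)%N -> 0 < lam ->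
  rho P (fun w => nsq (u (tau n) w - W n w *m u 0 w)) <=
  Pr P B + (8 * n%:R * \sum_(k < n.+1) rho P (fun w => nsq (rr k w)) +
  (8 * (D%:R ^+ 3 * K * t * eps) + (8 * (t ^+ 2 * eps / 4) +
  (8 * ((lam * (D%:R ^+ 2 * K * t) + t * (8 * D%:R ^+ 2 * K * eps +
     2 * h * eps + D%:R ^+ 2 * K * h * M + 2 * M * K * h) / lam) / 2) +
   2 * (D%:R ^+ 3 * K * t * h * M))))).
Proof.
move=> n0 l0.
have [l2 e2] := S2_le; have [l4 e4] := S4_le.
have m1 := measurable_nsq mS1.
have m2 := L1_measurable l2; have m4 := L1_measurable l4.
have m2' := measurable_nsq (mS mdd); have m3 := measurable_nsq (mS mvv).
have g1 w := nsq_ge0 (S1 w). have g2 w := nsq_ge0 (S2 w).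
have g3 w := nsq_ge0 (S3 w). have g4 w := nsq_ge0 (S4 w).
have g2' w := nsq_ge0 (S2' w).
have ZD (c : R) (Q Q' : T -> R) : 1 <= c -> measurable_fun setT Q ->
    measurable_fun setT Q' -> (forall w, 0 <= Q w) -> (forall w, 0 <= Q' w) ->
    rho P (fun w => c * Q w + Q' w) <= c * rho P Q + rho P Q'.
  move=> c1 mQ mQ' Q0 Q'0; apply: (le_trans (rhoD _ _ _ _ _)) => //.
  - exact: measurable_funM.
  - by move=> w; rewrite mulr_ge0// (le_trans ler01).
  - by rewrite lerD2r; exact: rhoZ.
have mZ (c : R) (Q : T -> R) : measurable_fun setT Q ->
  measurable_fun setT (fun w => c * Q w) by move=> mQ; exact: measurable_funM.
pose Q4 w := 2 * nsq (S4 w).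
pose Q3 w := 8 * nsq (S3 w) + Q4 w.
pose Q2' w := 8 * nsq (S2' w) + Q3 w.
pose Q2 w := 8 * nsq (S2 w) + Q2' w.
have mQ4 : measurable_fun setT Q4 by exact: mZ.
have mQ3 : measurable_fun setT Q3 by apply: measurable_funD => //; exact: mZ.
have mQ2' : measurable_fun setT Q2' by apply: measurable_funD => //; exact: mZ.
have mQ2 : measurable_fun setT Q2 by apply: measurable_funD => //; exact: mZ.
have p4 w : 0 <= Q4 w by rewrite mulr_ge0 ?g4.
have p3 w : 0 <= Q3 w by rewrite addr_ge0// mulr_ge0 ?g3.
have p2' w : 0 <= Q2' w by rewrite addr_ge0// mulr_ge0 ?g2'.
have p2 w : 0 <= Q2 w by rewrite addr_ge0// mulr_ge0 ?g2.
have r4 : rho P Q4 <= 2 * (D%:R ^+ 3 * K * t * h * M).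
  apply: (le_trans (rhoZ P _ m4 g4)); first lra.
  by rewrite ler_wpM2l// (le_trans (rho_Ex l4 g4)).
have r2 : rho P (fun w => nsq (S2 w)) <= D%:R ^+ 3 * K * t * eps.
  exact: le_trans (rho_Ex l2 g2) e2.
have r2' : rho P (fun w => nsq (S2' w)) <= t ^+ 2 * eps / 4.
  apply: (@le_trans _ _ (rho P (fun=> t ^+ 2 * eps / 4))); first exact: rho_le.
  apply: (le_trans (rho_Ex (L1_cst P _) _)); last by rewrite Ex_cst.
  by move=> _; rewrite divr_ge0// mulr_ge0// sqr_ge0.
apply: (@le_trans _ _ (Pr P B + rho P (fun w => 2 * nsq (S1 w) + Q2 w))).
  apply: rho_off_rho => //.
  - apply: measurable_nsq; apply: mx_measurableB; first exact: mu0.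
    by apply: mx_measurableM => //; exact: mu0.
  - by apply: measurable_funD => //; exact: mZ.
  - by move=> w; exact: nsq_ge0.
  - by move=> w; rewrite addr_ge0// mulr_ge0 ?g1.
rewrite lerD2l.
have c2 : 1 <= 2 :> R by lra.
have c8 : 1 <= 8 :> R by lra.
apply: (le_trans (ZD _ _ _ c2 m1 mQ2 g1 p2)); apply: lerD.
  rewrite [8 * n%:R * _](_ : _ = 2 * (4 * n%:R *
    \sum_(k < n.+1) rho P (fun w => nsq (rr k w)))); last by ring.
  by rewrite ler_wpM2l//; exact: rhoS1.
apply: (le_trans (ZD _ _ _ c8 m2 mQ2' g2 p2')); apply: lerD; first lra.
apply: (le_trans (ZD _ _ _ c8 m2' mQ3 g2' p3)); apply: lerD; first lra.
apply: (le_trans (ZD _ _ _ c8 m3 mQ4 g3 p4)); apply: lerD => //.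
by rewrite ler_wpM2l//; exact: rhoS3.
Qed.

End FlowEstimate.

Section SmallChoices.
Context {R : realType}.

Lemma small_factor (c e : R) : 0 <= c -> 0 < e ->
  exists x, [/\ 0 < x, x <= 1 & c * x <= e].
Proof.
move=> c0 e0; exists (Num.min 1 (e / (c + 1))).
have c1 : 0 < c + 1 by lra.
split; first by rewrite lt_min ltr01 divr_gt0.
  by rewrite ge_min lexx.
apply: (@le_trans _ _ ((c + 1) * (e / (c + 1)))).
  apply: ler_pM => //; last by rewrite ge_min lexx orbT.
  - by rewrite le_min ler01 divr_ge0// ltW.
  - lra.
by rewrite mulrC divfK// gt_eqF.
Qed.

Lemma small_mesh (t x : R) : 0 <= t -> 0 < x ->
  exists N, forall n, (N <= n)%N -> (0 < n)%N /\ t / n%:R <= x.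
Proof.
move=> t0 x0; exists (Num.bound (t / x)).+1 => n hn.
have n0 : (0 < n)%N by exact: leq_trans hn.
split=> //; rewrite ler_pdivrMr ?ltr0n// mulrC -ler_pdivrMr//.
have := archi_boundP (divr_ge0 t0 (ltW x0)) => /ltW h.
by apply: (le_trans h); rewrite ler_nat ltnW.
Qed.

Lemma uniform_bound (Q : nat -> nat -> Prop) n :
  (forall k, exists M, forall m, (M <= m)%N -> Q k m) ->
  exists M, forall k m, (k <= n)%N -> (M <= m)%N -> Q k m.
Proof.
move=> h; elim: n => [|n [M hM]].
  have [M hM] := h 0%N; exists M => k m; rewrite leqn0 => /eqP ->.
  exact: hM.
have [M' hM'] := h n.+1; exists (maxn M M') => k m.
rewrite geq_max leq_eqVlt => /orP[/eqP ->|kn] /andP[m1 m2]; first exact: hM'.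
exact: hM.
Qed.

End SmallChoices.

(** * Convergence of the Cayley flow to the solution *)

Section FlowConvergence.
Context {d : measure_display} {T : measurableType d} {R : realType}.
Variable P : probability T R.
Variable F : R -> set (set T).
Hypothesis hF : is_filtration F.
Variables (D : nat) (A : R -> T -> 'M[R]_D) (K : R).
Hypothesis hA : antisym_driver P F A K.
Variable u : R -> T -> 'cV[R]_D.

(* [sde_riemann] is the equation [du = dA u - u/2 dt], with the integrals
   replaced by limits of left-point Riemann sums. *)
Record linear_sde : Prop := LinearSDE {
  sde_mes : forall t, 0 <= t -> mx_adapted (F t) (u t);
  sde_bounded : forall w t, 0 <= t -> exists c : R,
    forall s, 0 <= s <= t -> nsq (u s w) <= c;
  sde_cont : forall w t e, 0 <= t -> 0 < e -> exists2 dl : R, 0 < dl &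
    forall r s, 0 <= r <= t -> 0 <= s <= t -> `|r - s| <= dl ->
      nsq (u r w - u s w) <= e;
  sde_riemann : forall t, 0 <= t -> null_seq (fun m => rho P (fun w =>
    nsq (u t w - u 0 w - \sum_(l < m)
      (inc A (fine_time (t / m%:R) l) (fine_time (t / m%:R) l.+1) w -
       (t / m%:R / 2)%:M) *m u (fine_time (t / m%:R) l) w))) }.

Hypothesis hu : linear_sde.
Variable t : R.
Hypothesis t0 : 0 <= t.

Let mu_ s : 0 <= s -> mx_measurable (u s).
Proof. by move=> s0; exact: (mx_adapted_measurable hF s0 (sde_mes hu s0)). Qed.

Local Notation mesh n r := (t / (n * r)%:R).

Let mesh0 n r : 0 <= mesh n r. Proof. by rewrite divr_ge0. Qed.

Let fine0 n r m : 0 <= fine_time (mesh n r) m.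
Proof. by rewrite mulr_ge0. Qed.

Let coarseE n r k : (0 < n)%N -> (0 < r)%N ->
  coarse_time r (mesh n r) k = k%:R * (t / n%:R).
Proof.
move=> n0 r0; rewrite /coarse_time !natrM.
by field; rewrite !pnatr_eq0 -!lt0n n0 r0.
Qed.

Let fine_le n r m : (m <= n * r)%N -> fine_time (mesh n r) m <= t.
Proof.
rewrite /fine_time; case: (posnP (n * r)) => [->|p h].
  by rewrite invr0 mulr0 mulr0.
rewrite mulrCA -[leRHS]mulr1 ler_wpM2l//.
by rewrite ler_pdivrMr ?ltr0n// mul1r ler_nat.
Qed.

Let measurable_gt (c : R) (f : T -> R) : measurable_fun setT f ->
  measurable [set w | c < f w].
Proof.
move=> mf; have := mf measurableT _ (measurable_itv `]c, +oo[).
by rewrite setTI; congr measurable; apply/seteqP; split=> w /=;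
  rewrite in_itv/= andbT.
Qed.

(** The union runs over all grids, so that [M] can be fixed before [n] and [r]. *)
Let big M : set T := \bigcup_n \bigcup_r \bigcup_(k in [set k | (k < n)%N])
  [set w | M%:R < nsq (u (coarse_time r (mesh n r) k) w)].

Let measurable_big M : measurable (big M).
Proof.
apply: bigcup_measurable => n _; apply: bigcup_measurable => r _.
apply: bigcup_measurable => k _; apply: measurable_gt.
by apply: measurable_nsq; apply: mu_; exact: fine0.
Qed.

(** The union runs over [r] only: [n] is chosen to make this event unlikely, and [r] comes
    afterwards. *)
Let osc eps n : set T := \bigcup_r \bigcup_(k in [set k | (k < n)%N])
  \bigcup_(l in [set l | (l < r)%N])
  [set w | eps < nsq (u (fine_time (mesh n r) (k * r + l)) w -
                      u (coarse_time r (mesh n r) k) w)].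

Let measurable_osc eps n : measurable (osc eps n).
Proof.
apply: bigcup_measurable => r _; apply: bigcup_measurable => k _.
apply: bigcup_measurable => l _; apply: measurable_gt.
by apply: measurable_nsq; apply: mx_measurableB; apply: mu_; exact: fine0.
Qed.

Let big_null : null_seq (fun M => Pr P (big M)).
Proof.
apply: Pr_null_pointwise => // w; have [c hc] := sde_bounded hu w t0.
exists (Num.bound (Num.max 0 c)) => M hM [n _ [r _ [k /= kn]]].
apply/negP; rewrite -leNgt.
apply: (@le_trans _ _ c).
  apply: hc; rewrite fine0 fine_le//.
  by rewrite leq_mul2r ltnW ?orbT.
have c0 : 0 <= Num.max 0 c by rewrite le_max lexx.
apply: (@le_trans _ _ (Num.max 0 c)); first by rewrite le_max lexx orbT.
have /ltW h := archi_boundP c0; apply: (le_trans h).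
by rewrite ler_nat.
Qed.

Let osc_null eps : 0 < eps -> null_seq (fun n => Pr P (osc eps n)).
Proof.
move=> e0; apply: Pr_null_pointwise => // w.
have [dl dl0 hdl] := sde_cont hu w t0 e0.
have [N hN] := small_mesh t0 dl0.
exists N => n /hN[n0 hn] [r _ [k /= kn [l /= lr]]].
apply/negP; rewrite -leNgt.
have r0 : (0 < r)%N by exact: leq_ltn_trans lr.
have kr : (k * r + l <= n * r)%N.
  apply: (@leq_trans (k.+1 * r)); first by rewrite mulSn addnC leq_add2r ltnW.
  by rewrite leq_mul2r kn orbT.
apply: hdl.
- by rewrite fine0 fine_le.
- by rewrite fine0 fine_le// (leq_trans _ kr)// leq_addr.
- rewrite /fine_time /coarse_time -mulrBl -natrB ?leq_addr// addKn.
  rewrite ger0_norm ?mulr_ge0//; apply: le_trans hn.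
  apply: (@le_trans _ _ (r%:R * mesh n r)).
    by rewrite ler_wpM2r// ler_nat ltnW.
  rewrite le_eqVlt; apply/orP; left; apply/eqP.
  by rewrite natrM; field; rewrite !pnatr_eq0 -!lt0n n0 r0.
Qed.

Let rr n r k w := u (coarse_time r (mesh n r) k) w - u 0 w -
  \sum_(m < k * r) (inc A (fine_time (mesh n r) m) (fine_time (mesh n r) m.+1) w
    - (mesh n r / 2)%:M) *m u (fine_time (mesh n r) m) w.

(** The node [k t / n], cut into [k r] cells, has the same mesh [t / (n r)] for every [k], so
    [sde_riemann] is applied at finitely many times and one [r] serves all nodes. *)
Let rr_null n e : (0 < n)%N -> 0 < e -> exists r, (0 < r)%N /\
  forall k, (k <= n)%N -> rho P (fun w => nsq (rr n r k w)) <= e.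
Proof.
move=> n0 e0.
have tk k : 0 <= k%:R * (t / n%:R) by rewrite mulr_ge0// divr_ge0.
have [r hr] := uniform_bound n (fun k => sde_riemann hu (tk k) e0).
exists r.+1; split=> // k kn.
(* The number [k * r.+1] of cells reaches [r] only for [k > 0]; at [k = 0] the defect is 0. *)
case: (posnP k) => [->|k0].
  apply: le_trans (ltW e0); rewrite le_eqVlt; apply/orP; left; apply/eqP.
  rewrite -[RHS](Ex_cst P); apply: eq_Ex => w.
  rewrite /rr mul0n big_ord0 subr0.
  have -> : coarse_time r.+1 (mesh n r.+1) 0 = 0.
    by rewrite /coarse_time mul0n mul0r.
  by rewrite subrr nsq0 min_r.
have := hr k (k * r.+1)%N kn _; rewrite /rr coarseE//.
have -> : k%:R * (t / n%:R) / (k * r.+1)%:R = mesh n r.+1.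
  rewrite !natrM; move: (r.+1) (ltn0Sn r) => r' r'0.
  by field; rewrite !pnatr_eq0 -!lt0n n0 k0 r'0.
by apply; rewrite (leq_trans (leqnSn _))// leq_pmull.
Qed.

Theorem flow_cvg : null_seq (fun n => rho P (fun w =>
  nsq (u t w - flow A (fun k => k%:R * (t / n%:R)) n w *m u 0 w))).
Proof.
move=> e e0; have e6 : 0 < e / 6 by lra.
have K0 := drv_K hA.
have D2 : 0 <= D%:R ^+ 2 * K :> R by rewrite mulr_ge0.
have D3 : 0 <= D%:R ^+ 3 * K :> R by rewrite mulr_ge0.
set a := D%:R ^+ 2 * K in D2; set a3 := D%:R ^+ 3 * K in D3.
(* The error is split into six equal parts. The parameters are chosen in the order [lam], [eps],
   [M], [x], [n], [r], each in terms of the earlier ones. *)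
have [lam [l0 l1 hl]] := small_factor (mulr_ge0 (mulr_ge0 (ler0n R 4) D2) t0) e6.
(* The coefficient of [eps] in the final bound, after bounding the mesh in it by 1; [c2] below is
   the coefficient of the mesh. *)
set c1 := 8 * a3 * t + 2 * t ^+ 2 + (32 * a * t + 8 * t) / lam.
have c10 : 0 <= c1.
  by rewrite /c1 !addr_ge0 ?divr_ge0 ?addr_ge0 ?mulr_ge0 ?sqr_ge0// ltW.
have [eps [eps0 eps1 heps]] := small_factor c10 e6.
have [M hM] := big_null e6; have {}hM := hM M (leqnn _).
set c2 := M%:R * (2 * a3 * t + (4 * a * t + 8 * K * t) / lam).
have c20 : 0 <= c2.
  by rewrite /c2 mulr_ge0// !addr_ge0 ?divr_ge0 ?addr_ge0 ?mulr_ge0// ltW.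
have [x [x0 x1 hx]] := small_factor c20 e6.
have [N1 hN1] := osc_null eps0 e6.
have [N2 hN2] := small_mesh t0 x0.
exists (maxn N1 N2) => n; rewrite geq_max => /andP[/hN1 {}hN1 /hN2[n0 hn]].
(* Compensates the factor [8 n] and the [n + 1] nodes in [flow_estimate]. *)
have e' : 0 < e / 6 / (8 * n%:R * n.+1%:R).
  by rewrite divr_gt0// !mulr_gt0// ltr0n.
have [r [r0 hr]] := rr_null n0 e'.
pose B := big M `|` osc eps n.
have mB : measurable B by exact: measurableU.
have PB : Pr P B <= e / 6 + e / 6.
  apply: (@le_trans _ _ (Pr P (big M) + Pr P (osc eps n))); last exact: lerD.
  rewrite /Pr -ExD; [|exact: L1_indic|exact: L1_indic].
  apply: le_Ex; [exact: L1_indic|by apply: L1D; exact: L1_indic|].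
  move=> w; rewrite !indicE /B in_setU.
  by case: (w \in big M); case: (w \in osc eps n);
    rewrite /= ?addr0 ?add0r// lerDl ler01.
have goodq w : ~ B w -> forall k, (k < n)%N ->
    nsq (u (coarse_time r (mesh n r) k) w) <= M%:R.
  move=> Bw k kn; rewrite leNgt; apply/negP => h; apply: Bw; left.
  by exists n => //; exists r => //; exists k.
have goodx w : ~ B w -> forall k l, (k < n)%N -> (l < r)%N ->
    nsq (u (fine_time (mesh n r) (k * r + l)) w -
         u (coarse_time r (mesh n r) k) w) <= eps.
  move=> Bw k l kn lr; rewrite leNgt; apply/negP => h; apply: Bw; right.
  by exists r => //; exists k => //; exists l.
have := flow_estimate hF hA (sde_mes hu) (mesh0 n r) (ltW eps0) (ler0n R M) mB
  goodq goodx n0 l0.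
have hE : r%:R * mesh n r = t / n%:R.
  by rewrite natrM; field; rewrite !pnatr_eq0 -!lt0n n0 r0.
have tE : n%:R * (r%:R * mesh n r) = t.
  by rewrite hE mulrC divfK// pnatr_eq0 -lt0n.
rewrite tE hE.
have -> : coarse_time r (mesh n r) n = t.
  by rewrite coarseE// mulrC divfK// pnatr_eq0 -lt0n.
have -> : flow A (coarse_time r (mesh n r)) n =
    flow A (fun k => k%:R * (t / n%:R)) n.
  by congr flow; apply/funext => k; exact: coarseE.
move=> h; apply: (le_trans h) => {h}.
rewrite -[8 * D%:R ^+ 2 * K]mulrA -/a -/a3; set h := t / n%:R in hn *.
have h0 : 0 <= h by rewrite divr_ge0.
have h1 : h <= 1 by exact: le_trans hn x1.
have hS : 8 * n%:R * \sum_(k < n.+1) rho P (fun w => nsq (rr n r k w)) <= e / 6.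
  apply: (@le_trans _ _ (8 * n%:R * \sum_(k < n.+1) (e / 6 / (8 * n%:R * n.+1%:R)))).
    by rewrite ler_wpM2l ?mulr_ge0//; apply: ler_sum => k _; exact: (hr k (ltn_ord k)).
  rewrite sumr_const card_ord -(mulr_natl (e / 6 / _)).
  rewrite le_eqVlt; apply/orP; left; apply/eqP.
  move: (n.+1) (ltn0Sn n) => m m0.
  by field; rewrite !pnatr_eq0 -!lt0n n0 m0.
have hmain : 8 * (a3 * t * eps) + (8 * (t ^+ 2 * eps / 4) +
    (8 * ((lam * (a * t) + t * (8 * a * eps + 2 * h * eps + a * h * M%:R +
       2 * M%:R * K * h) / lam) / 2) + 2 * (a3 * t * h * M%:R))) <=
    e / 6 + (e / 6 + e / 6).
  have -> : 8 * (a3 * t * eps) + (8 * (t ^+ 2 * eps / 4) +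
    (8 * ((lam * (a * t) + t * (8 * a * eps + 2 * h * eps + a * h * M%:R +
       2 * M%:R * K * h) / lam) / 2) + 2 * (a3 * t * h * M%:R))) =
    4 * a * t * lam + ((8 * a3 * t + 2 * t ^+ 2 + (32 * a * t + 8 * t * h) / lam)
      * eps + c2 * h).
    by rewrite /c2; field; rewrite gt_eqF.
  apply: lerD => //; apply: lerD.
    apply: le_trans heps; rewrite ler_wpM2r ?(ltW eps0)// /c1 lerD2l.
    rewrite ler_pM2r ?invr_gt0// lerD2l -[leRHS]mulr1 ler_wpM2l//.
    by rewrite mulr_ge0.
  by apply: le_trans hx; rewrite ler_wpM2l.
have -> : e = (e / 6 + e / 6) + (e / 6 + (e / 6 + (e / 6 + e / 6))) by field.
apply: lerD => //; apply: lerD => //.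
Qed.

End FlowConvergence.

(** * Riemann sums along continuous paths *)

Section Paths.
Context {R : realType}.
Implicit Types (f g : R -> R).

Lemma within_continuous_eps f x e : {within `[0, +oo[, continuous f} ->
  0 <= x -> 0 < e ->
  exists2 eta : R, 0 < eta & forall y, 0 <= y -> `|x - y| < eta -> `|f x - f y| < e.
Proof.
move=> cf x0 e0.
have /subspace_continuousP/(_ x) := cf.
rewrite /= in_itv/= andbT => /(_ x0) /cvgrPdist_lt /(_ e e0).
rewrite /= nearE /within/= => -[eta /= eta0 h].
exists eta => // y y0 xy; apply: h => //.
by rewrite in_itv/= andbT.
Qed.

Lemma heine f t e : {within `[0, +oo[, continuous f} -> 0 < e ->
  exists2 dl : R, 0 < dl & forall r s, 0 <= r <= t -> 0 <= s <= t ->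
    `|r - s| <= dl -> `|f r - f s| <= e.
Proof.
move=> cf e0.
have /compact_near_coveringP nc := @segment_compact R 0 t.
pose Q (dl r : R) := forall s, 0 <= r <= t -> 0 <= s <= t ->
  `|r - s| <= dl -> `|f r - f s| <= e.
have [eta /= eta0 h] : \forall dl \near (0 : R)^'+, (`[0, t] : set R) `<=` Q dl.
  apply: nc => x.
rewrite /= in_itv/= => /andP[x0 xt]; have e20 : 0 < e / 2 by lra.
  have [eta eta0 heta] := within_continuous_eps cf x0 e20.
  have eta20 : 0 < eta / 2 by lra.
  exists (ball x (eta / 2), [set i : R | i < eta / 2]).
    by split; [exact: nbhsx_ballx|exact: nbhs_right_lt].
  move=> [r dl] /= [xr dle] s /andP[r0 rt] /andP[s0 st] rs.
  have h1 : `|f x - f r| < e / 2 by apply: heta => //; rewrite (lt_trans xr)//; lra.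
  have h2 : `|f x - f s| < e / 2.
    apply: heta => //.
    have -> : x - s = (x - r) + (r - s) by ring.
    by apply: (le_lt_trans (ler_normD _ _)); rewrite /ball/= in xr; lra.
  have -> : f r - f s = (f x - f s) - (f x - f r) by ring.
  by apply: (le_trans (ler_normB _ _)); lra.
exists (eta / 2) => [|r s r0t s0t rs]; first lra.
  apply: (h (eta / 2)) => //; last lra.
  by rewrite /ball/= sub0r normrN gtr0_norm; lra.
Qed.

Lemma bounded_path f t : {within `[0, +oo[, continuous f} ->
  exists c, forall s, 0 <= s <= t -> `|f s| <= c.
Proof.
move=> cf.
have /compact_near_coveringP nc := @segment_compact R 0 t.
have [M [_ h]] : \forall c \near +oo%R,
    (`[0, t] : set R) `<=` (fun r => 0 <= r <= t -> `|f r| <= c).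
  apply: (nc R +oo%R (fun c r => 0 <= r <= t -> `|f r| <= c)) => x.
rewrite /= in_itv/= => /andP[x0 xt].
  have [eta eta0 heta] := within_continuous_eps cf x0 ltr01.
  exists (ball x eta, [set c : R | `|f x| + 1 < c]).
    by split; [exact: nbhsx_ballx|exact: nbhs_pinfty_gt].
  move=> [r c] /= [xr cx] /andP[r0 rt].
  have h1 := heta r r0 xr.
  have -> : f r = f x - (f x - f r) by ring.
  by apply: (le_trans (ler_normB _ _)); lra.
exists (M + 1) => s st; apply: (h (M + 1)) => //; lra.
Qed.

Definition grid (t : R) (m l : nat) : R := l%:R * (t / m%:R).

Lemma gridS t m l : grid t m l.+1 = grid t m l + t / m%:R.
Proof. by rewrite /grid -natr1 mulrDl mul1r. Qed.

Lemma grid_end t m : (0 < m)%N -> grid t m m = t.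
Proof. by move=> m0; rewrite /grid mulrC divfK// pnatr_eq0 -lt0n. Qed.

Lemma grid_le t m k l : 0 <= t -> (k <= l)%N -> grid t m k <= grid t m l.
Proof. by move=> t0 kl; rewrite ler_wpM2r ?divr_ge0// ler_nat. Qed.

Lemma grid_ge0 t m l : 0 <= t -> 0 <= grid t m l.
Proof. by move=> t0; rewrite mulr_ge0// divr_ge0. Qed.

Lemma grid_le_end t m l : 0 <= t -> (l <= m)%N -> grid t m l <= t.
Proof.
move=> t0; case: (posnP m) => [->|m0 lm]; first by rewrite /grid invr0 !mulr0.
by rewrite -[leRHS](grid_end t m0); exact: grid_le.
Qed.

(** Turns the indicator of [grid t m l <= a] into an initial range of indices, over which a sum can
    telescope. *)
Lemma grid_threshold t a m : 0 <= t -> exists2 K, (K <= m)%N &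
  forall l, (l < m)%N -> (grid t m l <= a) = (l < K)%N.
Proof.
move=> t0; suff h n : exists2 K, (K <= n)%N &
    forall l, (l < n)%N -> (grid t m l <= a) = (l < K)%N by exact: h.
elim: n => [|n [K Kn hK]]; first by exists 0%N.
have [na|na] := leP (grid t m n) a.
  exists n.+1 => // l; rewrite ltnS => ln; rewrite ln.
  exact: le_trans (grid_le _ t0 ln) na.
exists K => [|l]; first exact: leqW.
rewrite ltnS leq_eqVlt => /orP[/eqP ->|]; last exact: hK.
by rewrite leNgt na/= ltnNge Kn.
Qed.

(** The sum telescopes to [f (grid t m K) - f 0], and [grid t m K] lies within one mesh of
    [min a t]; uniform continuity of [f] concludes. *)
Lemma grid_stopped_sum f t a : {within `[0, +oo[, continuous f} ->
  0 <= t -> 0 <= a ->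
  null_seq (fun m => `|\sum_(l < m) (f (grid t m l.+1) - f (grid t m l)) *
    (grid t m l <= a)%R%:R - (f (Num.min a t) - f 0)|).
Proof.
move=> cf t0 a0 e e0.
have [dl dl0 hdl] := heine t cf e0.
have [M hM] := small_mesh t0 dl0.
exists M => m /hM[m0 hm].
have [K Km hK] := grid_threshold a m t0.
have K0 : (0 < K)%N.
  by rewrite -hK// /grid mul0r.
have -> : \sum_(l < m) (f (grid t m l.+1) - f (grid t m l)) *
    (grid t m l <= a)%R%:R = f (grid t m K) - f 0.
  rewrite (eq_bigr (fun l : 'I_m => if (l < K)%N then
      f (grid t m l.+1) - f (grid t m l) else 0)); last first.
    by move=> l _; rewrite hK//; case: ifP; rewrite ?mulr1 ?mulr0.
  rewrite -big_mkcond/= -(big_ord_widen m (fun l => f (grid t m l.+1) -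
    f (grid t m l)) Km).
  rewrite -(big_mkord xpredT (fun l => f (grid t m l.+1) - f (grid t m l))).
  by rewrite telescope_sumr// [grid t m 0]mul0r.
have -> : f (grid t m K) - f 0 - (f (Num.min a t) - f 0) =
  f (grid t m K) - f (Num.min a t) by ring.
have m0t : 0 <= Num.min a t <= t by rewrite le_min a0 t0 ge_min lexx orbT.
apply: hdl => //; first by rewrite grid_ge0// grid_le_end.
have ta : grid t m K.-1 <= a by rewrite hK ?prednK// (leq_trans _ Km)// ltn_predL.
have tt : grid t m K <= t by exact: grid_le_end.
have gS : grid t m K = grid t m K.-1 + t / m%:R by rewrite -gridS prednK.
apply: le_trans hm; rewrite ler_norml; apply/andP; split.
- have [KE|KE] := eqVneq K m.
    by rewrite KE grid_end//; have := divr_ge0 t0 (ler0n R m);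
      have : Num.min a t <= t by [rewrite ge_min lexx orbT]; lra.
  have Klt : (K < m)%N by rewrite ltn_neqAle KE.
  have : ~~ (grid t m K <= a) by rewrite hK// ltnn.
  rewrite -ltNge => aK.
  have : Num.min a t <= a by rewrite ge_min lexx.
  by have := divr_ge0 t0 (ler0n R m); lra.
- rewrite gS lerBlDl lerD2r le_min ta/=.
  by apply: grid_le_end => //; exact: leq_trans (leq_pred _) Km.
Qed.

Lemma grid_elementary_sum f t a b : {within `[0, +oo[, continuous f} ->
  0 <= t -> 0 <= a -> a <= b ->
  null_seq (fun m => `|\sum_(l < m) (f (grid t m l.+1) - f (grid t m l)) *
    (a < grid t m l <= b)%R%:R - (f (Num.min b t) - f (Num.min a t))|).
Proof.
move=> cf t0 a0 ab e e0; have e20 : 0 < e / 2 by lra.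
have [M1 h1] := grid_stopped_sum cf t0 a0 e20.
have [M2 h2] := grid_stopped_sum cf t0 (le_trans a0 ab) e20.
exists (maxn M1 M2) => m; rewrite geq_max => /andP[/h1 {}h1 /h2 {}h2].
have -> : \sum_(l < m) (f (grid t m l.+1) - f (grid t m l)) *
    (a < grid t m l <= b)%R%:R =
    \sum_(l < m) (f (grid t m l.+1) - f (grid t m l)) * (grid t m l <= b)%R%:R -
    \sum_(l < m) (f (grid t m l.+1) - f (grid t m l)) * (grid t m l <= a)%R%:R.
  rewrite -sumrB; apply: eq_bigr => l _; rewrite -mulrBr; congr (_ * _).
  have [la|la] := leP (grid t m l) a; last by rewrite subr0.
  by rewrite (le_trans la ab) subrr.
move: h1 h2; set x := \sum_(l < m) _; set y := \sum_(l < m) _ => h1 h2.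
have -> : y - x - (f (Num.min b t) - f (Num.min a t)) =
  (y - (f (Num.min b t) - f 0)) - (x - (f (Num.min a t) - f 0)) by ring.
by apply: (le_trans (ler_normB _ _)); lra.
Qed.

Lemma grid_cell t m s : (0 < m)%N -> 0 < s <= t ->
  exists2 l : 'I_m, grid t m l < s & s <= grid t m l.+1.
Proof.
move=> m0 /andP[s0 st].
have h n : s <= grid t m n -> exists2 l, (l < n)%N &
    grid t m l < s /\ s <= grid t m l.+1.
  elim: n => [|n IH]; first by rewrite /grid mul0r leNgt s0.
  have [/IH[l ln hl] _|sn sn1] := leP s (grid t m n).
    by exists l => //; exact: leqW.
  by exists n.
have [|l lm [h1 h2]] := h m; first by rewrite grid_end.
by exists (Ordinal lm).
Qed.

End Paths.

(** * Riemann sums of left-continuous functions *)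

Section RiemannSums.
Context {R : realType}.
Local Notation mu := (@lebesgue_measure R).
Variables (g : R -> R) (t c : R).
Hypothesis t0 : 0 < t.
Hypothesis gc : forall s, 0 <= s <= t -> `|g s| <= c.
Hypothesis gl : forall s e, 0 < s <= t -> 0 < e -> exists2 eta : R, 0 < eta &
  forall x, 0 <= x -> x < s -> s - x <= eta -> `|g x - g s| <= e.

Let cell m l : set R := `]grid t m l, grid t m l.+1]%classic.
(** Cells are open on the left, so at [s] the step function takes its value at a node strictly
    before [s]. Left continuity of [g] is then enough, and simple processes offer no more. *)
Let G m s := \sum_(l < m) g (grid t m l) * \1_(cell m l) s.

Let GE m s (l : 'I_m) : grid t m l < s -> s <= grid t m l.+1 ->
  G m s = g (grid t m l).
Proof.
move=> ls sl; rewrite /G (bigD1 l)//= big1 ?addr0 => [|k kl].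
  by rewrite indicE mem_set ?mulr1//= /cell/= in_itv/= ls sl.
rewrite indicE memNset ?mulr0//= /cell/= in_itv/= => /andP[ks sk].
move: kl; rewrite neq_ltn => /orP[kl|lk].
  have := lt_le_trans ls (le_trans sk (grid_le m (ltW t0) kl)).
  by rewrite ltxx.
have := lt_le_trans ks (le_trans sl (grid_le m (ltW t0) lk)).
by rewrite ltxx.
Qed.

Let G_bounded m s : `|G m s| <= `|c|.
Proof.
case: (posnP m) => [m0|m0].
  by rewrite /G m0 big_ord0 normr0.
have [st|st] := pselect (0 < s <= t).
  have [l h1 h2] := grid_cell m0 st; rewrite (GE h1 h2).
  apply: (le_trans (gc _)); last exact: ler_norm.
  by rewrite grid_ge0 ?(ltW t0)// grid_le_end ?(ltW t0)// ltnW.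
rewrite /G big1 ?normr0// => l _; rewrite indicE memNset ?mulr0//=.
rewrite /cell/= in_itv/= => /andP[ls sl]; apply: st; apply/andP; split.
  by apply: le_lt_trans ls; exact: grid_ge0 (ltW t0).
by apply: (le_trans sl); exact: grid_le_end (ltW t0) _.
Qed.

Let measurable_G m : measurable_fun setT (G m).
Proof.
apply: measurable_sum => l; apply: measurable_funM => //.
by apply: measurable_indic; exact: measurable_itv.
Qed.

Let G_cvg s : 0 < s <= t -> G m s @[m --> \oo] --> g s.
Proof.
move=> st; apply/cvgrPdist_le => e e0.
have [eta eta0 heta] := gl st e0.
have [M hM] := small_mesh (ltW t0) eta0.
near=> m.
have [m0 hm] : (0 < m)%N /\ t / m%:R <= eta.
  by apply: hM; near: m; exact: nbhs_infty_ge.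
have [l h1 h2] := grid_cell m0 st.
rewrite (GE h1 h2) distrC; apply: heta => //.
  exact: grid_ge0 (ltW t0).
by move: h2; rewrite gridS; lra.
Unshelve. all: by end_near. Qed.

Let integral_G m : (0 < m)%N ->
  (\int[mu]_(s in `]0%R, t]) (G m s)%:E)%E =
  (\sum_(l < m) g (grid t m l) * (t / m%:R))%:E.
Proof.
move=> m0; rewrite /G.
under eq_integral do rewrite -sumEFin.
rewrite integral_sum//=; last first.
  move=> l; apply: (integrableS measurableT) => //.
  under eq_fun do rewrite EFinM.
  exact/integrableZl/integrable_indic_itv.
rewrite -sumEFin; apply: eq_bigr => l _.
under eq_integral do rewrite EFinM.
rewrite integralZl//; last first.
  by apply: (integrableS measurableT) => //; exact: integrable_indic_itv.
rewrite integral_indic//=; last exact: measurable_itv.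
have -> : cell m l `&` `]0, t] = cell m l.
  apply/setIidPl => s; rewrite /cell /= !in_itv/= => /andP[ls sl].
  apply/andP; split.
    by apply: le_lt_trans ls; exact: grid_ge0 (ltW t0).
  by apply: (le_trans sl); exact: grid_le_end (ltW t0) _.
rewrite EFinM; congr (_ * _)%E.
rewrite [LHS](lebesgue_measure_itv `]grid t m l, grid t m l.+1])/= lte_fin gridS.
rewrite ltrDl divr_gt0 ?ltr0n//.
by rewrite -EFinD; congr EFin; ring.
Qed.

Let measurable_g : measurable_fun `]0, t] g.
Proof.
apply: (measurable_fun_cvg (h := G)) => [m|s].
  exact: measurable_funTS.
by rewrite /= in_itv/=; exact: G_cvg.
Qed.

(** Dominated convergence for the step functions [G], whose pointwise convergence also yields the
    measurability of [g]. *)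
Lemma riemann_sum_cvg : null_seq (fun m =>
  `|\sum_(l < m) g (grid t m l) * (t / m%:R) -
    (\int[mu]_(s in `[0%R, t]) g s)%R|).
Proof.
have mI : measurable (`]0, t] : set R) by exact: measurable_itv.
have [] := @dominated_convergence _ _ _ mu (`]0, t] : set R) mI
  (fun m s => (G m s)%:E) (EFin \o g) (cst `|c|%:E).
- by move=> m; apply/measurable_EFinP; exact: (measurable_funTS (measurable_G m)).
- exact/measurable_EFinP.
- apply: aeW => s; rewrite /= in_itv/= => st.
  by apply/fine_cvgP; split; [exact: nearW|exact: G_cvg].
- apply: measurable_bounded_integrable => //.
    by rewrite [X in (X < _)%E](lebesgue_measure_itv `]0, t])/= lte_fin t0 -EFinB ltry.
  exact: bounded_cst.
- by apply: aeW => s m _; rewrite lee_fin; exact: G_bounded.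
move=> ig _ hc.
have fi : (\int[mu]_(x in `]0%R, t]) (EFin \o g) x)%E \is a fin_num.
  by apply: integrable_fin_num ig.
move: hc; rewrite -[X in _ --> X -> _](fineK fi) => /fine_cvg h e e0.
have := h => /cvgrPdist_le /(_ e e0) [M _ hM].
exists M.+1 => m Mm; have m0 : (0 < m)%N by exact: leq_ltn_trans Mm.
have := hM m (ltnW Mm); rewrite /= integral_G//= distrC.
by rewrite -(Rintegral_itv_obnd_cbnd ig).
Qed.

End RiemannSums.

Section NullSeq.
Context {R : realType}.

Lemma null_seqW (r : nat -> R) : r n @[n --> \oo] --> 0 -> null_seq r.
Proof.
move=> /cvgrPdist_le h e e0; have [M _ hM] := h e e0.
exists M => n /hM /=; rewrite sub0r normrN; exact: le_trans (ler_norm _).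
Qed.

Lemma null_seq_cvg (x : nat -> R) (l : R) :
  null_seq (fun n => `|x n - l|) -> x n @[n --> \oo] --> l.
Proof.
move=> h; apply/cvgrPdist_le => e e0; have [M hM] := h e e0.
by exists M => // n /hM; rewrite distrC.
Qed.

Lemma cvg_sumr (S : Type) (G : set_system S) (FG : Filter G) (I : Type)
    (r : seq I) (f : I -> S -> R) (l : I -> R) :
  (forall i, f i x @[x --> G] --> l i) ->
  \sum_(i <- r) f i x @[x --> G] --> \sum_(i <- r) l i.
Proof.
move=> h; elim: r => [|i r IH].
  by under eq_fun do rewrite big_nil; rewrite big_nil; exact: cvg_cst.
by under eq_fun do rewrite big_cons; rewrite big_cons; apply: cvgD.
Qed.

Lemma null_nsq (D : nat) (v : nat -> 'cV[R]_D) :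
  (forall a, v n a 0 @[n --> \oo] --> 0) -> null_seq (fun n => nsq (v n)).
Proof.
move=> h; apply: null_seqW; rewrite -[X in _ --> X](_ : \sum_(a < D) 0 ^+ 2 = 0).
  apply: cvg_sumr => a; rewrite expr2.
  by apply: cvgM.
by rewrite big1// => a _; rewrite expr0n.
Qed.

End NullSeq.

(** * A Lenglart inequality for stochastic sums *)

Section Lenglart.
Context {d : measure_display} {T : measurableType d} {R : realType}.
Variable P : probability T R.
Variable F : R -> set (set T).
Hypothesis hF : is_filtration F.
Variables (D : nat) (A : R -> T -> 'M[R]_D) (K : R).
Hypothesis hA : antisym_driver P F A K.
Variables (h : R) (m : nat) (X : nat -> T -> 'cV[R]_D).
Hypothesis h0 : 0 < h.
Hypothesis mX : forall l, mx_adapted (F (fine_time h l)) (X l).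

Let fine0 l : 0 <= fine_time h l. Proof. by rewrite mulr_ge0// ltW. Qed.
Let fineS l : fine_time h l <= fine_time h l.+1.
Proof. by rewrite ler_wpM2r ?ler_nat// ltW. Qed.
Let fine_le k l : (k <= l)%N -> fine_time h k <= fine_time h l.
Proof. by move=> kl; rewrite ler_wpM2r ?ler_nat// ltW. Qed.

Let Q n w := \sum_(l < n) h * nsq (X l w).
Let V w := \sum_(l < m) inc A (fine_time h l) (fine_time h l.+1) w *m X l w.

Let Qmono n k w : (n <= k)%N -> Q n w <= Q k w.
Proof.
move=> nk; rewrite -(subnKC nk); elim: (k - n)%N => [|i IH]; first by rewrite addn0.
rewrite addnS /Q big_ord_recr/=; apply: (le_trans IH).
by rewrite lerDl mulr_ge0 ?nsq_ge0// ltW.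
Qed.

Let Q0 n w : 0 <= Q n w.
Proof. by apply: sumr_ge0 => l _; rewrite mulr_ge0 ?nsq_ge0// ltW. Qed.

(* The coefficients are set to [0] as soon as the accumulated quadratic
   variation [Q] exceeds [dl]. *)
Lemma lenglart (dl : R) : 0 < dl -> dl <= 1 ->
  rho P (fun w => nsq (V w)) <= rho P (Q m) / dl + D%:R ^+ 2 * K * dl.
Proof.
move=> dl0 dl1.
have mXm l : mx_measurable (X l).
  exact: (mx_adapted_measurable hF (fine0 l) (@mX l)).
have mQ n : measurable_fun setT (Q n).
  by apply: measurable_sum => l; apply: measurable_funM => //; exact: measurable_nsq.
have mQF l : mes_wrt (F (fine_time h l)) (Q l.+1).
  apply: measurable_sum => k; apply: measurable_funM => //.
  apply: measurable_nsq => i j.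
  apply: (mes_wrt_filtration hF (fine0 k) _ (@mX k i j)).
  by apply: fine_le; rewrite -ltnS.
(* [Q l.+1] contains [X l] yet is known at time [fine_time h l], so the stopped coefficient is still
   adapted and the sum never overshoots [dl]. *)
pose xi l w := if Q l.+1 w <= dl then X l w else 0.
have xiE l w i : xi l w i 0 = if Q l.+1 w <= dl then X l w i 0 else 0.
  by rewrite /xi; case: ifP => // _; rewrite mxE.
have mxi l : mx_adapted (F (fine_time h l)) (xi l).
  move=> i j; rewrite ord1.
  have -> : (fun w => xi l w i 0) =
    (fun w => if Q l.+1 w <= dl then X l w i 0 else 0) by apply/funext => w.
  apply: measurable_fun_ifT => //; first by apply: measurable_fun_ler => //; exact: mQF.
  exact: mX.
have nsq_xi l w : nsq (xi l w) <= dl / h.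
  rewrite /xi; case: ifP => [le|_]; last by rewrite nsq0 divr_ge0// ltW.
  rewrite ler_pdivlMr// mulrC; apply: le_trans le.
  by rewrite /Q big_ord_recr/= lerDr; exact: Q0.
(* The minimum with [Q n w] strengthens the induction: while [Q] is at most [dl] the two sums agree,
   and afterwards nothing is added. *)
have sum_xi w n : \sum_(l < n) h * nsq (xi l w) <= dl.
  suff : \sum_(l < n) h * nsq (xi l w) <= Num.min dl (Q n w).
    by rewrite le_min => /andP[].
  elim: n => [|n IH].
    by rewrite big_ord0 /Q big_ord0 le_min lexx ltW.
  rewrite big_ord_recr/= {2}/xi; case: ifP => [le|_].
    rewrite (min_idPr le) /Q big_ord_recr/= lerD2r; apply: le_trans IH _.
    by rewrite ge_min lexx orbT.
  rewrite nsq0 mulr0 addr0; apply: le_trans IH _.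
  rewrite le_min !ge_min lexx/=; apply/orP; right.
  exact: Qmono.
pose Y a l w := \sum_j xi l w j 0 *
  inc A (fine_time h l) (fine_time h l.+1) w a j.
have K0 := drv_K hA.
have fB l : fine_time h l.+1 - fine_time h l = h.
  by rewrite /fine_time -mulrBl -natrB// subSnn mul1r.
have Kh0 : 0 <= K * h by rewrite mulr_ge0// ltW.
have nA a j l : noise P F (fine_time h l) (fine_time h l.+1) (K * h)
    (fun w => inc A (fine_time h l) (fine_time h l.+1) w a j).
  by have := drv_lin hA a j (fine0 l) (fineS l); rewrite fB.
have nY a l : noise P F (fine_time h l) (fine_time h l.+1)
    (#|'I_D|%:R * (K * h) * (dl / h)) (Y a l).
  apply: (noise_comb hF (fine0 l) (fineS l) Kh0 (nA a ^~ l)).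
    by move=> j; exact: mxi.
  by move=> w; exact: nsq_xi.
pose V' w : 'cV[R]_D := \col_a \sum_(l < m) Y a l w.
have lV' a : L1 P (fun w => (\sum_(l < m) Y a l w) ^+ 2).
  by case: (noise_L2 (noise_sum hF fine0 fineS (nY a) m)).
have nsqV' w : nsq (V' w) = \sum_a (\sum_(l < m) Y a l w) ^+ 2.
  by apply: eq_bigr => a _; rewrite mxE.
have lnV' : L1 P (fun w => nsq (V' w)).
  by under eq_fun do rewrite nsqV'; apply: L1_sum.
have lxi l : L1 P (fun w => nsq (xi l w)).
  apply: (@L1_bounded _ _ _ _ _ (dl / h)).
    exact/measurable_nsq/(mx_adapted_measurable hF (fine0 l) (mxi l)).
  by move=> w; rewrite ger0_norm ?nsq_ge0.
have EV' : Ex P (fun w => nsq (V' w)) <= D%:R ^+ 2 * K * dl.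
  under eq_Ex do rewrite nsqV'.
  rewrite Ex_sum//; apply: (@le_trans _ _ (\sum_(a < D) D%:R * K * dl)).
    apply: ler_sum => a _; rewrite (noise_sum_Ex hF fine0 fineS (nY a) m).
    apply: (@le_trans _ _ (\sum_(l < m) D%:R * K *
        Ex P (fun w => h * nsq (xi l w)))).
      apply: ler_sum => l _.
      have xic i w : `|xi l w i 0| <= dl / h + 1.
        have := le_trans (sqr_le_nsq (xi l w) i) (nsq_xi l w).
        have := normr_ge0 (xi l w i 0).
        rewrite -(real_normK (num_real (xi l w i 0))).
        by have := divr_ge0 (ltW dl0) (ltW h0); set x := `|_|; nra.
      have := noise_comb_Ex hF (fine0 l) Kh0 (nA a ^~ l)
        (fun j => mxi l j 0) xic.
      rewrite card_ord => hle; apply: (le_trans hle).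
      rewrite ExZ// /nsq Ex_sum => [|j _]; last first.
        apply: (@L1_bounded _ _ _ _ _ (dl / h)).
          apply: measurable_funX.
          exact: (mx_adapted_measurable hF (fine0 l) (mxi l)).
        by move=> w; rewrite ger0_norm ?sqr_ge0// (le_trans (sqr_le_nsq _ _)).
      by rewrite le_eqVlt; apply/orP; left; apply/eqP; ring.
    rewrite -mulr_sumr ler_wpM2l//; first by rewrite mulr_ge0.
    rewrite -Ex_sum => [|l _]; last exact: L1Z.
    apply: Ex_le_cst => //; first by apply: L1_sum => l _; exact: L1Z.
  rewrite sumr_const card_ord -(mulr_natl (_ * dl)).
  by rewrite le_eqVlt; apply/orP; left; apply/eqP; ring.
pose B := [set w | dl < Q m w].
have mB : measurable B.
  have := mQ m measurableT _ (measurable_itv `]dl, +oo[).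
  by rewrite setTI; congr measurable; apply/seteqP; split=> w /=;
    rewrite in_itv/= andbT.
have VE w : ~ B w -> V w = V' w.
  move=> /negP; rewrite -leNgt => Qd; apply/matrixP => a j.
  rewrite /V summxE mxE; apply: eq_bigr => l _; rewrite mxE; apply: eq_bigr => k _.
  rewrite ord1 xiE (le_trans _ Qd); first exact: mulrC.
  exact: Qmono.
(* Markov's inequality for a truncated variable: [dl * 1_B <= min 1 (Q m)] because [dl <= 1]. *)
have PB : Pr P B <= rho P (Q m) / dl.
  rewrite ler_pdivlMr// mulrC -ExZ; last exact: L1_indic.
  apply: le_Ex; [by apply: L1Z; exact: L1_indic|by apply: L1_min1|].
  move=> w; rewrite indicE; have [Bw|Bw] := pselect (B w).
    by rewrite mem_set// mulr1 le_min dl1 ltW.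
  by rewrite memNset// mulr0 le_min ler01 Q0.
apply: (le_trans _ (lerD PB EV')).
apply: rho_off => //.
- apply: measurable_nsq; apply: mx_measurable_sum => l; apply: mx_measurableM => //.
  exact: (mx_adapted_measurable hF (fine0 _) (inc_adapted hF hA (fine0 l) (fineS l))).
- by move=> w; exact: nsq_ge0.
- by move=> w; exact: nsq_ge0.
- by move=> w /VE ->.
Qed.

End Lenglart.

(** * Complex matrices in real coordinates *)

Section RealCoordinates.
Context {R : realType} {N : nat}.
Implicit Types (M X : 'M[R[i]]_N).
Local Notation Re := complex.Re.
Local Notation Im := complex.Im.

Lemma ReD (x y : R[i]) : Re (x + y) = Re x + Re y.
Proof. by case: x => a b; case: y. Qed.
Lemma ImD (x y : R[i]) : Im (x + y) = Im x + Im y.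
Proof. by case: x => a b; case: y. Qed.
Lemma ReM (x y : R[i]) : Re (x * y) = Re x * Re y - Im x * Im y.
Proof. by case: x => a b; case: y. Qed.
Lemma ImM (x y : R[i]) : Im (x * y) = Re x * Im y + Im x * Re y.
Proof. by case: x => a b; case: y. Qed.
Lemma Re_sum (I : Type) (r : seq I) (f : I -> R[i]) :
  Re (\sum_(k <- r) f k) = \sum_(k <- r) Re (f k).
Proof. by elim: r => [|k r IH]; rewrite ?big_nil// !big_cons ReD IH. Qed.
Lemma Im_sum (I : Type) (r : seq I) (f : I -> R[i]) :
  Im (\sum_(k <- r) f k) = \sum_(k <- r) Im (f k).
Proof. by elim: r => [|k r IH]; rewrite ?big_nil// !big_cons ImD IH. Qed.

Lemma mxcoordD b i j M X : mxcoord b i j (M + X) = mxcoord b i j M + mxcoord b i j X.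
Proof. by rewrite /mxcoord mxE; case: b; rewrite ?ReD ?ImD. Qed.

Lemma mxcoordN b i j M : mxcoord b i j (- M) = - mxcoord b i j M.
Proof. by rewrite /mxcoord mxE; case: b; case: (M i j). Qed.

Lemma mxcoordB b i j M X : mxcoord b i j (M - X) = mxcoord b i j M - mxcoord b i j X.
Proof. by rewrite mxcoordD mxcoordN. Qed.

Lemma mxcoord0 b i j : mxcoord b i j (0 : 'M[R[i]]_N) = 0.
Proof. by rewrite /mxcoord mxE; case: b. Qed.

Lemma mxcoord_sum (I : Type) (r : seq I) (f : I -> 'M[R[i]]_N) b i j :
  mxcoord b i j (\sum_(k <- r) f k) = \sum_(k <- r) mxcoord b i j (f k).
Proof.
elim: r => [|k r IH]; first by rewrite !big_nil mxcoord0.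
by rewrite !big_cons mxcoordD IH.
Qed.

Lemma mxcoordZ_half b i j M :
  mxcoord b i j (2^-1 *: M) = 2^-1 * mxcoord b i j M.
Proof.
have -> : (2^-1 : R[i]) = (2^-1 : R)%:C%C by rewrite fmorphV rmorph_nat.
rewrite /mxcoord mxE; case: b; rewrite ?ReM ?ImM/=; ring.
Qed.

Definition rvec (c : 'I_N) M : 'cV[R]_(N + N) :=
  col_mx (\col_i mxcoord false i c M) (\col_i mxcoord true i c M).

(* Left multiplication by [i M] on vectors of C^N = R^(N + N). *)
Definition rmx M : 'M[R]_(N + N) :=
  block_mx (- \matrix_(i, j) mxcoord true i j M)
           (- \matrix_(i, j) mxcoord false i j M)
           (\matrix_(i, j) mxcoord false i j M)
           (- \matrix_(i, j) mxcoord true i j M).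

Lemma rvecP c M : [/\ forall i, rvec c M (lshift N i) 0 = mxcoord false i c M &
  forall i, rvec c M (rshift N i) 0 = mxcoord true i c M].
Proof. by split=> i; rewrite /rvec ?col_mxEu ?col_mxEd mxE. Qed.

Lemma rvec_ext c (v : 'cV[R]_(N + N)) M :
  (forall i, v (lshift N i) 0 = mxcoord false i c M) ->
  (forall i, v (rshift N i) 0 = mxcoord true i c M) -> v = rvec c M.
Proof.
move=> h1 h2; have [e1 e2] := rvecP c M.
apply/matrixP => k l; rewrite ord1; case: (split_ordP k) => m ->.
  by rewrite h1 e1.
by rewrite h2 e2.
Qed.

Lemma rvecD c M X : rvec c (M + X) = rvec c M + rvec c X.
Proof.
have [e1 e2] := rvecP c M; have [f1 f2] := rvecP c X.
by symmetry; apply: rvec_ext => i; rewrite mxE ?e1 ?e2 ?f1 ?f2 mxcoordD.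
Qed.

Lemma rvecN c M : rvec c (- M) = - rvec c M.
Proof.
have [e1 e2] := rvecP c M.
by symmetry; apply: rvec_ext => i; rewrite mxE ?e1 ?e2 mxcoordN.
Qed.

Lemma rvecB c M X : rvec c (M - X) = rvec c M - rvec c X.
Proof. by rewrite rvecD rvecN. Qed.

Lemma rvec0 c : rvec c 0 = 0.
Proof. by symmetry; apply: rvec_ext => i; rewrite mxE mxcoord0. Qed.

Lemma rvec_sum c (I : Type) (r : seq I) (f : I -> 'M[R[i]]_N) :
  rvec c (\sum_(k <- r) f k) = \sum_(k <- r) rvec c (f k).
Proof.
elim: r => [|k r IH]; first by rewrite !big_nil rvec0.
by rewrite !big_cons rvecD IH.
Qed.

Lemma rvecZ_half c M : rvec c (2^-1 *: M) = 2^-1 *: rvec c M.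
Proof.
have [e1 e2] := rvecP c M.
by symmetry; apply: rvec_ext => i; rewrite mxE ?e1 ?e2 mxcoordZ_half.
Qed.

Lemma rvec_mulmx c M X : rvec c ('i%C *: (M *m X)) = rmx M *m rvec c X.
Proof.
have [e1 e2] := rvecP c X.
symmetry; apply: rvec_ext => i; rewrite /rmx /rvec mul_block_col.
  rewrite col_mxEu !mxE /mxcoord mxE ReM/= mul0r mul1r sub0r mxE Im_sum.
  rewrite -sumrN -big_split/=; apply: eq_bigr => j _; rewrite !mxE ImM; ring.
rewrite col_mxEd !mxE /mxcoord mxE ImM/= mul0r mul1r add0r mxE Re_sum.
rewrite -big_split/=; apply: eq_bigr => j _; rewrite !mxE ReM; ring.
Qed.

Lemma rmxB M X : rmx (M - X) = rmx M - rmx X.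
Proof.
rewrite /rmx opp_block_mx add_block_mx.
by congr block_mx; apply/matrixP => i j; rewrite !mxE mxcoordB; ring.
Qed.

Lemma nsq_rvec_le c M : nsq (rvec c M) <= mxnorm2 M.
Proof.
rewrite /nsq big_split_ord/= /mxnorm2 big_bool/= addrC.
have h b : \sum_(i < N) mxcoord b i c M ^+ 2 <=
    \sum_(i < N) \sum_(j < N) mxcoord b i j M ^+ 2.
  apply: ler_sum => i _; rewrite [leRHS](bigD1 c)//= lerDl.
  by apply: sumr_ge0 => j _; exact: sqr_ge0.
have [e1 e2] := rvecP c M.
by apply: lerD; [under eq_bigr do rewrite e2|under eq_bigr do rewrite e1].
Qed.

Lemma mxnorm2_ge0 M : 0 <= mxnorm2 M.
Proof. by do 3 (apply: sumr_ge0 => ? _); exact: sqr_ge0. Qed.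

(** [i M] is anti-Hermitian, hence skew for the real inner product [Re <x, y>] on C^N. *)
Lemma rmx_anti M : M \is hermsymmx -> (rmx M)^T = - rmx M.
Proof.
move=> /is_hermitianmxP; rewrite expr0 scale1r => hM.
have h1 i j : mxcoord false i j M = mxcoord false j i M.
  by rewrite /mxcoord {1}hM !mxE; case: (M j i).
have h2 i j : mxcoord true i j M = - mxcoord true j i M.
  by rewrite /mxcoord {1}hM !mxE; case: (M j i).
rewrite /rmx tr_block_mx opp_block_mx !opprK.
congr block_mx; apply/matrixP => i j; rewrite !mxE ?opprK.
- by rewrite h2 opprK.
- by rewrite h1.
- by rewrite h1.
- by rewrite h2 opprK.
Qed.

Lemma nsq_rvec_i_le c M : nsq (rvec c ('i%C *: M)) <= mxnorm2 M.
Proof.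
have -> : nsq (rvec c ('i%C *: M)) = nsq (rvec c M); last exact: nsq_rvec_le.
rewrite /nsq !big_split_ord/= addrC.
have [e1 e2] := rvecP c M; have [f1 f2] := rvecP c ('i%C *: M).
congr (_ + _); apply: eq_bigr => i _.
  by rewrite f2 e1 /mxcoord mxE ImM/= mul0r mul1r add0r.
by rewrite f1 e2 /mxcoord mxE ReM/= mul0r mul1r sub0r sqrrN.
Qed.

End RealCoordinates.

(** * From the Ito equation to Riemann sums *)

Section SimpleProcess.
Context {d : measure_display} {T : measurableType d} {R : realType} {N : nat}.
Variables (F : R -> set (set T)) (S : simple_process (N := N) F).

Lemma sp_time_ge0 k : 0 <= sp_time S k. Proof. by case: S. Qed.
Lemma sp_timeS k : sp_time S k <= sp_time S k.+1. Proof. by case: S. Qed.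
Lemma sp_coef_mes k : sigma_mx (sp_coef S k) `<=` F (sp_time S k).
Proof. by case: S. Qed.

End SimpleProcess.

Lemma mx_measurable_rvec (d : measure_display) (T : measurableType d)
    (R : realType) (N : nat) (X : T -> 'M[R[i]]_N) c :
  (forall b i j, measurable_fun setT (fun w => mxcoord b i j (X w))) ->
  mx_measurable (fun w => rvec c (X w)).
Proof.
move=> h k l; rewrite ord1; case: (split_ordP k) => m ->.
  have e w : rvec c (X w) (lshift N m) 0 = mxcoord false m c (X w).
    by have [-> _] := rvecP c (X w).
  by under eq_fun do rewrite e; exact: h.
have e w : rvec c (X w) (rshift N m) 0 = mxcoord true m c (X w).
  by have [_ ->] := rvecP c (X w).
by under eq_fun do rewrite e; exact: h.
Qed.

Section CoordinateMeasurability.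
Context {d : measure_display} {T : measurableType d} {R : realType} {N : nat}.
Implicit Types (G : set (set T)) (X : T -> 'M[R[i]]_N).

Definition coord_mes G X : Prop :=
  forall b i j, mes_wrt G (fun w => mxcoord b i j (X w)).

Lemma sigma_mx_mes G X : sigma_algebra setT G -> sigma_mx X `<=` G ->
  coord_mes G X.
Proof.
move=> sG h b i j; apply/(mes_wrtP _ sG) => B mB; apply: h.
by apply: sub_sigma_algebra; exists b, i, j, B.
Qed.

Lemma coord_mes_rvec G X c : coord_mes G X -> mx_adapted G (fun w => rvec c (X w)).
Proof. exact: mx_measurable_rvec. Qed.

Lemma measurable_mxnorm2 X :
  (forall b i j, measurable_fun setT (fun w => mxcoord b i j (X w))) ->
  measurable_fun setT (fun w => mxnorm2 (X w)).
Proof.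
move=> h; apply: measurable_sum => b; apply: measurable_sum => i.
by apply: measurable_sum => j; exact: measurable_funX.
Qed.

End CoordinateMeasurability.

(** The nested shape with a final [0] is what unfolding a sum over ['I_4] produces. *)
Lemma nsqD4 (R : realFieldType) D (v1 v2 v3 v4 : 'cV[R]_D) :
  nsq (v1 + v2 + (v3 + v4)) <= 4 * (nsq v1 + (nsq v2 + (nsq v3 + (nsq v4 + 0)))).
Proof.
have := nsqD (v1 + v2) (v3 + v4); have := nsqD v1 v2; have := nsqD v3 v4.
lra.
Qed.

Lemma four_errors (R : realFieldType) (e q1 q2 q3 q4 : R) : 0 <= e ->
  q1 <= e / 32 -> q2 <= e / 32 -> q3 <= 3 * (e / 32) -> q4 <= e / 32 ->
  4 * (q1 + (q2 + (q3 + (q4 + 0)))) <= e.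
Proof. lra. Qed.

Section UnitarySDE.
Context {d : measure_display} {T : measurableType d} {R : realType} {N : nat}.
Variable P : probability T R.
Variable F : R -> set (set T).
Hypothesis hF : is_filtration F.
Variables (H U : R -> T -> 'M[R[i]]_N) (V : 'M[R[i]]_N).
Hypothesis adH : adapted F H.
Hypothesis cH : forall w, mx_continuous_path (H ^~ w).
Variable K : R.
Local Notation A := (fun t w => rmx (H t w)).
Hypothesis hA : antisym_driver P F A K.
Hypothesis hU : unitary_BM P F H V U.
Variable c : 'I_N.
Local Notation u := (fun t w => rvec c (U t w)).

Let adU : adapted F U. Proof. by case: hU. Qed.
Let cU w : mx_continuous_path (U ^~ w). Proof. by case: hU. Qed.
Let U0 w : U 0 w = V. Proof. by case: hU. Qed.

Let mesU t : 0 <= t -> coord_mes (F t) (U t).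
Proof.
move=> t0; apply: sigma_mx_mes; first by case: (hF.1 _ t0).
exact: adU.
Qed.

Let mesH t : 0 <= t -> coord_mes (F t) (H t).
Proof.
move=> t0; apply: sigma_mx_mes; first by case: (hF.1 _ t0).
exact: adH.
Qed.

Let u_mes t : 0 <= t -> mx_adapted (F t) (u t).
Proof. by move=> t0; exact: coord_mes_rvec (mesU t0). Qed.

Let u_cont w k : {within `[0, +oo[, continuous (fun t => u t w k 0)}.
Proof.
case: (split_ordP k) => m ->.
  have -> : (fun t => u t w (lshift N m) 0) = (fun t => mxcoord false m c (U t w)).
    by apply/funext => t; have [-> _] := rvecP c (U t w).
  exact: cU.
have -> : (fun t => u t w (rshift N m) 0) = (fun t => mxcoord true m c (U t w)).
  by apply/funext => t; have [_ ->] := rvecP c (U t w).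
exact: cU.
Qed.

Let A_cont w a b : {within `[0, +oo[, continuous (fun t => A t w a b)}.
Proof.
have cN x y z : {within `[0, +oo[, continuous (fun t => - mxcoord x y z (H t w))}.
  by move=> t; apply: cvgN; exact: cH.
case: (split_ordP a) => m ->; case: (split_ordP b) => n ->.
- rewrite (_ : (fun t => _) = (fun t => - mxcoord true m n (H t w)))//.
  by apply/funext => t; rewrite /rmx block_mxEul !mxE.
- rewrite (_ : (fun t => _) = (fun t => - mxcoord false m n (H t w)))//.
  by apply/funext => t; rewrite /rmx block_mxEur !mxE.
- rewrite (_ : (fun t => _) = (fun t => mxcoord false m n (H t w))).
    exact: cH.
  by apply/funext => t; rewrite /rmx block_mxEdl !mxE.
- rewrite (_ : (fun t => _) = (fun t => - mxcoord true m n (H t w)))//.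
  by apply/funext => t; rewrite /rmx block_mxEdr !mxE.
Qed.

Let u_bounded w t : 0 <= t -> exists c0 : R,
  forall s, 0 <= s <= t -> nsq (u s w) <= c0.
Proof.
move=> t0.
have h k : exists c1, forall s, 0 <= s <= t -> `|u s w k 0| <= c1.
  exact: bounded_path (@u_cont w k).
have [C hC] := choice h.
exists (\sum_k C k ^+ 2) => s st; apply: ler_sum => k _.
rewrite -(real_normK (num_real (u s w k 0))) ler_sqr ?nnegrE ?hC//.
exact: le_trans (hC k s st).
Qed.

Let u_unif w t e : 0 <= t -> 0 < e -> exists2 dl : R, 0 < dl &
  forall r s, 0 <= r <= t -> 0 <= s <= t -> `|r - s| <= dl ->
    nsq (u r w - u s w) <= e.
Proof.
move=> t0 e0; pose e1 := Num.min 1 (e / (N + N).+1%:R).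
have n0 : 0 < (N + N).+1%:R :> R by [].
have e10 : 0 < e1 by rewrite lt_min ltr01 divr_gt0.
have [e11 e12] : e1 <= 1 /\ e1 <= e / (N + N).+1%:R.
  by rewrite /e1 !ge_min !lexx orbT.
have h k : exists dl : R, 0 < dl /\ forall r s, 0 <= r <= t -> 0 <= s <= t ->
    `|r - s| <= dl -> `|u r w k 0 - u s w k 0| <= e1.
  by have [dl dl0 hdl] := heine t (@u_cont w k) e10; exists dl.
have [C hC] := choice h.
exists (\big[Num.min/1]_k C k).
  by apply: lt_bigmin => // k _; case: (hC k).
move=> r s r0 s0 rs.
have hk k : (u r w - u s w) k 0 ^+ 2 <= e / (N + N).+1%:R.
  have -> (x y : 'cV[R]_(N + N)) : (x - y) k 0 = x k 0 - y k 0 by rewrite !mxE.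
  apply: le_trans e12.
  have h1 : `|u r w k 0 - u s w k 0| <= e1.
    by apply: (hC k).2 => //; apply: (le_trans rs); exact: bigmin_le_cond.
  rewrite -(real_normK (num_real (_ - _))) expr2.
  apply: (le_trans _ (_ : e1 * 1 <= e1)); last by rewrite mulr1.
  by rewrite ler_pM// (le_trans h1).
apply: (@le_trans _ _ (\sum_(k < N + N) e / (N + N).+1%:R)).
  by apply: ler_sum => k _.
rewrite sumr_const card_ord -(mulr_natl (e / _)) mulrCA.
by rewrite ler_piMr ?(ltW e0)// ler_pdivrMr// mul1r ler_nat.
Qed.

Section FixedTime.
Variable t : R.
Hypothesis t0 : 0 < t.

Local Notation inc_ m l w := (inc A (grid t m l) (grid t m l.+1) w).

Definition riemann_ito (X : R -> T -> 'cV[R]_(N + N)) m w :=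
  \sum_(l < m) inc_ m l w *m X (grid t m l) w.

Let sv (S : simple_process (N := N) F) s w := rvec c (sp_eval S s w).

Let svE S s w : sv S s w = \sum_(k < sp_size S)
  (sp_time S k < s <= sp_time S k.+1)%R%:R *: rvec c (sp_coef S k w).
Proof.
rewrite /sv /sp_eval rvec_sum; apply: eq_bigr => k _.
by case: ifP => _; rewrite ?scale1r ?scale0r ?rvec0.
Qed.

Let spI (S : simple_process (N := N) F) w := rvec c ('i%C *: sp_integral H S t w).

Let spIE S w : spI S w = \sum_(k < sp_size S)
  (A (Num.min (sp_time S k.+1) t) w - A (Num.min (sp_time S k) t) w) *m
  rvec c (sp_coef S k w).
Proof.
rewrite /spI /sp_integral scaler_sumr rvec_sum; apply: eq_bigr => k _.
by rewrite rvec_mulmx rmxB.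
Qed.

(** Path by path: the sums of an indicator integrand converge to an increment of the continuous path
    by [grid_elementary_sum], and a simple process is a finite combination of such indicators. *)
Let riemann_simple S w :
  null_seq (fun m => nsq (riemann_ito (sv S) m w - spI S w)).
Proof.
apply: null_nsq => a.
have E m : (riemann_ito (sv S) m w - spI S w) a 0 =
    \sum_(k < sp_size S) \sum_b rvec c (sp_coef S k w) b 0 *
      (\sum_(l < m) (A (grid t m l.+1) w a b - A (grid t m l) w a b) *
         (sp_time S k < grid t m l <= sp_time S k.+1)%R%:R -
       (A (Num.min (sp_time S k.+1) t) w a b -
        A (Num.min (sp_time S k) t) w a b)).
  rewrite mxE [X in _ + X]mxE spIE /riemann_ito !summxE.
  under eq_bigr => l _.
    rewrite svE mulmx_sumr summxE.
    under eq_bigr => k _ do rewrite -scalemxAr mxE mxE mulr_sumr.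
    over.
  rewrite exchange_big/= -sumrB; apply: eq_bigr => k _.
  rewrite exchange_big/= mxE -sumrB; apply: eq_bigr => b _.
  rewrite mulrBr mulr_sumr; congr (_ - _).
    by apply: eq_bigr => l _; rewrite /inc !mxE; ring.
  by rewrite !mxE; ring.
rewrite -[X in _ --> X](_ : \sum_(k < sp_size S) \sum_(b < N + N) (0 : R) = 0);
  last by rewrite big1// => k _; rewrite big1.
under eq_fun do rewrite E.
apply: cvg_sumr => k; apply: cvg_sumr => b.
rewrite -[X in _ --> X](mulr0 (rvec c (sp_coef S k w) b 0)).
apply: cvgM; first exact: cvg_cst.
rewrite -[X in _ --> X](subrr (A (Num.min (sp_time S k.+1) t) w a b -
        A (Num.min (sp_time S k) t) w a b)).
apply: cvgB; last exact: cvg_cst.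
apply: null_seq_cvg.
apply: (grid_elementary_sum (@A_cont w a b) (ltW t0)).
  exact: sp_time_ge0.
exact: sp_timeS.
Qed.

Let sp_mes (S : simple_process (N := N) F) s : 0 <= s ->
  coord_mes (F s) (sp_eval S s).
Proof.
move=> s0 b i j; rewrite /mes_wrt /sp_eval.
under eq_fun do rewrite mxcoord_sum.
apply: measurable_sum => k.
case: (boolP (sp_time S k < s <= sp_time S k.+1)) => [/andP[ks sk]|_].
  apply: (mes_wrt_filtration hF (sp_time_ge0 S k) (ltW ks)).
  apply: sigma_mx_mes; last exact: sp_coef_mes.
  by case: (hF.1 _ (sp_time_ge0 S k)).
by under eq_fun do rewrite mxcoord0; exact: measurable_cst.
Qed.

Let sv_mes (S : simple_process (N := N) F) s : 0 <= s ->
  mx_adapted (F s) (fun w => sv S s w - u s w).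
Proof.
move=> s0; apply: mx_measurableB; last exact: u_mes.
exact: coord_mes_rvec (sp_mes S s0).
Qed.

Let dist (S : simple_process (N := N) F) w s := mxnorm2 (sp_eval S s w - U s w).
Let distance S w := \int[lebesgue_measure]_(s in `[0%R, t]) dist S w s.
Let path_left_cont (f : R -> R) s : {within `[0, +oo[, continuous f} -> 0 < s ->
  f x @[x --> s^'-] --> f s.
Proof.
move=> /continuous_within_itvcyP[h _] s0; apply: cvg_at_left_filter.
by apply: h; rewrite in_itv/= s0.
Qed.

Let sp_left_cont (S : simple_process (N := N) F) w b i j s :
  mxcoord b i j (sp_eval S x w) @[x --> s^'-] --> mxcoord b i j (sp_eval S s w).
Proof.
rewrite /sp_eval mxcoord_sum.
under eq_fun do rewrite mxcoord_sum.
apply: cvg_sumr => k; apply: cvg_near_cst.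
have hlt r : \forall x \near s^'-, (r < x) = (r < s).
  have [rs|sr] := ltP r s.
    by apply: filterS (nbhs_left_gt rs) => x ->.
  apply: filterS (nbhs_left_lt s) => x xs; apply/negbTE.
  by rewrite -leNgt (le_trans (ltW xs)).
have hk := hlt (sp_time S k); have hk1 := hlt (sp_time S k.+1).
apply: filterS3 hk hk1 (nbhs_left_lt s) => x e1 e2 xs.
have -> : (sp_time S k < x <= sp_time S k.+1) = (sp_time S k < s <= sp_time S k.+1).
  by rewrite e1 !(leNgt _ (sp_time S k.+1)) e2.
by [].
Unshelve. all: by end_near. Qed.

Let dist_left_cont S w s : 0 < s -> dist S w x @[x --> s^'-] --> dist S w s.
Proof.
move=> s0; do 3 (apply: cvg_sumr => ?).
rewrite expr2; under eq_fun do rewrite expr2.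
have h : forall b i j, mxcoord b i j (sp_eval S x w - U x w) @[x --> s^'-] -->
    mxcoord b i j (sp_eval S s w - U s w).
  move=> b i j; rewrite mxcoordB; under eq_fun do rewrite mxcoordB.
  by apply: cvgB; [exact: sp_left_cont|apply: path_left_cont => //; exact: cU].
by apply: cvgM; exact: h.
Qed.

Let left_cont_eps (f : R -> R) s e : f x @[x --> s^'-] --> f s -> 0 < e ->
  exists2 eta : R, 0 < eta &
  forall x, 0 <= x -> x < s -> s - x <= eta -> `|f x - f s| <= e.
Proof.
move=> /cvgrPdist_le /[apply] -[eta /= eta0 h].
exists (eta / 2); first by rewrite divr_gt0.
move=> x _ xs sx; rewrite distrC; apply: h => //=.
by rewrite ger0_norm ?subr_ge0 ?(ltW xs)//; lra.
Qed.

Let dist_bounded S w : exists c0 : R, forall s, 0 <= s <= t -> `|dist S w s| <= c0.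
Proof.
have h (q : bool * 'I_N * 'I_N) : exists c1, forall s, 0 <= s <= t ->
    `|mxcoord q.1.1 q.1.2 q.2 (sp_eval S s w - U s w)| <= c1.
  have [c1 hc1] := bounded_path t (@cU w q.1.1 q.1.2 q.2).
  exists (\sum_(k < sp_size S) `|mxcoord q.1.1 q.1.2 q.2 (sp_coef S k w)| + c1) => s hs.
  rewrite mxcoordB (le_trans (ler_normB _ _))// lerD ?hc1//.
  rewrite /sp_eval mxcoord_sum (le_trans (ler_norm_sum _ _ _))//.
  by apply: ler_sum => k _; case: ifP => // _; rewrite mxcoord0 normr0.
have [C hC] := choice h.
exists (\sum_b \sum_i \sum_j C (b, i, j) ^+ 2) => s st.
rewrite ger0_norm ?mxnorm2_ge0//; do 3 (apply: ler_sum => ? _).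
rewrite -(real_normK (num_real (mxcoord _ _ _ _))) ler_sqr ?nnegrE//.
  exact: (hC (_, _, _)).
exact: le_trans (hC (_, _, _) s st).
Qed.

Let dist_sum S w m := \sum_(l < m) dist S w (grid t m l) * (t / m%:R).

Let dist_cvg S w : null_seq (fun m => `|dist_sum S w m - distance S w|).
Proof.
have [c0 hc0] := dist_bounded S w.
apply: (riemann_sum_cvg t0 hc0) => s e /andP[s0 _] e0.
by apply: left_cont_eps e0; exact: dist_left_cont.
Qed.

Let measurable_dist S s : 0 <= s -> measurable_fun setT (fun w => dist S w s).
Proof.
move=> s0; apply: measurable_mxnorm2 => b i j.
under eq_fun do rewrite mxcoordB.
by apply: measurable_funB; apply: (mes_filtration hF s0); [exact: sp_mes|exact: mesU].
Qed.

Let measurable_dist_sum S m : measurable_fun setT (fun w => dist_sum S w m).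
Proof.
apply: measurable_sum => l; apply: measurable_funM => //.
by apply: measurable_dist; exact: grid_ge0 (ltW t0).
Qed.

Let measurable_distance S : measurable_fun setT (distance S).
Proof.
apply: (measurable_fun_cvg (h := fun m w => dist_sum S w m)) => // w _.
exact: null_seq_cvg.
Qed.

Let measurable_sp_integral (S : simple_process (N := N) F) : forall b i j,
  measurable_fun setT (fun w => mxcoord b i j (sp_integral H S t w)).
Proof.
have mI (X : T -> 'M[R[i]]_N) s : 0 <= s -> coord_mes (F s) X ->
    forall b i j, measurable_fun setT (fun w => mxcoord b i j (X w)).
  by move=> s0 h b i j; exact: (mes_filtration hF s0).
have mC k b i j : measurable_fun setT (fun w => mxcoord b i j (sp_coef S k w)).
  apply: (mI _ _ (sp_time_ge0 S k)) => {b i j} ; apply: sigma_mx_mes.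
    by case: (hF.1 _ (sp_time_ge0 S k)).
  exact: sp_coef_mes.
have mm s : 0 <= s -> 0 <= Num.min s t by move=> s0; rewrite le_min s0 ltW.
have mD k b i j : measurable_fun setT (fun w => mxcoord b i j
    (H (Num.min (sp_time S k.+1) t) w - H (Num.min (sp_time S k) t) w)).
  under eq_fun do rewrite mxcoordB.
  by apply: measurable_funB; apply: (mI _ (Num.min (sp_time S _) t));
    rewrite ?mm ?sp_time_ge0//; apply: mesH; rewrite mm ?sp_time_ge0.
move=> b i j; under eq_fun do rewrite mxcoord_sum.
apply: measurable_sum => k; case: b.
  rewrite /mxcoord; under eq_fun do rewrite mxE Im_sum.
  apply: measurable_sum => l; under eq_fun do rewrite ImM.
  apply: measurable_funD; apply: measurable_funM;
    [exact: (mD k false)|exact: (mC k true)|exact: (mD k true)|exact: (mC k false)].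
rewrite /mxcoord; under eq_fun do rewrite mxE Re_sum.
apply: measurable_sum => l; under eq_fun do rewrite ReM.
apply: measurable_funB; apply: measurable_funM;
    [exact: (mD k false)|exact: (mC k false)|exact: (mD k true)|exact: (mC k true)].
Qed.

Let drift_sum m w := \sum_(l < m) (t / m%:R) *: u (grid t m l) w.
Let drift w := rvec c (mxRintegral (U ^~ w) t).

Let drift_cvg0 w k : drift_sum m w k 0 @[m --> \oo] --> drift w k 0.
Proof.
have h b i : \sum_(l < m) mxcoord b i c (U (grid t m l) w) * (t / m%:R) @[m --> \oo] -->
    \int[lebesgue_measure]_(s in `[0%R, t]) mxcoord b i c (U s w).
  apply: null_seq_cvg.
  have [c0 hc0] := bounded_path t (@cU w b i c).
  apply: (riemann_sum_cvg t0 hc0) => s e /andP[s0 _] e0.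
  by apply: left_cont_eps e0; apply: path_left_cont => //; exact: cU.
have E m : drift_sum m w k 0 = \sum_(l < m) u (grid t m l) w k 0 * (t / m%:R).
  rewrite /drift_sum summxE; apply: eq_bigr => l _.
  by rewrite [LHS]mxE mulrC.
under eq_fun do rewrite E.
have [e1 e2] := rvecP c (mxRintegral (U ^~ w) t).
rewrite /drift; case: (split_ordP k) => i ->.
  have e s : u s w (lshift N i) 0 = mxcoord false i c (U s w) by have [-> _] := rvecP c (U s w).
  rewrite e1 /mxcoord mxE; apply: cvg_trans (h false i).
  by apply: near_eq_cvg; near=> m; apply: eq_bigr => l _; rewrite e.
have e s : u s w (rshift N i) 0 = mxcoord true i c (U s w) by have [_ ->] := rvecP c (U s w).
rewrite e2 /mxcoord mxE; apply: cvg_trans (h true i).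
by apply: near_eq_cvg; near=> m; apply: eq_bigr => l _; rewrite e.
Unshelve. all: by end_near. Qed.

Let drift_cvg w : null_seq (fun m => nsq (2^-1 *: drift_sum m w - 2^-1 *: drift w)).
Proof.
apply: null_nsq => k.
have E m : (2^-1 *: drift_sum m w - 2^-1 *: drift w) k 0 =
    2^-1 * drift_sum m w k 0 - 2^-1 * drift w k 0.
  have -> (x y : 'cV[R]_(N + N)) : (2^-1 *: x - 2^-1 *: y) k 0 = 2^-1 * x k 0 - 2^-1 * y k 0.
    by rewrite !mxE.
  by [].
under eq_fun do rewrite E.
have : 2^-1 * drift_sum m w k 0 - 2^-1 * drift w k 0
    @[m --> \oo] --> 2^-1 * drift w k 0 - 2^-1 * drift w k 0.
  apply: cvgB; last exact: cvg_cst.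
  by apply: cvgM; [exact: cvg_cst|exact: drift_cvg0].
by rewrite subrr.
Qed.

Let D2K := (N + N)%:R ^+ 2 * K.

Let residual m w := u t w - u 0 w - \sum_(l < m)
  (inc_ m l w - (t / m%:R / 2)%:M) *m u (grid t m l) w.

Let correction S m w :=
  \sum_(l < m) inc_ m l w *m (sv S (grid t m l) w - u (grid t m l) w).

(** Four errors: the Ito integral against that of a simple process, the latter against its Riemann
    sum, the Riemann sum of the simple process against that of [u], and the drift. The second and
    the fourth vanish path by path. *)
Let residualE (I : T -> 'M[R[i]]_N) S m w :
  U t w = V + 'i%C *: I w - 2^-1 *: mxRintegral (U ^~ w) t ->
  residual m w =
    ((rvec c ('i%C *: I w) - spI S w) + (spI S w - riemann_ito (sv S) m w)) +
    (correction S m w + (2^-1 *: drift_sum m w - 2^-1 *: drift w)).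
Proof.
move=> e; rewrite /residual.
have -> : u t w = u 0 w + rvec c ('i%C *: I w) - 2^-1 *: drift w.
  by rewrite /= e U0 rvecB rvecD rvecZ_half.
have -> : correction S m w = riemann_ito (sv S) m w - riemann_ito u m w.
  rewrite /correction /riemann_ito -sumrB; apply: eq_bigr => l _.
  by rewrite mulmxBr.
have -> : \sum_(l < m) (inc_ m l w - (t / m%:R / 2)%:M) *m u (grid t m l) w =
    riemann_ito u m w - 2^-1 *: drift_sum m w.
  rewrite /riemann_ito /drift_sum scaler_sumr -sumrB; apply: eq_bigr => l _.
  rewrite [LHS](mulmxBl _ ((t / m%:R / 2)%:M) (u (grid t m l) w)).
  by rewrite mul_scalar_mx scalerA; congr (_ - _ *: _); rewrite mulrC.
apply/matrixP => a b; rewrite !mxE; ring.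
Qed.

(** Smallness in probability of the stochastic sum is reduced to that of a Riemann sum of the
    squared distance from the simple process to [U]; no moment of [U] enters. *)
Let rho_correction S m dl : (0 < m)%N -> 0 < dl -> dl <= 1 ->
  rho P (fun w => nsq (correction S m w)) <=
  rho P (fun w => dist_sum S w m) / dl + D2K * dl.
Proof.
move=> m0 dl0 dl1.
have h0 : 0 < t / m%:R by rewrite divr_gt0 ?ltr0n.
have g0 l : 0 <= grid t m l by exact: grid_ge0 (ltW t0).
apply: le_trans (lenglart hF hA m h0 (X := fun l w => sv S (grid t m l) w - u (grid t m l) w) _ dl0 dl1) _.
  by move=> l; exact: (@sv_mes S _ (g0 l)).
rewrite lerD2r ler_pM2r ?invr_gt0//; apply: rho_le.
- apply: measurable_sum => l; apply: measurable_funM => //; apply: measurable_nsq.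
  exact: (mx_adapted_measurable hF (g0 l) (sv_mes S (g0 l))).
- exact: measurable_dist_sum.
- by move=> w; apply: sumr_ge0 => l _; rewrite mulr_ge0 ?nsq_ge0// ltW.
- move=> w; apply: ler_sum => l _; rewrite mulrC ler_pM2r//.
  by rewrite /sv -rvecB; exact: nsq_rvec_le.
Qed.

(** The index [n] of the simple process is fixed first, from the definition of the Ito integral;
    only then does the number [m] of cells grow. *)
Lemma riemann_sde_pos : null_seq (fun m => rho P (fun w => nsq (residual m w))).
Proof.
case: hU => _ _ _ [J hJ]; have [[mJ [S [hS1 hS2]]] hae] := hJ t (ltW t0).
have D2K0 : 0 <= D2K by rewrite mulr_ge0 ?exprn_ge0//; exact: drv_K hA.
have mJc b i j : measurable_fun setT (fun w => mxcoord b i j (J t w)).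
  move=> _ B mB; rewrite setTI; apply: mJ.
  by apply: sub_sigma_algebra; exists b, i, j, B.
have mSI n : measurable_fun setT (fun w => mxnorm2 (sp_integral H (S n) t w - J t w)).
  apply: measurable_mxnorm2 => b i j; under eq_fun do rewrite mxcoordB.
  by apply: measurable_funB; [exact: measurable_sp_integral|exact: mJc].
have mc0 : measurable_fun setT (cst 0 : T -> R) by exact: measurable_cst.
have n1 := rho_null_in_prob (fun n => measurable_distance (S n)) mc0 hS1.
have n2 := rho_null_in_prob mSI mc0 hS2.
move=> e e0.
(* [D2K * dl <= e / 32] handles the second Lenglart term. The first is divided by [dl], so the
   distance is required to be below [dl * (e / 32)]. *)
pose dl := Num.min 1 (e / (32 * (D2K + 1))).
have q0 : 0 < 32 * (D2K + 1) by lra.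
have dl0 : 0 < dl by rewrite lt_min ltr01 divr_gt0.
have dl1 : dl <= 1 by rewrite ge_min lexx.
have hdl : D2K * dl <= e / 32.
  have h : dl <= e / (32 * (D2K + 1)) by rewrite ge_min lexx orbT.
  have : dl * (32 * (D2K + 1)) <= e by rewrite -ler_pdivlMr.
  by nra.
have e32 : 0 < e / 32 by lra.
have [M1 hM1] := n1 (dl * (e / 32)) (mulr_gt0 dl0 e32).
have [M2 hM2] := n2 (e / 32) e32.
pose n := maxn M1 M2.
have {}hM1 := hM1 n (leq_maxl _ _); have {}hM2 := hM2 n (leq_maxr _ _).
have mi (X : T -> 'M[R[i]]_N) :
    (forall b i j, measurable_fun setT (fun w => mxcoord b i j (X w))) ->
    mx_measurable (fun w => rvec c ('i%C *: X w)).
  move=> mX.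
  rewrite (_ : (fun _ => _) = fun w => rmx 1 *m rvec c (X w)).
    by apply: mx_measurableM; [exact: mx_measurable_cst|exact: mx_measurable_rvec].
  by apply/funext => w; rewrite -rvec_mulmx mul1mx.
have mspI : mx_measurable (spI (S n)) by apply: mi; exact: measurable_sp_integral.
have g0 m l : 0 <= grid t m l by exact: grid_ge0 (ltW t0).
have mu s : 0 <= s -> mx_measurable (u s).
  by move=> s0; exact: (mx_adapted_measurable hF s0 (u_mes s0)).
have minc m l : mx_measurable (fun w => inc_ m l w).
  exact: (mx_adapted_measurable hF (g0 _ _)
            (inc_adapted hF hA (g0 m l) (grid_le m (ltW t0) (leqnSn l)))).
have mRS m : mx_measurable (riemann_ito (sv (S n)) m).
  apply: mx_measurable_sum => l; apply: mx_measurableM; first exact: minc.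
  apply: mx_measurable_rvec => b i j; apply: (mes_filtration hF (g0 m l)).
  exact: sp_mes.
have mds m : mx_measurable (drift_sum m).
  apply: mx_measurable_sum => l; apply: mx_measurableZ; first exact: measurable_cst.
  exact: mu.
have mdr : mx_measurable drift.
  move=> a b; rewrite ord1.
  apply: (measurable_fun_cvg (h := fun m w => drift_sum m w a 0)) => [m|w _].
    exact: mds.
  exact: drift_cvg0.
have mcorr m : mx_measurable (correction (S n) m).
  apply: mx_measurable_sum => l; apply: mx_measurableM; first exact: minc.
  exact: (mx_adapted_measurable hF (g0 m l) (@sv_mes (S n) _ (g0 m l))).
pose p1 w := rvec c ('i%C *: J t w) - spI (S n) w.
pose p2 m w := spI (S n) w - riemann_ito (sv (S n)) m w.
pose p4 m w := 2^-1 *: drift_sum m w - 2^-1 *: drift w.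
have mp1 : mx_measurable p1 by apply: mx_measurableB => //; exact: mi.
have mp2 m : mx_measurable (p2 m) by apply: mx_measurableB.
have mp4 m : mx_measurable (p4 m).
  by apply: mx_measurableB; apply: mx_measurableZ => //; exact: measurable_cst.
have [M3 hM3] : exists M3, forall m, (M3 <= m)%N -> rho P (fun w => nsq (p2 m w)) <= e / 32.
  suff : null_seq (fun m => rho P (fun w => nsq (p2 m w))) by move/(_ _ e32).
  apply: rho_null_pointwise => [m|m w|w]; first exact: measurable_nsq.
    exact: nsq_ge0.
  move=> x x0; have [M hM] := riemann_simple (S n) w x0; exists M => m /hM.
  by rewrite -nsqN opprB.
have [M4 hM4] : exists M4, forall m, (M4 <= m)%N -> rho P (fun w => nsq (p4 m w)) <= e / 32.
  suff : null_seq (fun m => rho P (fun w => nsq (p4 m w))) by move/(_ _ e32).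
  apply: rho_null_pointwise => [m|m w|w]; first exact: measurable_nsq.
    exact: nsq_ge0.
  exact: drift_cvg.
have [M5 hM5] : exists M5, forall m, (M5 <= m)%N ->
    rho P (fun w => `|dist_sum (S n) w m - distance (S n) w|) <= dl * (e / 32).
  suff : null_seq (fun m => rho P (fun w => `|dist_sum (S n) w m - distance (S n) w|)).
    by move/(_ _ (mulr_gt0 dl0 e32)).
  apply: rho_null_pointwise => [m|m w|w]; last exact: dist_cvg.
    by apply: measurableT_comp => //; exact: measurable_funB.
  exact: normr_ge0.
exists (maxn (maxn M3 M4) (maxn M5 1)) => m.
rewrite !geq_max => /andP[/andP[m3 m4] /andP[m5 m0]].
have q1 : rho P (fun w => nsq (p1 w)) <= e / 32.
  apply: le_trans hM2; apply: rho_le.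
  - exact: measurable_nsq.
  - apply: measurableT_comp => //; apply: measurable_funB => //; exact: mSI.
  - by move=> w; exact: nsq_ge0.
  move=> w; rewrite subr0 ger0_norm ?mxnorm2_ge0// /p1 /spI -rvecB -scalerBr.
  rewrite -nsqN -rvecN -scalerN opprB; exact: nsq_rvec_i_le.
have q2 := hM3 m m3; have q4 := hM4 m m4; have q5 := hM5 m m5.
have q6 : rho P (fun w => dist_sum (S n) w m) <= 2 * dl * (e / 32).
  apply: (@le_trans _ _ (rho P (fun w => `|dist_sum (S n) w m - distance (S n) w| +
                                         `|distance (S n) w - 0|))).
    apply: rho_le => // [|w|w].
    - by apply: measurable_funD; apply: measurableT_comp => //; exact: measurable_funB.
    - by apply: sumr_ge0 => l _; rewrite mulr_ge0 ?mxnorm2_ge0// divr_ge0// ltW.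
    - by rewrite subr0 -[leLHS](subrK (distance (S n) w)) lerD ?ler_norm.
  apply: le_trans (rhoD _ _ _ _ _) _.
  - by apply: measurableT_comp => //; exact: measurable_funB.
  - by apply: measurableT_comp => //; exact: measurable_funB.
  - by move=> w; exact: normr_ge0.
  - by move=> w; exact: normr_ge0.
  by apply: le_trans (lerD q5 hM1) _; rewrite -mulrDl mulr_natl mulr2n.
have q3 : rho P (fun w => nsq (correction (S n) m w)) <= 3 * (e / 32).
  apply: (le_trans (rho_correction (S n) m0 dl0 dl1)).
  have : rho P (fun w => dist_sum (S n) w m) / dl <= 2 * (e / 32).
    by rewrite ler_pdivrMr//; apply: le_trans q6 _; rewrite mulrAC.
  by move=> h3; rewrite -natr1 mulrDl mul1r; exact: lerD.
rewrite (@rho_eq_ae _ _ _ _ _ (fun w => nsq ((p1 w + p2 m w) + (correction (S n) m w + p4 m w)))).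
- pose p k w := [:: nsq (p1 w); nsq (p2 m w); nsq (correction (S n) m w); nsq (p4 m w)]`_k.
  have mp (k : 'I_4) : measurable_fun setT (p k).
    by case: k => -[|[|[|[|//]]]] ?; apply: measurable_nsq => //.
  have p0 (k : 'I_4) w : 0 <= p k w.
    by case: k => -[|[|[|[|//]]]] ?; exact: nsq_ge0.
  apply: (@le_trans _ _ (rho P (fun w => 4 * \sum_(k < 4) p k w))).
    apply: rho_le => [||w|w].
    - by apply: measurable_nsq; apply: mx_measurableD; apply: mx_measurableD.
    - by apply: measurable_funM => //; exact: measurable_sum.
    - exact: nsq_ge0.
    rewrite !big_ord_recl big_ord0 /p/=.
    exact: nsqD4.
  apply: le_trans (rhoZ P _ _ _) _ => //.
  - by rewrite ler1n.
  - exact: measurable_sum.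
  - by move=> w; exact: sumr_ge0.
  have := rho_sum P (index_enum 'I_4) mp p0.
  rewrite !big_ord_recl big_ord0 /p/= => hp.
  exact: le_trans (ler_wpM2l (ler0n _ 4) hp) (four_errors (ltW e0) q1 q2 q3 q4).
- apply: measurable_nsq; apply: mx_measurableB.
    by apply: mx_measurableB; apply: mu; rewrite ?lexx ?(ltW t0).
  apply: mx_measurable_sum => l; apply: mx_measurableM; last exact: mu.
  by apply: mx_measurableB; [exact: minc|exact: mx_measurable_cst].
- by apply: measurable_nsq; apply: mx_measurableD; apply: mx_measurableD.
- by move=> w; exact: nsq_ge0.
- by move=> w; exact: nsq_ge0.
- by apply: filterS hae => w /(residualE (S n) m) ->.
Qed.

End FixedTime.

Lemma unitary_linear_sde : linear_sde P F A u.
Proof.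
split=> //.
move=> t; rewrite le_eqVlt => /predU1P[<-|t0]; last exact: riemann_sde_pos.
move=> e e0; exists 0%N => m _; rewrite /rho (@eq_Ex _ _ _ _ _ (cst 0)) ?Ex_cst ?ltW// => w.
have -> : u 0 w - u 0 w - \sum_(l < m)
      (inc A (fine_time (0 / m%:R) l) (fine_time (0 / m%:R) l.+1) w -
       (0 / m%:R / 2)%:M) *m u (fine_time (0 / m%:R) l) w = 0.
  rewrite subrr sub0r big1 ?oppr0// => l _.
  by rewrite /fine_time /inc !mul0r !mulr0 subrr raddf0 subr0 mul0mx.
by rewrite nsq0 /= min_r.
Qed.

End UnitarySDE.
(** * Increments of Hermitian Brownian motion *)

Section HermitianCoordinates.
Context {R : realType} {N : nat}.
Hypothesis N0 : (0 < N)%N.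
Implicit Types M : 'M[R[i]]_N.

Lemma mxcoord_herm M b i j : M \is hermsymmx ->
  mxcoord b i j M = (-1) ^+ b * mxcoord b j i M.
Proof.
move=> /is_hermitianmxP; rewrite expr0 scale1r => hM.
rewrite /mxcoord {1 2}hM !mxE; case: b; case: (M j i) => x y /=.
  by rewrite expr1 mulN1r.
by rewrite expr0 mul1r.
Qed.

Lemma hermN M : M \is hermsymmx -> - M \is hermsymmx.
Proof.
move=> /is_hermitianmxP; rewrite expr0 scale1r => e.
apply/is_hermitianmxP; rewrite expr0 scale1r; apply/matrixP => a b.
by rewrite {1}e !mxE rmorphN.
Qed.

(** Entry of [(2 N)^-1 (E_jk + E_kj)] for real parts, with a minus sign for imaginary parts. It is
    also the covariance, per unit time, of two coordinates of the same kind. *)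
Definition coord_coef b (j k a e : 'I_N) : R :=
  (2 * N%:R)^-1 * (((a == j) && (e == k))%:R + (-1) ^+ b * ((a == k) && (e == j))%:R).

(* The Hermitian matrix whose pairing with M is the coordinate b j k of M. *)
Definition coord_mx b j k : 'M[R[i]]_N := \matrix_(a, e)
  ((if b then 0 else coord_coef b j k a e) +i*
   (if b then coord_coef b j k a e else 0))%C.

Lemma mxcoord_coord_mx b' a e b j k :
  mxcoord b' a e (coord_mx b j k) = (b' == b)%:R * coord_coef b j k a e.
Proof. by rewrite /mxcoord mxE; case: b'; case: b => /=; rewrite ?mul1r ?mul0r. Qed.

Lemma coord_mx_herm b j k : coord_mx b j k \is hermsymmx.
Proof.
apply/is_hermitianmxP; rewrite expr0 scale1r; apply/matrixP => a e; rewrite !mxE.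
apply/eqP; rewrite eq_complex /=; apply/andP; split; apply/eqP; case: b => //=.
- by rewrite /coord_coef !expr0 !mul1r addrC ![_ && (a == _)]andbC.
- by rewrite /coord_coef !expr1 !mulN1r -mulrN opprB ![_ && (a == _)]andbC.
- by rewrite oppr0.
Qed.

Lemma herm_pairing_coord (A B : 'M[R[i]]_N) : B \is hermsymmx ->
  herm_pairing A B =
  N%:R * \sum_b \sum_a \sum_e mxcoord b a e A * mxcoord b a e B.
Proof.
move=> hB; congr (_ * _); rewrite /mxtrace Re_sum big_bool/=.
rewrite -big_split/=; apply: eq_bigr => a _.
rewrite mxE Re_sum -big_split/=; apply: eq_bigr => e _.
have := mxcoord_herm true a e hB; have := mxcoord_herm false a e hB.
by rewrite /mxcoord ReM expr1 expr0 => -> ->; ring.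
Qed.

Lemma herm_pairing_coord_mx b j k M : M \is hermsymmx ->
  herm_pairing (coord_mx b j k) M = mxcoord b j k M.
Proof.
move=> hM; rewrite (herm_pairing_coord _ hM).
have N1 : (2 * N%:R : R) != 0 by rewrite mulf_neq0 ?pnatr_eq0 -?lt0n.
have sum2 (f : 'I_N -> 'I_N -> R) j' k' :
    \sum_a \sum_e ((a == j') && (e == k'))%:R * f a e = f j' k'.
  rewrite (bigD1 j')//= [X in _ + X]big1 ?addr0; last first.
    by move=> a /negbTE ->; rewrite big1// => e _; rewrite mul0r.
  rewrite (bigD1 k')//= [X in _ + X]big1 ?addr0; last first.
    by move=> e /negbTE ->; rewrite andbF mul0r.
  by rewrite !eqxx mul1r.
have E : \sum_b' \sum_a \sum_e mxcoord b' a e (coord_mx b j k) * mxcoord b' a e M =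
   (2 * N%:R)^-1 * (mxcoord b j k M + (-1) ^+ b * mxcoord b k j M).
  rewrite (bigD1 b)//= [X in _ + X]big1 ?addr0; last first.
    move=> b' /negbTE b'b; rewrite big1// => a _; rewrite big1// => e _.
    by rewrite mxcoord_coord_mx b'b !mul0r.
  rewrite -(sum2 (fun a e => mxcoord b a e M) j k) -(sum2 (fun a e => mxcoord b a e M) k j).
  rewrite [X in _ = _ * (_ + X)]mulr_sumr -big_split/= mulr_sumr; apply: eq_bigr => a _.
  rewrite [X in _ = _ * (_ + X)]mulr_sumr -big_split/= mulr_sumr; apply: eq_bigr => e _.
  by rewrite mxcoord_coord_mx eqxx mul1r /coord_coef; ring.
rewrite E (mxcoord_herm b k j hM) mulrA -exprD addnn -mul2n exprM sqrrN !expr1n.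
by field; rewrite pnatr_eq0 -lt0n.
Qed.

End HermitianCoordinates.

(** * Covariance of the real entries *)

Section RealEntries.
Context {R : realType} {N : nat}.
Implicit Types (M : 'M[R[i]]_N) (a b c d : 'I_(N + N)).

Definition rhi a : bool := if fintype.split a is inr _ then true else false.
Definition rix a : 'I_N := match fintype.split a with inl i => i | inr i => i end.

Let splitl (i : 'I_N) : fintype.split (lshift N i) = inl i.
Proof. exact: (unsplitK (inl i)). Qed.
Let splitr (i : 'I_N) : fintype.split (rshift N i) = inr i.
Proof. exact: (unsplitK (inr i)). Qed.

(** One signed formula for the four blocks, so that covariances can be checked by cases on the
    booleans [rhi]. *)
Lemma rmxE M a b : rmx M a b =
  (-1) ^+ (~~ (rhi a && ~~ rhi b)) * mxcoord (rhi a == rhi b) (rix a) (rix b) M.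
Proof.
case: (split_ordP a) => i ->; case: (split_ordP b) => k ->;
  rewrite /rhi /rix ?splitl ?splitr /rmx ?block_mxEul ?block_mxEur ?block_mxEdl
    ?block_mxEdr !mxE /= ?expr1 ?expr0 ?mulN1r ?mul1r//.
Qed.

Lemma rhi_rix_eq a b : (a == b) = (rhi a == rhi b) && (rix a == rix b).
Proof.
case: (split_ordP a) => i ->; case: (split_ordP b) => k ->;
  rewrite /rhi /rix ?splitl ?splitr ?eq_lshift ?eq_rshift ?eq_lrshift ?eq_rlshift//=.
Qed.

Lemma mxcoord1 (b0 : bool) (i k : 'I_N) : mxcoord b0 i k (1 : 'M[R[i]]_N) = (~~ b0)%:R * (i == k)%:R.
Proof. by rewrite /mxcoord mxE; case: (i == k); case: b0 => /=; rewrite ?mulr1 ?mulr0. Qed.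

(* Multiplication by the imaginary unit. *)
Definition Jmx : 'M[R]_(N + N) := rmx 1.

(* The covariance of the entries of a standard Gaussian antisymmetric matrix
   commuting with [Jmx]. *)
Definition rcov a b c d : R :=
  (2 * N%:R)^-1 * ((a == c)%:R * (b == d)%:R - (a == d)%:R * (b == c)%:R +
                   Jmx a c * Jmx b d - Jmx a d * Jmx b c).

Lemma Jmx_tr : Jmx^T = - Jmx.
Proof.
apply: rmx_anti; apply/is_hermitianmxP; rewrite expr0 scale1r.
by rewrite tr_scalar_mx map_scalar_mx rmorph1.
Qed.

Lemma JmxN a b : Jmx b a = - Jmx a b.
Proof. by have /matrixP/(_ a b) := Jmx_tr; rewrite mxE => ->; rewrite mxE. Qed.

Lemma Jmx_sqr : Jmx *m Jmx = - 1%:M.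
Proof.
have J1 : (\matrix_(i, j) mxcoord true i j (1 : 'M[R[i]]_N)) = 0.
  by apply/matrixP => i j; rewrite mxE mxcoord1 mul0r mxE.
have J2 : (\matrix_(i, j) mxcoord false i j (1 : 'M[R[i]]_N)) = 1%:M.
  by apply/matrixP => i j; rewrite mxE mxcoord1 mul1r mxE.
rewrite /Jmx /rmx J1 J2 mulmx_block oppr0 !mul0mx !mulmx0 !add0r !addr0.
by rewrite mulNmx mulmxN !mulmx1 scalar_mx_block opp_block_mx !oppr0.
Qed.

(** On the diagonal the four terms of [rcov] sum to [(2 N)^-1 (1 - 2 N - 1 - 0)], the second [- 1]
    coming from [J^2 = - 1]. This normalization is what matches the drift [- U / 2] of the
    equation. *)
Lemma rcov_sqr a b : (0 < N)%N -> \sum_e rcov a e e b = - (a == b)%:R.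
Proof.
move=> N0; rewrite -mulr_sumr !big_split/= !sumrN.
have -> : \sum_(e < N + N) (a == e)%:R * (e == b)%:R = (a == b)%:R :> R.
  rewrite (bigD1 a)//= eqxx mul1r big1 ?addr0// => e.
  by rewrite eq_sym => /negbTE ->; rewrite mul0r.
have -> : \sum_(e < N + N) (a == b)%:R * (e == e)%:R = 2 * N%:R * (a == b)%:R :> R.
  under eq_bigr do rewrite eqxx mulr1.
  by rewrite sumr_const card_ord -[LHS]mulr_natr natrD; ring.
have -> : \sum_(e < N + N) Jmx a e * Jmx e b = - (a == b)%:R.
  by have /matrixP/(_ a b) := Jmx_sqr; rewrite mxE => ->; rewrite !mxE.
rewrite [X in _ - X]big1 => [|e _]; last first.
  suff -> : Jmx e e = 0 by rewrite mulr0.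
  by have := JmxN e e; lra.
have N1 : (N%:R : R) != 0 by rewrite pnatr_eq0 -lt0n.
by field.
Qed.

Lemma rcov_coord a b c d :
  (-1) ^+ (~~ (rhi a && ~~ rhi b)) * (-1) ^+ (~~ (rhi c && ~~ rhi d)) *
  (((rhi a == rhi b) == (rhi c == rhi d))%:R *
    coord_coef (rhi c == rhi d) (rix c) (rix d) (rix a) (rix b)) = rcov a b c d.
Proof.
rewrite /rcov /Jmx /coord_coef !rmxE !mxcoord1 !rhi_rix_eq -!mulnb !natrM.
case: (rhi a); case: (rhi b); case: (rhi c); case: (rhi d) => /=;
  rewrite ?expr1 ?expr0; ring.
Qed.

End RealEntries.

Section HermitianIncrements.
Context {d : measure_display} {T : measurableType d} {R : realType} {N : nat}.
Hypothesis N0 : (0 < N)%N.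
Variable P : probability T R.
Variable H : R -> T -> 'M[R[i]]_N.
Hypothesis hH : hermitian_BM P H.
Variables s t : R.
Hypothesis s0 : 0 <= s.
Hypothesis st : s <= t.

Let t0 : 0 <= t. Proof. exact: le_trans st. Qed.
Let hermH r w : 0 <= r -> H r w \is hermsymmx.
Proof. by case: hH => h _ _ _ _; exact: h. Qed.

Let X b j k r w := mxcoord b j k (H r w).

Let pairingN (A M : 'M[R[i]]_N) : herm_pairing (- A) M = - herm_pairing A M :> R.
Proof. by rewrite /herm_pairing mulNmx raddfN/= -mulrN; congr (_ * _); case: (\tr _). Qed.

Let gaussian_at b j k r : 0 <= r -> centered_gaussian P (X b j k r).
Proof.
move=> r0; case: hH => _ _ _ /(_ [:: (r, coord_mx b j k)]) h _.
rewrite (_ : X b j k r = fun w =>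
    \sum_(q <- [:: (r, coord_mx b j k)]) herm_pairing q.2 (H q.1 w)).
  by apply: h => q; rewrite inE => /eqP ->; split => //; exact: coord_mx_herm.
by apply/funext => w; rewrite big_seq1 herm_pairing_coord_mx// hermH.
Qed.

Definition hinc w := H t w - H s w.

Lemma hinc_gaussian b j k : centered_gaussian P (fun w => mxcoord b j k (hinc w)).
Proof.
case: hH => _ _ _ /(_ [:: (t, coord_mx b j k); (s, - coord_mx b j k)]) h _.
rewrite (_ : (fun _ => _) = fun w =>
    \sum_(q <- [:: (t, coord_mx b j k); (s, - coord_mx b j k)]) herm_pairing q.2 (H q.1 w)).
  apply: h => q; rewrite !inE => /orP[] /eqP -> /=; split => //; first exact: coord_mx_herm.
  by apply: hermN; exact: coord_mx_herm.
apply/funext => w; rewrite big_cons big_seq1/= pairingN mxcoordB.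
by rewrite !herm_pairing_coord_mx// hermH.
Qed.

Let L2_at b j k r : 0 <= r -> L2 P (X b j k r).
Proof. by move=> r0; case: (centered_gaussian_moments (gaussian_at b j k r0)). Qed.

Let cov_at b j k b' j' k' r r' : 0 <= r -> 0 <= r' ->
  Ex P (fun w => X b j k r w * X b' j' k' r' w) =
  Num.min r r' * ((b == b')%:R * coord_coef b' j' k' j k).
Proof.
move=> r0 r'0; case: hH => _ _ _ _ h.
have := h r r' _ _ r0 r'0 (coord_mx_herm b j k) (coord_mx_herm b' j' k').
rewrite herm_pairing_coord_mx ?coord_mx_herm// mxcoord_coord_mx unlock => e.
rewrite /Ex /Rintegral -[RHS]/(fine (_%:E)) -e; congr fine.
by apply: eq_integral => w _; rewrite !herm_pairing_coord_mx// hermH.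
Qed.

Lemma hinc_cov b j k b' j' k' :
  Ex P (fun w => mxcoord b j k (hinc w) * mxcoord b' j' k' (hinc w)) =
  (t - s) * ((b == b')%:R * coord_coef b' j' k' j k).
Proof.
rewrite (@eq_Ex _ _ _ _ _ (fun w => (X b j k t w * X b' j' k' t w - X b j k t w * X b' j' k' s w)
  - (X b j k s w * X b' j' k' t w - X b j k s w * X b' j' k' s w))); last first.
  by move=> w; rewrite !mxcoordB /X; ring.
have l r r' : 0 <= r -> 0 <= r' -> L1 P (fun w => X b j k r w * X b' j' k' r' w).
  by move=> r0 r'0; apply: L2M; exact: L2_at.
rewrite !ExB ?cov_at ?minxx//; do ?[exact: l | apply: L1B; exact: l].
by rewrite (min_r st) (min_l st); ring.
Qed.

Lemma hinc_moments b j k : let Y w := mxcoord b j k (hinc w) in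
  [/\ L2 P Y, L1 P (fun w => Y w ^+ 4), Ex P Y = 0,
      Ex P (fun w => Y w ^+ 2) <= t - s &
      Ex P (fun w => Y w ^+ 4) <= 522 * (t - s) ^+ 2].
Proof.
move=> Y; have [l2 l4 e0 e4] := centered_gaussian_moments (hinc_gaussian b j k).
have ts : 0 <= t - s by rewrite subr_ge0.
have e2 : Ex P (fun w => Y w ^+ 2) <= t - s.
  have -> : Ex P (fun w => Y w ^+ 2) = (t - s) * coord_coef b j k j k.
    have := hinc_cov b j k b j k; rewrite eqxx mul1r => <-.
    by apply: eq_Ex => w; rewrite expr2.
  rewrite ler_piMr// /coord_coef eqxx -ler_pdivlMl; last by rewrite invr_gt0 mulr_gt0 ?ltr0n.
  rewrite invrK mulr1; have : (1 : R) <= N%:R by rewrite ler1n.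
  by rewrite !eqxx; case: b {Y l2 l4 e0 e4} => /=; case: (_ && _) => /=; rewrite ?expr0 ?expr1; lra.
split; [exact: l2|exact: l4|exact: e0|exact: e2|].
apply: (le_trans e4); rewrite ler_wpM2l ?ler0n//.
by rewrite ler_sqr ?nnegrE//; apply: Ex_ge0 => w; exact: sqr_ge0.
Qed.

Lemma rmx_hinc_moments a b : let Y w := rmx (hinc w) a b in
  [/\ L2 P Y, L1 P (fun w => Y w ^+ 4), Ex P Y = 0,
      Ex P (fun w => Y w ^+ 2) <= t - s &
      Ex P (fun w => Y w ^+ 4) <= 522 * (t - s) ^+ 2].
Proof.
move=> Y; rewrite /Y; under eq_fun do rewrite rmxE.
have [l2 l4 e0 e2 e4] := hinc_moments (rhi a == rhi b) (rix a) (rix b).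
split.
- exact: L2Z.
- rewrite (_ : (fun _ => _) = (fun w => mxcoord (rhi a == rhi b) (rix a) (rix b) (hinc w) ^+ 4))//.
  by apply/funext => w; rewrite rmxE exprMn -exprM -signr_odd oddM andbF mul1r.
- by rewrite ExZ ?e0 ?mulr0//; exact: L2_L1.
- apply: le_trans e2; rewrite le_eqVlt; apply/orP; left; apply/eqP/eq_Ex => w.
  by rewrite rmxE exprMn -exprM -signr_odd oddM andbF mul1r.
- apply: le_trans e4; rewrite le_eqVlt; apply/orP; left; apply/eqP/eq_Ex => w.
  by rewrite rmxE exprMn -exprM -signr_odd oddM andbF mul1r.
Qed.

Lemma rmx_hinc_cov a b a' b' :
  Ex P (fun w => rmx (hinc w) a b * rmx (hinc w) a' b') = (t - s) * rcov a b a' b'.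
Proof.
rewrite -rcov_coord mulrCA -hinc_cov -ExZ.
  by apply: eq_Ex => w; rewrite !rmxE; ring.
by apply: L2M; [have [] := hinc_moments (rhi a == rhi b) (rix a) (rix b)
               |have [] := hinc_moments (rhi a' == rhi b') (rix a') (rix b')].
Qed.

End HermitianIncrements.

Lemma half_sum_le (R : realFieldType) (x y z : R) : x <= z -> y <= z ->
  2^-1 * (x + y) <= z.
Proof. lra. Qed.

(** * Hermitian Brownian motion as an antisymmetric driver *)

Section HermitianDriver.
Context {d : measure_display} {T : measurableType d} {R : realType} {N : nat}.
Hypothesis N0 : (0 < N)%N.
Variable P : probability T R.
Variable F : R -> set (set T).
Hypothesis hF : is_filtration F.
Variable H : R -> T -> 'M[R[i]]_N.
Hypothesis hH : hermitian_BM_wrt P F H.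

Let bmH : hermitian_BM P H. Proof. by case: hH. Qed.
Let adH : adapted F H. Proof. by case: hH. Qed.

Local Notation A := (fun t w => rmx (H t w)).
Local Notation D := (N + N)%N.

Let incE s t w : inc A s t w = rmx (hinc H s t w).
Proof. by rewrite /inc /hinc rmxB. Qed.

Section Increment.
Variables s t : R.
Hypothesis s0 : 0 <= s.
Hypothesis st : s <= t.

Let t0 : 0 <= t. Proof. exact: le_trans st. Qed.
Let G := sigma_mx (hinc H s t).

Lemma Ex_past_increment X Y : mes_wrt (F s) X -> mes_wrt G Y -> L1 P X -> L1 P Y ->
  L1 P (fun w => X w * Y w) /\ Ex P (fun w => X w * Y w) = Ex P X * Ex P Y.
Proof.
move=> mX mY lX lY; apply: L1_Ex_indep => // B C mB mC.
case: hH => _ _ /(_ s t s0 st) h; apply: h.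
  exact: (mes_wrtP X (hF.1 s s0).1).1 mX B mB.
by apply: (mes_wrtP Y _).1 mY C mC; exact: smallest_sigma_algebra.
Qed.

(** Independence of the increment from [F s] promotes a plain mean and a plain variance to the
    conditional ones in [noise]. *)
Lemma noise_increment Y kappa : mes_wrt (F t) Y -> mes_wrt G Y ->
  L2 P Y -> Ex P Y = 0 -> Ex P (fun w => Y w ^+ 2) <= kappa ->
  noise P F s t kappa Y.
Proof.
move=> mY gY lY e1 e2; split=> //.
  move=> X mX lX.
  by have [_ ->] := Ex_past_increment mX gY (L2_L1 lX) (L2_L1 lY); rewrite e1 mulr0.
move=> X c mX Xc; have mX' := mes_filtration hF s0 mX.
have mX2 : mes_wrt (F s) (fun w => X w ^+ 2) by apply: measurable_funX.
have gY2 : mes_wrt G (fun w => Y w ^+ 2) by apply: measurable_funX.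
have [_ lY2] := lY.
have [_ lX2] := L2_bounded P mX' Xc.
under eq_Ex do rewrite exprMn.
have [_ ->] := Ex_past_increment mX2 gY2 lX2 lY2.
by rewrite mulrC ler_wpM2r//; apply: Ex_ge0 => w; exact: sqr_ge0.
Qed.

Lemma rmx_hinc_adapted : mx_adapted G (fun w => rmx (hinc H s t w)).
Proof.
move=> a b; under eq_fun do rewrite rmxE.
apply: measurable_funM => //.
by apply: sigma_mx_mes => //; exact: smallest_sigma_algebra.
Qed.

Let rmx_adapted r : 0 <= r -> mx_adapted (F r) (A r).
Proof.
move=> r0 a b; under eq_fun do rewrite rmxE.
apply: measurable_funM => //.
by apply: sigma_mx_mes; [case: (hF.1 r r0)|exact: adH].
Qed.

Lemma rmx_hinc_adaptedF : mx_adapted (F t) (fun w => rmx (hinc H s t w)).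
Proof.
move=> a b; under eq_fun do rewrite -incE /inc.
apply: mx_measurableB; first exact: rmx_adapted.
exact: (mx_adapted_le hF s0 st (rmx_adapted s0)).
Qed.

Let B w := rmx (hinc H s t w).
Let moments a b := rmx_hinc_moments N0 bmH s0 st a b.
Let ts : 0 <= t - s. Proof. by rewrite subr_ge0. Qed.

Let measurable_B a b : measurable_fun setT (fun w => B w a b).
Proof. by have [[]] := moments a b. Qed.

Lemma rmx_hinc_prod a b c d' : let Y w := B w a b * B w c d' in
  L2 P Y /\ Ex P (fun w => Y w ^+ 2) <= 522 * (t - s) ^+ 2.
Proof.
move=> Y; have [_ l4 _ _ e4] := moments a b; have [_ l4' _ _ e4'] := moments c d'.
have mY : measurable_fun setT Y by apply: measurable_funM.
have h w : Y w ^+ 2 <= 2^-1 * (B w a b ^+ 4 + B w c d' ^+ 4).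
  have -> : 4%N = (2 * 2)%N by []; rewrite /Y !exprM.
  by have := sqr_ge0 (B w a b ^+ 2 - B w c d' ^+ 2); nra.
have lS : L1 P (fun w => 2^-1 * (B w a b ^+ 4 + B w c d' ^+ 4)) by apply/L1Z/L1D.
have l2 : L2 P Y.
  split=> //; apply: L1_dom lS; first exact: measurable_funX.
  by move=> w; rewrite ger0_norm ?sqr_ge0.
split=> //; apply: (@le_trans _ _ (Ex P (fun w => 2^-1 * (B w a b ^+ 4 + B w c d' ^+ 4)))).
  by apply: le_Ex => //; case: l2.
rewrite ExZ ?ExD//; last exact: L1D.
exact: half_sum_le.
Qed.

Lemma rmx_hinc_sqr_Ex a b : Ex P (fun w => (B w *m B w) a b) = - (t - s) * (a == b)%:R.
Proof.
under eq_Ex do rewrite mxE.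
rewrite Ex_sum => [|e _]; last by apply: L2_L1; case: (rmx_hinc_prod a e e b).
under eq_bigr do rewrite (rmx_hinc_cov N0 bmH s0 st).
rewrite -mulr_sumr mulNr -mulrN; congr (_ * _).
exact: rcov_sqr.
Qed.

(** One constant for all bounds: [522 D^4] serves the fourth moment, with [D^2] from two
    Cauchy-Schwarz steps and [D^2] entries; [1044 D^2 + 2] serves the quadratic noise. *)
Definition driver_cst : R := 522 * D%:R ^+ 4 + 1044 * D%:R ^+ 2 + 2.

Let cst_ge x : x <= 522 * D%:R ^+ 4 \/ x <= 1044 * D%:R ^+ 2 + 2 -> x <= driver_cst.
Proof.
have h2 : (0 : R) <= D%:R ^+ 2 by rewrite exprn_ge0.
have h4 : (0 : R) <= D%:R ^+ 4 by rewrite exprn_ge0.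
by rewrite /driver_cst => -[|]; lra.
Qed.

Lemma driver_lin a b : noise P F s t (driver_cst * (t - s)) (fun w => B w a b).
Proof.
have [l2 _ e0 e2 _] := moments a b.
apply: noise_increment => //; first exact: rmx_hinc_adaptedF.
  exact: rmx_hinc_adapted.
apply: (le_trans e2); rewrite ler_peMl//; apply: cst_ge; right.
have : (0 : R) <= D%:R ^+ 2 by rewrite exprn_ge0.
by move: (D%:R ^+ 2) => x; lra.
Qed.

Lemma driver_quad a b : noise P F s t (driver_cst * (t - s) ^+ 2)
  (fun w => (B w *m B w + (t - s)%:M) a b).
Proof.
pose Z w := (B w *m B w) a b; pose k : R := (t - s) * (a == b)%:R.
have E w : (B w *m B w + (t - s)%:M) a b = Z w + k.
  by rewrite mxE [X in _ + X]mxE /k mulr_natr.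
have lprod e := (rmx_hinc_prod a e e b).1.
have LZ : L2 P Z.
  by rewrite /Z; under eq_fun do rewrite mxE; apply: L2_sum => e _; exact: lprod.
have LY : L2 P (fun w => (B w *m B w + (t - s)%:M) a b).
  by under eq_fun do rewrite E; apply: L2D LZ (L2_cst _ _).
apply: noise_increment => //.
- by apply: mx_measurableD; [apply: mx_measurableM; exact: rmx_hinc_adaptedF
                            |exact: mx_measurable_cst].
- by apply: mx_measurableD; [apply: mx_measurableM; exact: rmx_hinc_adapted
                            |exact: mx_measurable_cst].
- under eq_Ex do rewrite E; rewrite ExD ?Ex_cst; last 2 first.
  + exact: L2_L1.
  + exact: L1_cst.
  by rewrite rmx_hinc_sqr_Ex /k mulNr addNr.
have lS : L1 P (fun w => \sum_e (B w a e * B w e b) ^+ 2).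
  by apply: L1_sum => e _; exact: (lprod e).2.
apply: (@le_trans _ _ (Ex P (fun w => 2 * D%:R * (\sum_e (B w a e * B w e b) ^+ 2)
   + 2 * (t - s) ^+ 2))).
  apply: le_Ex => [||w]; first by case: LY.
    by apply: L1D; [exact: L1Z|exact: L1_cst].
  rewrite E; have h1 : Z w ^+ 2 <= D%:R * \sum_e (B w a e * B w e b) ^+ 2.
    have := @sqr_sum_le R 'I_D (fun e => B w a e * B w e b).
    by rewrite card_ord /Z mxE.
  have h2 : k ^+ 2 <= (t - s) ^+ 2.
    by rewrite /k; case: (a == b); rewrite ?mulr1 ?mulr0 ?expr0n ?sqr_ge0.
  rewrite -mulrA; have := sqr_ge0 (Z w - k); nra.
rewrite ExD ?Ex_cst ?ExZ ?Ex_sum//; last 3 first.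
- by move=> e _; exact: (lprod e).2.
- exact: L1Z.
- exact: L1_cst.
have h : \sum_e Ex P (fun w => (B w a e * B w e b) ^+ 2) <= D%:R * (522 * (t - s) ^+ 2).
  rewrite mulr_natl -[X in _ *+ X](card_ord D) -sumr_const.
  by apply: ler_sum => e _; case: (rmx_hinc_prod a e e b).
apply: (@le_trans _ _ ((1044 * D%:R ^+ 2 + 2) * (t - s) ^+ 2)).
  have h0 := ler_wpM2l (mulr_ge0 (ler0n R 2) (ler0n R D)) h.
  by apply: le_trans (lerD h0 (lexx _)) _; rewrite le_eqVlt; apply/orP; left; apply/eqP; ring.
by apply: ler_wpM2r; [exact: sqr_ge0|apply: cst_ge; right].
Qed.

Lemma driver_four : L1 P (fun w => fsq (B w) ^+ 2) /\
  Ex P (fun w => fsq (B w) ^+ 2) <= driver_cst * (t - s) ^+ 2.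
Proof.
pose S w := D%:R ^+ 2 * \sum_a \sum_b B w a b ^+ 4.
have l4 a b : L1 P (fun w => B w a b ^+ 4) by case: (moments a b).
have lS : L1 P S by apply/L1Z/L1_sum => a _; apply: L1_sum => b _.
have h w : fsq (B w) ^+ 2 <= S w.
  rewrite /fsq /S expr2 -mulrA.
  apply: le_trans (@sqr_sum_le R 'I_D _) _; rewrite card_ord ler_wpM2l//.
  rewrite mulr_sumr; apply: ler_sum => a _.
  apply: le_trans (@sqr_sum_le R 'I_D _) _; rewrite card_ord ler_wpM2l//.
  by apply: ler_sum => b _; rewrite -exprM.
have l : L1 P (fun w => fsq (B w) ^+ 2).
  apply: L1_dom lS => [|w]; last by rewrite ger0_norm ?sqr_ge0.
  by apply: measurable_funX; apply: measurable_fsq.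
split=> //; apply: (le_trans (le_Ex l lS h)).
rewrite ExZ; last by apply: L1_sum => a _; apply: L1_sum => b _.
rewrite Ex_sum; last by move=> a _; apply: L1_sum => b _.
apply: (@le_trans _ _ (522 * D%:R ^+ 4 * (t - s) ^+ 2)); last first.
  by apply: ler_wpM2r; [exact: sqr_ge0|apply: cst_ge; left].
have h2 : \sum_a Ex P (fun w => \sum_b B w a b ^+ 4) <= D%:R * (D%:R * (522 * (t - s) ^+ 2)).
  rewrite mulr_natl -[X in _ *+ X](card_ord D) -sumr_const.
  apply: ler_sum => a _; rewrite Ex_sum//.
  rewrite mulr_natl -[X in _ *+ X](card_ord D) -sumr_const.
  by apply: ler_sum => b _; case: (moments a b).
apply: le_trans (ler_wpM2l (exprn_ge0 2 (ler0n R D)) h2) _.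
by rewrite le_eqVlt; apply/orP; left; apply/eqP; ring.
Qed.

End Increment.

Lemma hermitian_antisym_driver : antisym_driver P F A driver_cst.
Proof.
have iE s t : (fun w => inc A s t w) = (fun w => rmx (hinc H s t w)).
  by apply/funext => w; rewrite incE.
split.
- rewrite /driver_cst; apply: addr_ge0; last exact: ler0n.
  by apply: addr_ge0; apply: mulr_ge0; rewrite ?exprn_ge0 ?ler0n.
- by move=> t w t0; apply: rmx_anti; case: bmH => h _ _ _ _; exact: h.
- move=> t t0 a b; under eq_fun do rewrite rmxE.
  apply: measurable_funM => //.
  by apply: sigma_mx_mes; [case: (hF.1 t t0)|exact: adH].
- move=> s t a b s0 st; under eq_fun do rewrite incE; exact: driver_lin.
- move=> s t a b s0 st; under eq_fun do rewrite incE; exact: driver_quad.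
- move=> s t s0 st; under eq_fun do rewrite incE; exact: driver_four.
Qed.

End HermitianDriver.

(** * One step of the moments along the flow *)

Section PowerExpansion.
Context {R : realDomainType}.

(** Induction by Pascal's rule: multiplying the remainder at [p] by [y] creates only the extra term
    [C(p, 2) x^(p-2) (y - x)^3]. Where a predecessor is truncated at 0, its coefficient vanishes. *)
Lemma power_taylor2 p (x y : R) : 0 <= x <= 1 -> 0 <= y <= 1 ->
  `|y ^+ p - (x ^+ p + p%:R * x ^+ p.-1 * (y - x) +
      'C(p, 2)%:R * x ^+ p.-2 * (y - x) ^+ 2)| <= 'C(p, 3)%:R * `|y - x| ^+ 3.
Proof.
move=> /andP[x0 x1] /andP[y0 y1]; elim: p => [|p IH].
  by rewrite !expr0 !bin0n !mul0r !addr0 subrr normr0.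
rewrite !binS bin1.
set r := y ^+ p - _ in IH.
have E : y ^+ p.+1 - (x ^+ p.+1 + p.+1%:R * x ^+ p * (y - x) +
    ('C(p, 2) + p)%:R * x ^+ p.-1 * (y - x) ^+ 2) =
    y * r + 'C(p, 2)%:R * x ^+ p.-2 * (y - x) ^+ 3.
  rewrite /r; case: p {IH r} => [|[|p]] /=.
  - by rewrite natrD bin_small//; ring.
  - by rewrite natrD bin_small//; ring.
  - by rewrite natrD !exprS -natr1; ring.
rewrite [p.+1.-1]/= [p.+1.-2]/= E (le_trans (ler_normD _ _))// natrD mulrDl lerD//.
  by rewrite normrM (ger0_norm y0) (le_trans _ IH)// ler_piMl.
rewrite -normrX normrM normrM normr_nat (ger0_norm (exprn_ge0 _ x0)).
by rewrite -mulrA ler_wpM2l// ler_piMl// exprn_ile1.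
Qed.

End PowerExpansion.

Section PairSquare.
Context {R : realFieldType} {D : nat}.
Variables a b : 'I_D.
Hypothesis ab : a != b.
Implicit Types v : 'cV[R]_D.

(** The squared modulus of a complex coordinate, with [a] and [b] indexing its real and imaginary
    parts. *)
Definition psq v : R := v a 0 ^+ 2 + v b 0 ^+ 2.

Lemma psq_ge0 v : 0 <= psq v. Proof. by rewrite addr_ge0 ?sqr_ge0. Qed.

Lemma psq_le_nsq v : psq v <= nsq v.
Proof.
rewrite /nsq (bigD1 a)//= (bigD1 b)/=; last by rewrite eq_sym.
by rewrite addrA lerDl sumr_ge0// => i _; exact: sqr_ge0.
Qed.

Lemma psq_mul_le (x1 x2 y1 y2 : R) :
  (x1 * y1 + x2 * y2) ^+ 2 <= (x1 ^+ 2 + x2 ^+ 2) * (y1 ^+ 2 + y2 ^+ 2).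
Proof. by have := sqr_ge0 (x1 * y2 - x2 * y1); nra. Qed.

(** The difference is [q + 2 m] with [q <= e <= 1] and [m^2 <= e] for [e = nsq (u - v)], so its
    square is at most [2 q^2 + 8 m^2 <= 10 e]. *)
Lemma psq_diff_sqr u v : nsq v = 1 -> nsq (u - v) <= 1 ->
  (psq u - psq v) ^+ 2 <= 10 * nsq (u - v).
Proof.
move=> v1 d1; have d0 := nsq_ge0 (u - v).
have h1 := psq_le_nsq (u - v); have h2 := psq_ge0 (u - v).
have h3 := psq_le_nsq v; have h4 := psq_ge0 v; rewrite v1 in h3.
have c := psq_mul_le (v a 0) (v b 0) ((u - v) a 0) ((u - v) b 0).
have E : psq u - psq v =
    psq (u - v) + 2 * (v a 0 * (u - v) a 0 + v b 0 * (u - v) b 0).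
  by rewrite /psq !mxE; ring.
rewrite E; move: c; rewrite -/(psq v) -/(psq (u - v)).
move: (_ + v b 0 * _) (psq v) (psq (u - v)) (nsq (u - v)) h1 h2 h3 h4 d0 d1.
move=> m s q e h1 h2 h3 h4 d0 d1 c; have := sqr_ge0 (q - 2 * m).
have : s * q <= q by rewrite ler_piMl.
by nra.
Qed.

Lemma nsq_diff_sqr u v : nsq v = 1 -> nsq (u - v) <= 1 ->
  (nsq u - 1) ^+ 2 <= 10 * nsq (u - v).
Proof.
move=> v1 d1; have d0 := nsq_ge0 (u - v).
pose m := \sum_i v i 0 * (u - v) i 0.
have c : m ^+ 2 <= nsq (u - v).
  by have := CauchySchwarz_sum (fun i => v i 0) (fun i => (u - v) i 0); rewrite -/(nsq v) v1 mul1r.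
have E : nsq u - 1 = nsq (u - v) + 2 * m.
  rewrite -[X in nsq u - X]v1 /nsq /m mulr_sumr -sumrB -big_split/=; apply: eq_bigr => i _.
  by rewrite !mxE; ring.
rewrite {}E; move: c d0 d1; move: m (nsq _) => m q c d0 d1.
by have := sqr_ge0 (q - 2 * m); nra.
Qed.

Lemma nsq_cayley_quad B v : B^T = - B ->
  nsq ((cayley B - 1%:M - B) *m v) <= fsq B ^+ 2 / 4 * nsq v.
Proof.
move=> aB; have u := unitmx_1B (tr_half aB).
have -> : cayley B - 1%:M - B = invmx (1%:M - half B) *m (2^-1 *: (B *m B)).
  apply: (can_inj (mulKmx u)); rewrite mulKVmx// cayley_sub1// mulmxBr mulKVmx//.
  rewrite mulmxBl mul1mx /half -scalemxAl opprB addrC subrK.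
  by [].
rewrite -mulmxA; apply: (le_trans (nsq_inv1B _ (tr_half aB))).
rewrite -scalemxAl nsqZ -mulmxA.
have f0 := fsq_ge0 B; have v0 := nsq_ge0 v.
have h1 := nsq_mulmx B v; have h2 := nsq_mulmx B (B *m v).
have h : nsq (B *m (B *m v)) <= fsq B ^+ 2 * nsq v.
  by apply: (le_trans h2); rewrite expr2 -mulrA ler_wpM2l.
lra.
Qed.

End PairSquare.

Section CayleyMoment.
Context {R : realFieldType} {D : nat}.
Variables a b : 'I_D.
Hypothesis ab : a != b.
Variables (B : 'M[R]_D) (x : 'cV[R]_D) (lam : R).
Hypothesis aB : B^T = - B.
Hypothesis x1 : nsq x = 1.
Hypothesis lam0 : 0 < lam.
Hypothesis lam1 : lam <= 1.

Local Notation S := (psq a b x).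
Local Notation S' := (psq a b (cayley B *m x)).

(* Bounds [fsq B ^ (3/2)] without square roots. *)
Definition weight : R := lam * fsq B + fsq B ^+ 2 / lam.
(** The parts of degree one and two in [B] of [S' - S]. In [quad_part] the scalar product of [x]
    with [B^2 x] has no factor 2, as the Cayley expansion contains [B^2 / 2]. *)
Definition lin_part : R := 2 * (x a 0 * (B *m x) a 0 + x b 0 * (B *m x) b 0).
Definition quad_part : R := psq a b (B *m x) +
  (x a 0 * (B *m B *m x) a 0 + x b 0 * (B *m B *m x) b 0).

Let f0 : 0 <= fsq B. Proof. exact: fsq_ge0. Qed.
Let il0 : 0 < lam^-1. Proof. by rewrite invr_gt0. Qed.
Let w0 : 0 <= weight.
Proof. by rewrite addr_ge0 ?mulr_ge0 ?exprn_ge0// ltW. Qed.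

(** [fsq B ^ 3] is the product of the two summands of [weight], hence at most [(weight / 2)^2]. *)
Let sq_weight (k y : R) : 0 <= k -> y ^+ 2 <= k ^+ 2 * fsq B ^+ 3 ->
  `|y| <= k * (weight / 2).
Proof.
move=> k0 h.
rewrite -ler_sqr ?nnegrE ?mulr_ge0 ?invr_ge0//.
rewrite (real_normK (num_real y)); apply: (le_trans h); rewrite exprMn ler_wpM2l ?sqr_ge0//.
have e : lam * lam^-1 = 1 by rewrite mulfV ?gt_eqF.
have -> : fsq B ^+ 3 = lam * fsq B * (fsq B ^+ 2 / lam).
  by rewrite -[LHS]mul1r -e; ring.
rewrite /weight; have := sqr_ge0 (lam * fsq B - fsq B ^+ 2 / lam); lra.
Qed.

Let y := B *m x.
Let z := (cayley B - 1%:M - B) *m x.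
Let r := cayley_rem B *m x.
Let g := (cayley B - 1%:M) *m x.

Let subE (u v : 'cV[R]_D) i : (u - v) i 0 = u i 0 - v i 0.
Proof. by rewrite !mxE. Qed.
Let x'E i : (cayley B *m x) i 0 = x i 0 + g i 0.
Proof. by rewrite /g (mulmxBl (cayley B) 1%:M x) mul1mx subE addrC subrK. Qed.
Let gE i : g i 0 = y i 0 + z i 0.
Proof.
by rewrite /z (mulmxBl (cayley B - 1%:M) B x) subE addrC subrK.
Qed.
Let zE i : z i 0 = 2^-1 * (B *m B *m x) i 0 + r i 0.
Proof.
rewrite /r /cayley_rem (mulmxBl (cayley B - 1%:M - B) _ x) -/z subE.
by rewrite -scalemxAl [X in _ + (_ - X)]mxE addrC subrK.
Qed.

Let hy : psq a b y <= fsq B.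
Proof. by apply: le_trans (psq_le_nsq ab _) _; have := nsq_mulmx B x; rewrite x1 mulr1. Qed.
Let hz : psq a b z <= fsq B ^+ 2 / 4.
Proof. by apply: le_trans (psq_le_nsq ab _) _; have := nsq_cayley_quad x aB; rewrite x1 mulr1. Qed.
Let hr : psq a b r <= fsq B ^+ 3.
Proof. by apply: le_trans (psq_le_nsq ab _) _; have := nsq_cayley_rem x aB; rewrite x1 mulr1. Qed.
Let hg : psq a b g <= fsq B.
Proof. by apply: le_trans (psq_le_nsq ab _) _; have := nsq_cayley_sub1 x aB; rewrite x1 mulr1. Qed.
Let hx : S <= 1. Proof. by rewrite -x1; exact: psq_le_nsq. Qed.
Let nx' : nsq (cayley B *m x) = 1.
Proof. by rewrite nsq_orthogonal// cayley_orthogonal. Qed.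
Let hx' : S' <= 1.
Proof. by rewrite -nx'; exact: psq_le_nsq. Qed.
Let x0 : 0 <= S. Proof. exact: psq_ge0. Qed.

Let eta_sqr : (S' - S) ^+ 2 <= 4 * fsq B.
Proof.
have E : S' - S = g a 0 * ((cayley B *m x) a 0 + x a 0) +
    g b 0 * ((cayley B *m x) b 0 + x b 0) by rewrite /psq !x'E; ring.
rewrite E; apply: (le_trans (psq_mul_le _ _ _ _)); rewrite -/(psq a b g).
have g0 : 0 <= psq a b g by exact: psq_ge0.
rewrite mulrC ler_pM// ?addr_ge0 ?sqr_ge0//.
move: hx hx'; rewrite /psq.
have := sqr_ge0 ((cayley B *m x) a 0 - x a 0).
have := sqr_ge0 ((cayley B *m x) b 0 - x b 0); lra.
Qed.

Let lin_sqr : lin_part ^+ 2 <= 4 * fsq B.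
Proof.
have := psq_mul_le (x a 0) (x b 0) (y a 0) (y b 0).
rewrite -/(psq a b x) -/(psq a b y) /lin_part -/y.
have : S * psq a b y <= psq a b y by rewrite ler_piMl// psq_ge0.
by move: hy; rewrite exprMn; lra.
Qed.

Let eta_lin : `|S' - S - lin_part| <= 2 * fsq B.
Proof.
have E : S' - S - lin_part = psq a b g + 2 * (x a 0 * z a 0 + x b 0 * z b 0).
  by rewrite /lin_part -/y /psq !x'E !gE; ring.
have h : `|x a 0 * z a 0 + x b 0 * z b 0| <= fsq B / 2.
  rewrite -ler_sqr ?nnegrE ?divr_ge0// (real_normK (num_real _)).
  apply: (le_trans (psq_mul_le _ _ _ _)); rewrite -/(psq a b x) -/(psq a b z).
  have : S * psq a b z <= psq a b z by rewrite ler_piMl// psq_ge0.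
  by move: hz; lra.
have g0 := psq_ge0 a b g.
rewrite E (le_trans (ler_normD _ _))// normrM (ger0_norm g0) (ger0_norm (ler0n _ 2)).
by move: h hg; lra.
Qed.

Let eta_rem : `|S' - S - (lin_part + quad_part)| <= 4 * weight.
Proof.
have E : S' - S - (lin_part + quad_part) =
  (2 * (x a 0 * r a 0 + x b 0 * r b 0) +
   2 * (y a 0 * z a 0 + y b 0 * z b 0)) + psq a b z.
  by rewrite /lin_part /quad_part -/y /psq !x'E !gE !zE; field.
have h1 : `|x a 0 * r a 0 + x b 0 * r b 0| <= 1 * (weight / 2).
  apply: sq_weight => //; rewrite expr1n mul1r.
  apply: (le_trans (psq_mul_le _ _ _ _)); rewrite -/(psq a b x) -/(psq a b r).
  by apply: le_trans hr; rewrite ler_piMl// psq_ge0.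
have h2 : `|y a 0 * z a 0 + y b 0 * z b 0| <= 1 * (weight / 2).
  apply: sq_weight => //; rewrite expr1n mul1r.
  apply: (le_trans (psq_mul_le _ _ _ _)); rewrite -/(psq a b y) -/(psq a b z).
  have q : psq a b z <= fsq B ^+ 2.
    by apply: (le_trans hz); have := sqr_ge0 (fsq B); lra.
  by rewrite exprS ler_pM ?psq_ge0.
have h3 : psq a b z <= weight.
  apply: (le_trans hz); rewrite /weight.
  have e1 : fsq B ^+ 2 <= fsq B ^+ 2 / lam by rewrite ler_peMr ?sqr_ge0// invf_ge1.
  have e2 : 0 <= lam * fsq B by rewrite mulr_ge0// ltW.
  by have := sqr_ge0 (fsq B); lra.
have z0 := psq_ge0 a b z.
rewrite E (le_trans (ler_normD _ _))// (ger0_norm z0).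
have := ler_normD (2 * (x a 0 * r a 0 + x b 0 * r b 0)) (2 * (y a 0 * z a 0 + y b 0 * z b 0)).
rewrite !normrM (ger0_norm (ler0n _ 2)); lra.
Qed.

(** Each error in the proof below is at most [4 weight] times one of [C(p, 1)], [C(p, 2)],
    [C(p, 3)]. *)
Definition moment_rem p : R := 4 * (p%:R + 'C(p, 2)%:R + 'C(p, 3)%:R).

(** Taylor expansion of the power at [S]; then [S' - S] is replaced by [lin_part + quad_part] in the
    linear term and by [lin_part] in the quadratic one. Each replacement is of order [fsq B ^ (3/2)]
    at most. *)
Lemma cayley_moment p :
  `|S' ^+ p - (S ^+ p + p%:R * S ^+ p.-1 * (lin_part + quad_part) +
     'C(p, 2)%:R * S ^+ p.-2 * lin_part ^+ 2)| <= moment_rem p * weight.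
Proof.
have S'0 : 0 <= S' by exact: psq_ge0.
have xb : 0 <= S <= 1 by rewrite x0.
have x'b : 0 <= S' <= 1 by rewrite S'0.
have w2 : `|(S' - S) ^+ 2 - lin_part ^+ 2| <= 8 * (weight / 2).
  apply: sq_weight => //; rewrite subr_sqr exprMn.
  have h1 : (S' - S - lin_part) ^+ 2 <= 4 * fsq B ^+ 2.
    rewrite -(real_normK (num_real (_ - lin_part))).
    have := eta_lin; have := normr_ge0 (S' - S - lin_part).
    by move: `| _ | => n; nra.
  have h2 : (S' - S + lin_part) ^+ 2 <= 16 * fsq B.
    by have := sqr_ge0 (S' - S - lin_part); move: eta_sqr lin_sqr; lra.
  apply: le_trans (ler_pM (sqr_ge0 _) (sqr_ge0 _) h1 h2) _.
  by rewrite le_eqVlt; apply/orP; left; apply/eqP; ring.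
have w3 : `|S' - S| ^+ 3 <= 8 * (weight / 2).
  rewrite -normrX; apply: sq_weight => //; rewrite -exprM mulnC exprM.
  apply: (@le_trans _ _ ((4 * fsq B) ^+ 3)).
    by rewrite lerXn2r ?nnegrE ?sqr_ge0 ?mulr_ge0.
  by rewrite le_eqVlt; apply/orP; left; apply/eqP; ring.
have T := power_taylor2 p xb x'b; have w1 := eta_rem.
set e1 := S' - S - (lin_part + quad_part) in w1.
set e2 := (S' - S) ^+ 2 - lin_part ^+ 2 in w2.
set e3 := S' ^+ p - _ in T.
have -> : S' ^+ p - (S ^+ p + p%:R * S ^+ p.-1 * (lin_part + quad_part) +
     'C(p, 2)%:R * S ^+ p.-2 * lin_part ^+ 2) =
   p%:R * S ^+ p.-1 * e1 + 'C(p, 2)%:R * S ^+ p.-2 * e2 + e3.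
  by rewrite /e1 /e2 /e3; ring.
have b1 k n (e : R) : `|e| <= 4 * weight -> `|k%:R * S ^+ n * e| <= 4 * k%:R * weight.
  move=> he; rewrite !normrM normr_nat (ger0_norm (exprn_ge0 _ x0)).
  have -> : 4 * k%:R * weight = k%:R * 1 * (4 * weight) by ring.
  by rewrite ler_pM// ?mulr_ge0 ?exprn_ge0// ler_wpM2l// exprn_ile1.
have s1 := b1 p p.-1 _ w1.
have s2 : `|'C(p, 2)%:R * S ^+ p.-2 * e2| <= 4 * 'C(p, 2)%:R * weight.
  by apply: b1; move: w2; lra.
have s3 : `|e3| <= 4 * 'C(p, 3)%:R * weight.
  apply: (le_trans T); rewrite (mulrC 4) -mulrA ler_wpM2l//; move: w3; lra.
rewrite (le_trans (ler_normD _ _))// /moment_rem.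
have := ler_normD (p%:R * S ^+ p.-1 * e1) ('C(p, 2)%:R * S ^+ p.-2 * e2); lra.
Qed.

End CayleyMoment.

(** * Variances of bilinear forms in the increment *)

Section QuadraticForms.
Context {R : realType} {N : nat}.
Local Notation D := (N + N)%N.
Local Notation J := (@Jmx R N).
Implicit Types v y : 'I_D -> R.

Lemma sum4_factor (v y v' y' : 'I_D -> R) (P Q : 'I_D -> 'I_D -> R) :
  \sum_i \sum_c \sum_k \sum_l v i * y c * (v' k * y' l) * (P i k * Q c l) =
  (\sum_i \sum_k v i * P i k * v' k) * (\sum_c \sum_l y c * Q c l * y' l).
Proof.
rewrite mulr_suml; apply: eq_bigr => i _; rewrite exchange_big mulr_suml.
apply: eq_bigr => k _; rewrite mulr_sumr; apply: eq_bigr => c _.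
by rewrite mulr_sumr; apply: eq_bigr => l _; ring.
Qed.

Lemma sum4_cross (v y v' y' : 'I_D -> R) (P Q : 'I_D -> 'I_D -> R) :
  \sum_i \sum_c \sum_k \sum_l v i * y c * (v' k * y' l) * (P i l * Q c k) =
  (\sum_i \sum_l v i * P i l * y' l) * (\sum_c \sum_k y c * Q c k * v' k).
Proof.
rewrite -sum4_factor; apply: eq_bigr => i _; apply: eq_bigr => c _.
rewrite exchange_big; apply: eq_bigr => l _; apply: eq_bigr => k _; ring.
Qed.

Lemma sum_delta v y :
  \sum_i \sum_k v i * (i == k)%:R * y k = \sum_i v i * y i.
Proof.
apply: eq_bigr => i _; rewrite (bigD1 i)//= eqxx mulr1 big1 ?addr0// => k.
by rewrite eq_sym => /negbTE ->; rewrite mulr0 mul0r.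
Qed.

Lemma sumJ_anti v y :
  \sum_i \sum_k y i * J i k * v k = - \sum_i \sum_k v i * J i k * y k.
Proof.
rewrite exchange_big -sumrN; apply: eq_bigr => k _; rewrite -sumrN.
by apply: eq_bigr => i _; rewrite (JmxN k i); ring.
Qed.

(** The variance per unit time of [v^T dA y]. The product of [v^T J v] and [y^T J y] is absent
    because [J] is antisymmetric. *)
Definition form_var v y : R := (2 * N%:R)^-1 *
  ((\sum_i v i * v i) * (\sum_c y c * y c) - (\sum_i v i * y i) ^+ 2 +
   (\sum_i \sum_c v i * J i c * y c) ^+ 2).

Lemma sum_rcov v y :
  \sum_i \sum_c \sum_k \sum_l v i * y c * (v k * y l) * rcov i c k l = form_var v y.
Proof.
have E i c k l : v i * y c * (v k * y l) * rcov i c k l =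
  (2 * N%:R)^-1 * (v i * y c * (v k * y l) * ((i == k)%:R * (c == l)%:R) -
   v i * y c * (v k * y l) * ((i == l)%:R * (c == k)%:R) +
   v i * y c * (v k * y l) * (J i k * J c l) -
   v i * y c * (v k * y l) * (J i l * J c k)).
  by rewrite /rcov; ring.
under eq_bigr do under eq_bigr do under eq_bigr do under eq_bigr do rewrite E.
under eq_bigr do under eq_bigr do under eq_bigr do rewrite -mulr_sumr.
under eq_bigr do under eq_bigr do rewrite -mulr_sumr.
under eq_bigr do rewrite -mulr_sumr.
rewrite -mulr_sumr; congr (_ * _).
under eq_bigr do under eq_bigr do under eq_bigr do rewrite !big_split/= !sumrN.
under eq_bigr do under eq_bigr do rewrite !big_split/= !sumrN.
under eq_bigr do rewrite !big_split/= !sumrN.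
rewrite !big_split/= !sumrN sum4_factor sum4_cross sum4_factor sum4_cross.
rewrite !sum_delta (sumJ_anti v y).
have J0 : \sum_i \sum_k v i * J i k * v k = 0 by have := sumJ_anti v v; lra.
rewrite J0 (_ : \sum_i y i * v i = \sum_i v i * y i); first by ring.
by apply: eq_bigr => i _; rewrite mulrC.
Qed.

Variable j : 'I_N.
Local Notation a := (lshift N j).
Local Notation b := (rshift N j).
Variable x : 'cV[R]_D.
Hypothesis x1 : nsq x = 1.

Lemma Jmx_mull : (J *m x) a 0 = - x b 0.
Proof.
rewrite mxE big_split_ord/= big1 ?add0r => [|i _]; last first.
  by rewrite /Jmx /rmx block_mxEul !mxE mxcoord1 mul0r oppr0 mul0r.
rewrite (bigD1 j)//= big1 ?addr0 => [|i ij].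
  by rewrite /Jmx /rmx block_mxEur !mxE mxcoord1 eqxx mulr1 mulN1r.
rewrite /Jmx /rmx block_mxEur !mxE mxcoord1.
by rewrite eq_sym (negbTE ij) mulr0 oppr0 mul0r.
Qed.

Lemma Jmx_mulr : (J *m x) b 0 = x a 0.
Proof.
rewrite mxE big_split_ord/= [X in _ + X]big1 ?addr0 => [|i _]; last first.
  by rewrite /Jmx /rmx block_mxEdr !mxE mxcoord1 mul0r oppr0 mul0r.
rewrite (bigD1 j)//= big1 ?addr0 => [|i ij].
  by rewrite /Jmx /rmx block_mxEdl !mxE mxcoord1 eqxx mulr1 mul1r.
rewrite /Jmx /rmx block_mxEdl !mxE mxcoord1.
by rewrite eq_sym (negbTE ij) mulr0 mul0r.
Qed.

Lemma pair_neq : a != b. Proof. by rewrite eq_lrshift. Qed.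

Definition sel (i : 'I_D) : R := ((i == a) || (i == b))%:R.

Lemma sum_sel (f : 'I_D -> R) : \sum_i sel i * f i = f a + f b.
Proof.
rewrite (bigD1 a)//= (bigD1 b)/=; last by rewrite eq_sym pair_neq.
rewrite /sel !eqxx orbT !mul1r big1 ?addr0// => i /andP[/negbTE -> /negbTE ->].
by rewrite mul0r.
Qed.

Let sum1 (i : 'I_D) (f : 'I_D -> R) : \sum_k (k == i)%:R * f k = f i.
Proof.
rewrite (bigD1 i)//= eqxx mul1r big1 ?addr0// => k /negbTE ->.
by rewrite mul0r.
Qed.

Let nsqx : \sum_c x c 0 * x c 0 = 1.
Proof. by rewrite -x1; apply: eq_bigr => i _; rewrite expr2. Qed.

Lemma form_var_delta i :
  form_var (fun k => (k == i)%:R) (fun c => x c 0) =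
  (2 * N%:R)^-1 * (1 - x i 0 ^+ 2 + (J *m x) i 0 ^+ 2).
Proof.
rewrite /form_var sum1 eqxx mul1r nsqx sum1.
under eq_bigr do under eq_bigr do rewrite -mulrA.
under eq_bigr do rewrite -mulr_sumr.
by rewrite sum1 [in RHS]mxE.
Qed.

(** [J] exchanges the two coordinates up to sign, so [x_a^2] and [x_b^2] cancel between the two
    variances. *)
Lemma form_var_pair : (0 < N)%N ->
  form_var (fun k => (k == a)%:R) (fun c => x c 0) +
  form_var (fun k => (k == b)%:R) (fun c => x c 0) = N%:R^-1.
Proof.
move=> N0; rewrite !form_var_delta Jmx_mull Jmx_mulr.
have N1 : (N%:R : R) != 0 by rewrite pnatr_eq0 -lt0n.
by field.
Qed.

(** [v] is the projection of [x] on the complex coordinate [j]: both [|v|^2] and [v^T x] equal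
    [psq a b x], and [v^T J x = 0]. *)
Lemma form_var_sel :
  form_var (fun k => sel k * x k 0) (fun c => x c 0) =
  (2 * N%:R)^-1 * (psq a b x - psq a b x ^+ 2).
Proof.
rewrite /form_var nsqx mulr1.
have e (f : 'I_D -> R) : \sum_k sel k * x k 0 * f k = x a 0 * f a + x b 0 * f b.
  by under eq_bigr do rewrite -mulrA; rewrite sum_sel.
rewrite !e /sel !eqxx orbT !mul1r.
have -> : \sum_i \sum_c sel i * x i 0 * J i c * x c 0 =
    x a 0 * (J *m x) a 0 + x b 0 * (J *m x) b 0.
  rewrite -(e (fun i => (J *m x) i 0)); apply: eq_bigr => i _; rewrite [X in _ = _ * X]mxE mulr_sumr.
  by apply: eq_bigr => c _; rewrite mulrA.
by rewrite Jmx_mull Jmx_mulr /psq; congr (_ * _); ring.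
Qed.

End QuadraticForms.

(** The left-hand side is the generator [(1/N - y) f' + (1/N) (y - y^2) f''] applied to [f = y^p].
    The case [p = 1] is apart because [p.-2] is truncated there. *)
Lemma moment_drift (R : realType) (N p : nat) (y : R) : (0 < N)%N -> (0 < p)%N ->
  p%:R * y ^+ p.-1 * (N%:R^-1 - y) +
  2 / N%:R * ('C(p, 2)%:R * y ^+ p.-2 * (y - y ^+ 2)) =
  - Lambda N p * y ^+ p + p%:R ^+ 2 / N%:R * y ^+ p.-1.
Proof.
move=> N0; have N1 : (N%:R : R) != 0 by rewrite pnatr_eq0 -lt0n.
case: p => [//|[|p]] _; rewrite /Lambda.
  by rewrite bin_small//= !expr0 expr1; field.
have c : 2 * 'C(p.+2, 2)%:R = p.+2%:R * (p.+2%:R - 1) :> R.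
  rewrite -natrM -(mul_bin_diag p.+2 1) bin1 natrM; congr (_ * _).
  by rewrite /= -[X in _ = X - 1]natr1 addrK.
have -> : 2 / N%:R * ('C(p.+2, 2)%:R * y ^+ p.+2.-2 * (y - y ^+ 2)) =
    (2 * 'C(p.+2, 2)%:R) / N%:R * (y ^+ p * (y - y ^+ 2)) by rewrite /=; ring.
by rewrite c /= !exprS; field.
Qed.

(** * Expectation of one Cayley step *)

Section OneStep.
Context {d : measure_display} {T : measurableType d} {R : realType} {N : nat}.
Hypothesis N0 : (0 < N)%N.
Variable P : probability T R.
Variable F : R -> set (set T).
Hypothesis hF : is_filtration F.
Variable H : R -> T -> 'M[R[i]]_N.
Hypothesis hH : hermitian_BM_wrt P F H.
Variables s t : R.
Hypothesis s0 : 0 <= s.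
Hypothesis st : s <= t.

Local Notation D := (N + N)%N.
Local Notation A := (fun t w => rmx (H t w)).

Definition past_bounded (X : T -> R) : Prop :=
  mes_wrt (F s) X /\ exists c, forall w, `|X w| <= c.

Lemma past_boundedM X Y : past_bounded X -> past_bounded Y ->
  past_bounded (fun w => X w * Y w).
Proof.
move=> [mX [c Xc]] [mY [c' Yc]]; split; first exact: measurable_funM.
by exists (c * c') => w; rewrite normrM ler_pM.
Qed.

Lemma past_bounded_cst c : past_bounded (fun=> c).
Proof. by split; [exact: measurable_cst|exists `|c|]. Qed.

Lemma past_boundedX X n : past_bounded X -> past_bounded (fun w => X w ^+ n).
Proof.
move=> pX; elim: n => [|n IH].
  by under eq_fun do rewrite expr0; exact: past_bounded_cst.
by under eq_fun do rewrite exprS; exact: past_boundedM.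
Qed.

Lemma past_boundedD X Y : past_bounded X -> past_bounded Y ->
  past_bounded (fun w => X w + Y w).
Proof.
move=> [mX [c Xc]] [mY [c' Yc]]; split; first exact: measurable_funD.
by exists (c + c') => w; rewrite (le_trans (ler_normD _ _))// lerD.
Qed.

Lemma past_bounded_L1 X : past_bounded X -> L1 P X.
Proof.
by move=> [mX [c Xc]]; apply: L1_bounded Xc; exact: (mes_filtration hF s0 mX).
Qed.

Let bmH : hermitian_BM P H. Proof. by case: hH. Qed.
Let G := sigma_mx (hinc H s t).
Let B w := rmx (hinc H s t w).
Let gB i c : mes_wrt G (fun w => B w i c).
Proof. exact: rmx_hinc_adapted. Qed.
Let L2B i c : L2 P (fun w => B w i c).
Proof. by case: (rmx_hinc_moments N0 bmH s0 st i c). Qed.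
Let EB i c : Ex P (fun w => B w i c) = 0.
Proof. by case: (rmx_hinc_moments N0 bmH s0 st i c). Qed.

Lemma Ex_past_mul X Y : past_bounded X -> mes_wrt G Y -> L1 P Y ->
  L1 P (fun w => X w * Y w) /\ Ex P (fun w => X w * Y w) = Ex P X * Ex P Y.
Proof.
move=> pX gY lY; have [mX _] := pX.
exact: (Ex_past_increment hF hH s0 st mX gY (past_bounded_L1 pX) lY).
Qed.

Lemma Ex_past_form (g : T -> R) (v y : 'I_D -> T -> R) :
  past_bounded g -> (forall i, past_bounded (v i)) -> (forall i, past_bounded (y i)) ->
  L1 P (fun w => g w * \sum_i \sum_c v i w * B w i c * y c w) /\
  Ex P (fun w => g w * \sum_i \sum_c v i w * B w i c * y c w) = 0.
Proof.
move=> pg pv py.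
have E w : g w * \sum_i \sum_c v i w * B w i c * y c w =
    \sum_i \sum_c g w * (v i w * y c w) * B w i c.
  rewrite mulr_sumr; apply: eq_bigr => i _; rewrite mulr_sumr.
  by apply: eq_bigr => c _; ring.
have h i c := Ex_past_mul (past_boundedM pg (past_boundedM (pv i) (py c)))
  (gB i c) (L2_L1 (L2B i c)).
under eq_fun do rewrite E; split.
  by apply: L1_sum => i _; apply: L1_sum => c _; case: (h i c).
rewrite Ex_sum => [|i _]; last by apply: L1_sum => c _; case: (h i c).
rewrite big1// => i _; rewrite Ex_sum => [|c _]; last by case: (h i c).
by rewrite big1// => c _; have [_ ->] := h i c; rewrite EB mulr0.
Qed.

(** Expanding over four indices isolates products of two entries of [B], which are independent of
    the past; [sum_rcov] then resums their covariances. *)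
Lemma Ex_past_form_sqr (g : T -> R) (v y : 'I_D -> T -> R) :
  past_bounded g -> (forall i, past_bounded (v i)) -> (forall i, past_bounded (y i)) ->
  L1 P (fun w => g w * (\sum_i \sum_c v i w * B w i c * y c w) ^+ 2) /\
  Ex P (fun w => g w * (\sum_i \sum_c v i w * B w i c * y c w) ^+ 2) =
  (t - s) * Ex P (fun w => g w * form_var (v ^~ w) (y ^~ w)).
Proof.
move=> pg pv py.
pose f i c k l w := g w * (v i w * y c w * (v k w * y l w)).
have pf i c k l : past_bounded (f i c k l).
  by apply: (past_boundedM pg); apply: past_boundedM; exact: past_boundedM.
have E w : g w * (\sum_i \sum_c v i w * B w i c * y c w) ^+ 2 =
    \sum_i \sum_c \sum_k \sum_l f i c k l w * (B w i c * B w k l).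
  rewrite expr2 mulr_suml mulr_sumr; apply: eq_bigr => i _.
  rewrite mulr_suml mulr_sumr; apply: eq_bigr => c _.
  rewrite mulr_sumr mulr_sumr; apply: eq_bigr => k _.
  rewrite mulr_sumr mulr_sumr; apply: eq_bigr => l _; rewrite /f; ring.
have h i c k l : L1 P (fun w => f i c k l w * (B w i c * B w k l)) /\
    Ex P (fun w => f i c k l w * (B w i c * B w k l)) =
    (t - s) * Ex P (fun w => f i c k l w * rcov i c k l).
  have gBB : mes_wrt G (fun w => B w i c * B w k l) by apply: measurable_funM; exact: gB.
  have [l1 ->] := Ex_past_mul (pf i c k l) gBB (L2M (L2B i c) (L2B k l)).
  split=> //; rewrite (rmx_hinc_cov N0 bmH s0 st).
  rewrite mulrCA; congr (_ * _); rewrite mulrC -ExZ; last exact: past_bounded_L1.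
  by apply: eq_Ex => w; rewrite mulrC.
under eq_fun do rewrite E; split.
  by do 4 (apply: L1_sum => ? _); exact: (h _ _ _ _).1.
have V w : g w * form_var (v ^~ w) (y ^~ w) =
    \sum_i \sum_c \sum_k \sum_l f i c k l w * rcov i c k l.
  rewrite -sum_rcov mulr_sumr; apply: eq_bigr => i _.
  rewrite mulr_sumr; apply: eq_bigr => c _.
  rewrite mulr_sumr; apply: eq_bigr => k _.
  by rewrite mulr_sumr; apply: eq_bigr => l _; rewrite /f; ring.
under [in RHS]eq_Ex do rewrite V.
have lr i c k l : L1 P (fun w => f i c k l w * rcov i c k l).
  by apply/past_bounded_L1/past_boundedM => //; exact: past_bounded_cst.
rewrite Ex_sum; last by move=> *; do 3 (apply: L1_sum => ? _); exact: (h _ _ _ _).1.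
rewrite Ex_sum; last by move=> *; do 3 (apply: L1_sum => ? _); exact: lr.
rewrite mulr_sumr; apply: eq_bigr => i _.
rewrite Ex_sum; last by move=> *; do 2 (apply: L1_sum => ? _); exact: (h _ _ _ _).1.
rewrite Ex_sum; last by move=> *; do 2 (apply: L1_sum => ? _); exact: lr.
rewrite mulr_sumr; apply: eq_bigr => c _.
rewrite Ex_sum; last by move=> *; apply: L1_sum => ? _; exact: (h _ _ _ _).1.
rewrite Ex_sum; last by move=> *; apply: L1_sum => ? _; exact: lr.
rewrite mulr_sumr; apply: eq_bigr => k _.
rewrite Ex_sum; last by move=> *; exact: (h _ _ _ _).1.
rewrite Ex_sum; last by move=> *; exact: lr.
by rewrite mulr_sumr; apply: eq_bigr => l _; case: (h i c k l).
Qed.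

Variable x : T -> 'cV[R]_D.
Hypothesis mx : mx_adapted (F s) x.
Hypothesis x1 : forall w, nsq (x w) = 1.
Variable j : 'I_N.
Local Notation a := (lshift N j).
Local Notation b := (rshift N j).
Local Notation S w := (psq a b (x w)).

Let px i : past_bounded (fun w => x w i 0).
Proof.
split; first exact: mx.
exists 1 => w; rewrite -ler_sqr ?nnegrE// expr1n (real_normK (num_real _)).
by rewrite -(x1 w); exact: sqr_le_nsq.
Qed.

Let pS : past_bounded (fun w => S w).
Proof. by apply: past_boundedD; apply: past_boundedX; exact: px. Qed.

Lemma Ex_lin_part g : past_bounded g ->
  L1 P (fun w => g w * lin_part a b (B w) (x w)) /\
  Ex P (fun w => g w * lin_part a b (B w) (x w)) = 0.
Proof.
move=> pg.
have E w : g w * lin_part a b (B w) (x w) =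
    g w * 2 * \sum_i \sum_c sel j i * x w i 0 * B w i c * x w c 0.
  rewrite /lin_part -(sum_sel j (fun i => x w i 0 * (B w *m x w) i 0)) mulrA; congr (_ * _).
  apply: eq_bigr => i _; rewrite [X in _ * (_ * X) = _]mxE !mulr_sumr.
  by apply: eq_bigr => c _; ring.
under eq_fun do rewrite E.
apply: (@Ex_past_form _ (fun i w => sel j i * x w i 0) (fun c w => x w c 0)) => //.
  by apply: past_boundedM => //; exact: past_bounded_cst.
by move=> i; apply: past_boundedM => //; exact: past_bounded_cst.
Qed.

(** [lin_part] is twice a bilinear form with variance given by [form_var_sel], and
    [4 / (2 N) = 2 / N]. *)
Lemma Ex_lin_part_sqr g : past_bounded g ->
  L1 P (fun w => g w * lin_part a b (B w) (x w) ^+ 2) /\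
  Ex P (fun w => g w * lin_part a b (B w) (x w) ^+ 2) =
  (t - s) * (2 / N%:R) * Ex P (fun w => g w * (S w - S w ^+ 2)).
Proof.
move=> pg.
have E w : g w * lin_part a b (B w) (x w) ^+ 2 =
    g w * 4 * (\sum_i \sum_c sel j i * x w i 0 * B w i c * x w c 0) ^+ 2.
  rewrite /lin_part -(sum_sel j (fun i => x w i 0 * (B w *m x w) i 0)) exprMn mulrA.
  have -> : (2 : R) ^+ 2 = 4 by ring.
  congr (_ * _ ^+ 2).
  apply: eq_bigr => i _; rewrite [X in _ * (_ * X) = _]mxE !mulr_sumr.
  by apply: eq_bigr => c _; ring.
under eq_fun do rewrite E.
have pg4 : past_bounded (fun w => g w * 4).
  by apply: past_boundedM => //; exact: past_bounded_cst.
have [||l ->] := @Ex_past_form_sqr (fun w => g w * 4) (fun i w => sel j i * x w i 0) (fun c w => x w c 0) pg4.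
- by move=> i; apply: past_boundedM => //; exact: past_bounded_cst.
- exact: px.
split=> //; rewrite -[RHS]mulrA; congr (_ * _).
rewrite -ExZ; last first.
  apply: past_bounded_L1; apply: past_boundedM => //; apply: past_boundedD => //.
  under eq_fun do rewrite -mulN1r; apply: past_boundedM; first exact: past_bounded_cst.
  exact: past_boundedX.
apply: eq_Ex => w; rewrite (form_var_sel j (x1 w)).
have N1 : (N%:R : R) != 0 by rewrite pnatr_eq0 -lt0n.
by field.
Qed.

(** The square of [B x] contributes [1/N] by [form_var_pair], and the terms in [B^2 x] contribute
    [- S] because [E B^2 = - (t - s)]. *)
Lemma Ex_quad_part g : past_bounded g ->
  L1 P (fun w => g w * quad_part a b (B w) (x w)) /\
  Ex P (fun w => g w * quad_part a b (B w) (x w)) =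
  (t - s) * Ex P (fun w => g w * (N%:R^-1 - S w)).
Proof.
move=> pg.
pose f k w := \sum_i \sum_c (i == k)%:R * B w i c * x w c 0.
have fE k w : f k w = (B w *m x w) k 0.
  rewrite /f (bigD1 k)//= [X in _ + X]big1 ?addr0 => [|i /negbTE ik].
    by rewrite mxE; apply: eq_bigr => c _; rewrite eqxx mul1r.
  by rewrite big1// => c _; rewrite ik !mul0r.
pose q k c w := g w * (x w k 0 * x w c 0) * (B w *m B w) k c.
have qE w k : g w * (x w k 0 * (B w *m B w *m x w) k 0) = \sum_c q k c w.
  rewrite [X in _ * (_ * X)]mxE !mulr_sumr; apply: eq_bigr => c _.
  by rewrite /q; ring.
have E w : g w * quad_part a b (B w) (x w) =
  (g w * f a w ^+ 2 + g w * f b w ^+ 2) + (\sum_c q a c w + \sum_c q b c w).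
  by rewrite -!qE !fE /quad_part /psq; ring.
have hf k : L1 P (fun w => g w * f k w ^+ 2) /\ Ex P (fun w => g w * f k w ^+ 2) =
    (t - s) * Ex P (fun w => g w * form_var (fun i => (i == k)%:R) (fun c => x w c 0)).
  apply: (@Ex_past_form_sqr g (fun i _ => (i == k)%:R) (fun c w => x w c 0)) => //.
  by move=> i; exact: past_bounded_cst.
have hq k c : L1 P (q k c) /\
    Ex P (q k c) = - (t - s) * (k == c)%:R * Ex P (fun w => g w * (x w k 0 * x w c 0)).
  have gBB : mes_wrt G (fun w => (B w *m B w) k c).
    by apply: mx_measurableM; exact: rmx_hinc_adapted.
  have lBB : L1 P (fun w => (B w *m B w) k c).
    under eq_fun do rewrite mxE.
    by apply: L1_sum => l _; exact: L2M.
  have [l ->] := Ex_past_mul (past_boundedM pg (past_boundedM (px k) (px c))) gBB lBB.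
  by split=> //; rewrite (rmx_hinc_sqr_Ex N0 hH s0 st) mulrC.
have hqs k : L1 P (fun w => \sum_c q k c w) /\
    Ex P (fun w => \sum_c q k c w) = - (t - s) * Ex P (fun w => g w * x w k 0 ^+ 2).
  split; first by apply: L1_sum => c _; case: (hq k c).
  rewrite Ex_sum => [|c _]; last by case: (hq k c).
  rewrite (bigD1 k)//= big1 ?addr0 => [|c ck].
    by have [_ ->] := hq k k; rewrite eqxx mulr1.
  by have [_ ->] := hq k c; rewrite eq_sym (negbTE ck) mulr0 mul0r.
have pV k c : past_bounded (fun w => g w * ((2 * N%:R)^-1 * (1 - x w k 0 ^+ 2 + x w c 0 ^+ 2))).
  apply: past_boundedM => //; apply: past_boundedM; first exact: past_bounded_cst.
  apply: past_boundedD; last exact: past_boundedX.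
  apply: past_boundedD; first exact: past_bounded_cst.
  under eq_fun do rewrite -mulN1r; apply: past_boundedM; first exact: past_bounded_cst.
  exact: past_boundedX.
have lV k : k = a \/ k = b ->
    L1 P (fun w => g w * form_var (fun i => (i == k)%:R) (fun c => x w c 0)).
  move=> [] ->; apply: past_bounded_L1.
    rewrite (_ : (fun w => _) = (fun w => g w * ((2 * N%:R)^-1 * (1 - x w a 0 ^+ 2 + x w b 0 ^+ 2)))).
      exact: pV.
    by apply/funext => w; rewrite (form_var_delta (x1 w)) Jmx_mull sqrrN.
  rewrite (_ : (fun w => _) = (fun w => g w * ((2 * N%:R)^-1 * (1 - x w b 0 ^+ 2 + x w a 0 ^+ 2)))).
    exact: pV.
  by apply/funext => w; rewrite (form_var_delta (x1 w)) Jmx_mulr.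
have lx k : L1 P (fun w => g w * x w k 0 ^+ 2).
  by apply/past_bounded_L1/past_boundedM => //; exact: past_boundedX.
have lV2 : L1 P (fun w => g w * form_var (fun i => (i == a)%:R) (fun c => x w c 0) +
   g w * form_var (fun i => (i == b)%:R) (fun c => x w c 0)).
  by apply: L1D; apply: lV; [left|right].
have -> : Ex P (fun w => g w * (N%:R^-1 - S w)) =
  (Ex P (fun w => g w * form_var (fun i => (i == a)%:R) (fun c => x w c 0)) +
   Ex P (fun w => g w * form_var (fun i => (i == b)%:R) (fun c => x w c 0))) -
  (Ex P (fun w => g w * x w a 0 ^+ 2) + Ex P (fun w => g w * x w b 0 ^+ 2)).
  rewrite -ExD; [|by apply: lV; left|by apply: lV; right].
  rewrite -ExD; [|exact: lx|exact: lx].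
  rewrite -ExB; [|exact: lV2|by apply: L1D; exact: lx].
  by apply: eq_Ex => w; rewrite -(form_var_pair j (x1 w) N0) /psq; ring.
have l1 : L1 P (fun w => g w * f a w ^+ 2 + g w * f b w ^+ 2).
  by apply: L1D; [case: (hf a)|case: (hf b)].
have l2 : L1 P (fun w => \sum_c q a c w + \sum_c q b c w).
  by apply: L1D; [case: (hqs a)|case: (hqs b)].
under eq_fun do rewrite E; split; first exact: L1D.
rewrite ExD// ExD; [|by case: (hf a)|by case: (hf b)].
rewrite ExD; [|by case: (hqs a)|by case: (hqs b)].
have [_ ->] := hf a; have [_ ->] := hf b.
by have [_ ->] := hqs a; have [_ ->] := hqs b; ring.
Qed.

Let driver := hermitian_antisym_driver N0 hF hH.
Let incE w : inc A s t w = B w. Proof. by rewrite /inc /B /hinc rmxB. Qed.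
Let aB w : (B w)^T = - B w.
Proof. by rewrite -incE; apply: (inc_anti driver) => //; exact: le_trans st. Qed.

(** [D^2 K] bounds [E fsq] per unit time and, since [D >= 1], also dominates the constant [K] of
    [E fsq^2]. *)
Let weight_cst : R := D%:R ^+ 2 * @driver_cst R N.
Let L1_fsq : L1 P (fun w => fsq (B w)).
Proof. by have := L1_fsq_inc driver s0 st; under eq_fun do rewrite incE. Qed.
Let L1_fsq2 : L1 P (fun w => fsq (B w) ^+ 2).
Proof. by have := (drv_four driver s0 st).1; under eq_fun do rewrite incE. Qed.

Let L1_weight lam : L1 P (fun w => weight (B w) lam).
Proof.
rewrite /weight; apply: L1D; first exact: L1Z.
by under eq_fun do rewrite mulrC; exact: L1Z.
Qed.

Let Ex_weight lam : 0 < lam ->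
  Ex P (fun w => weight (B w) lam) <= weight_cst * (lam * (t - s) + (t - s) ^+ 2 / lam).
Proof.
move=> lam0; rewrite /weight ExD; last 2 first.
- exact: L1Z.
- by under eq_fun do rewrite mulrC; exact: L1Z.
rewrite ExZ//; under [X in _ + Ex _ X]eq_fun do rewrite mulrC; rewrite ExZ//.
have h1 : Ex P (fun w => fsq (B w)) <= weight_cst * (t - s).
  by have := Ex_fsq_inc driver s0 st; under eq_fun do rewrite incE.
have h2 : Ex P (fun w => fsq (B w) ^+ 2) <= weight_cst * (t - s) ^+ 2.
  have := (drv_four driver s0 st).2; under eq_fun do rewrite incE.
  move/le_trans; apply; rewrite ler_wpM2r ?sqr_ge0// /weight_cst ler_peMl ?(drv_K driver)//.
  by rewrite exprn_ege1// ler1n addn_gt0 N0.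
have -> : weight_cst * (lam * (t - s) + (t - s) ^+ 2 / lam) =
    lam * (weight_cst * (t - s)) + lam^-1 * (weight_cst * (t - s) ^+ 2) by ring.
by apply: lerD; apply: ler_wpM2l; rewrite ?invr_ge0 ?(ltW lam0).
Qed.

(** With [t - s <= lam^2] the error is of order [lam (t - s)], so a small [lam] makes it negligible
    against the step. *)
Lemma Ex_cayley_moment p lam : (0 < p)%N -> 0 < lam -> lam <= 1 ->
  `|Ex P (fun w => psq a b (cayley (B w) *m x w) ^+ p) -
    ((1 - Lambda N p * (t - s)) * Ex P (fun w => S w ^+ p) +
     p%:R ^+ 2 / N%:R * (t - s) * Ex P (fun w => S w ^+ p.-1))| <=
  moment_rem p * (weight_cst * (lam * (t - s) + (t - s) ^+ 2 / lam)).
Proof.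
move=> p0 lam0 lam1.
have ab := pair_neq j.
pose S' w := psq a b (cayley (B w) *m x w).
pose M w := S w ^+ p + p%:R * S w ^+ p.-1 * (lin_part a b (B w) (x w) + quad_part a b (B w) (x w)) +
     'C(p, 2)%:R * S w ^+ p.-2 * lin_part a b (B w) (x w) ^+ 2.
pose g1 w : R := p%:R * S w ^+ p.-1.
pose g2 w : R := 'C(p, 2)%:R * S w ^+ p.-2.
have pg1 : past_bounded g1 by apply: past_boundedM; [exact: past_bounded_cst|exact: past_boundedX].
have pg2 : past_bounded g2 by apply: past_boundedM; [exact: past_bounded_cst|exact: past_boundedX].
have [l1 e1] := Ex_lin_part pg1; have [l2 e2] := Ex_quad_part pg1.
have [l3 e3] := Ex_lin_part_sqr pg2.
have lS n : L1 P (fun w => S w ^+ n) by apply/past_bounded_L1/past_boundedX.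
have ME w : M w = S w ^+ p + (g1 w * lin_part a b (B w) (x w) +
    g1 w * quad_part a b (B w) (x w)) + g2 w * lin_part a b (B w) (x w) ^+ 2.
  by rewrite /M -mulrDr.
have lM : L1 P M.
  rewrite (funext ME).
  by apply: L1D l3; apply: L1D => //; exact: L1D.
have nx' w : nsq (cayley (B w) *m x w) = 1.
  by rewrite nsq_orthogonal// cayley_orthogonal.
have mB : mx_measurable B by move=> i c; case: (L2B i c).
have mx' : mx_measurable x by move=> i c; exact: (mes_filtration hF s0 (mx i c)).
have mS' : measurable_fun setT S'.
  have m : mx_measurable (fun w => cayley (B w) *m x w).
    by apply: mx_measurableM => //; exact: mx_measurable_cayley.
  by apply: measurable_funD; apply: measurable_funX; exact: m.
have lS' : L1 P (fun w => S' w ^+ p).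
  apply: (@L1_bounded _ _ _ _ _ 1); first exact: measurable_funX.
  move=> w; rewrite normrX exprn_ile1// ger0_norm ?psq_ge0//.
  by rewrite -(nx' w); exact: psq_le_nsq.
have EM : Ex P M = (1 - Lambda N p * (t - s)) * Ex P (fun w => S w ^+ p) +
     p%:R ^+ 2 / N%:R * (t - s) * Ex P (fun w => S w ^+ p.-1).
  rewrite (funext ME).
  rewrite ExD; [|by apply: L1D => //; exact: L1D|by []].
  rewrite ExD//; last exact: L1D.
  rewrite ExD// e1 add0r e2 e3.
  have lg1 : L1 P (fun w => g1 w * (N%:R^-1 - S w)).
    apply: past_bounded_L1; apply: past_boundedM => //; apply: past_boundedD.
      exact: past_bounded_cst.
    under eq_fun do rewrite -mulN1r; apply: past_boundedM => //; exact: past_bounded_cst.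
  have lg2 : L1 P (fun w => g2 w * (S w - S w ^+ 2)).
    apply: past_bounded_L1; apply: past_boundedM => //; apply: past_boundedD => //.
    under eq_fun do rewrite -mulN1r; apply: past_boundedM; first exact: past_bounded_cst.
    exact: past_boundedX.
  have D : Ex P (fun w => g1 w * (N%:R^-1 - S w)) + 2 / N%:R * Ex P (fun w => g2 w * (S w - S w ^+ 2)) =
      - Lambda N p * Ex P (fun w => S w ^+ p) + p%:R ^+ 2 / N%:R * Ex P (fun w => S w ^+ p.-1).
    rewrite -!ExZ// -!ExD//; try exact: L1Z.
    by apply: eq_Ex => w; rewrite moment_drift.
  have -> : forall u v z : R, z + (t - s) * u + (t - s) * (2 / N%:R) * v =
      z + (t - s) * (u + 2 / N%:R * v) by move=> *; ring.
  by rewrite D; ring.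
rewrite -EM -ExB//.
apply: le_trans (le_norm_Ex (L1B lS' lM)) _.
apply: (@le_trans _ _ (Ex P (fun w => moment_rem p * weight (B w) lam))).
  apply: le_Ex; [exact/L1_norm/L1B|exact: L1Z|move=> w].
  exact: cayley_moment.
rewrite ExZ//; apply: ler_wpM2l; last exact: Ex_weight.
by rewrite /moment_rem mulr_ge0// !addr_ge0.
Qed.

End OneStep.

(** * The system of differential equations *)

Section MomentSystem.
Context {R : realType}.
Variable N : nat.
Hypothesis N0 : (0 < N)%N.
Variable a : nat -> R.

Let N1 : (N%:R : R) != 0. Proof. by rewrite pnatr_eq0 -lt0n. Qed.

Lemma Lambda_ge0 n : 0 <= Lambda N n :> R.
Proof.
rewrite /Lambda; case: n => [|n]; first by rewrite !mul0r addr0.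
by rewrite addr_ge0// divr_ge0// mulr_ge0// -(natr1 n) addrK.
Qed.

Lemma Lambda0 : Lambda N 0 = 0 :> R.
Proof. by rewrite /Lambda !mul0r addr0. Qed.

Definition moment_coef p n : R := p`!%:R *
  ('C(p, p - n)%:R * (a n / pochhammer (N%:R + 2 * n%:R) (p - n))).

Definition moment_sol p (s : R) : R :=
  \sum_(n < p.+1) moment_coef p n * expR (- Lambda N n * s).

Lemma pochhammer_gt0 (x : R) n : 0 < x -> 0 < pochhammer x n.
Proof. by move=> x0; apply: prodr_gt0 => k _; rewrite ltr_wpDr. Qed.

(** [Lambda_(p+1) - Lambda_n = (p + 1 - n) (N + n + p) / N]: the second factor is the one that the
    Pochhammer symbol gains from [p] to [p + 1], and the first is absorbed by the binomial
    coefficient. *)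
Lemma moment_coef_rec p n : (n <= p)%N ->
  (Lambda N p.+1 - Lambda N n) * moment_coef p.+1 n =
  p.+1%:R ^+ 2 / N%:R * moment_coef p n.
Proof.
move=> np; rewrite /moment_coef (subSn np) /pochhammer big_ord_recr/=.
rewrite -/(pochhammer _ _) -(subSn np) bin_sub ?leqW// bin_sub//.
set w := pochhammer _ _; set x : R := N%:R + 2 * n%:R.
have x0 : 0 < x by rewrite ltr_wpDr ?ltr0n// mulr_ge0.
have w0 : w != 0 by rewrite gt_eqF// pochhammer_gt0.
have E : (p - n)%:R = p%:R - n%:R :> R by rewrite natrB.
have y0 : x + (p - n)%:R != 0 by rewrite gt_eqF// ltr_wpDr.
have B : (p%:R + 1 - n%:R) * 'C(p.+1, n)%:R = (p%:R + 1) * 'C(p, n)%:R :> R.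
  have := mul_bin_down p.+1 n; rewrite /= => /(congr1 (fun k => k%:R : R)).
  by rewrite !natrM natrB ?leqW// -natr1 => <-; ring.
rewrite factS natrM -[p.+1%:R]natr1.
have L : Lambda N p.+1 - Lambda N n =
    (p%:R + 1 - n%:R) * (x + (p - n)%:R) / N%:R :> R.
  by rewrite /Lambda E /x -[p.+1%:R]natr1; field.
rewrite L; set y := x + (p - n)%:R in y0 *.
have -> : (p%:R + 1 - n%:R) * y / N%:R *
   ((p%:R + 1) * p`!%:R * ('C(p.+1, n)%:R * (a n / (w * y)))) =
   (p%:R + 1) * p`!%:R * a n / N%:R / w * ((p%:R + 1 - n%:R) * 'C(p.+1, n)%:R) by field; rewrite ?N1 ?y0 ?w0.
by rewrite B; field; rewrite ?N1 ?w0.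
Qed.

(** The top index [n = p + 1] drops out of the difference, as its eigenvalue is [Lambda_(p+1)]
    itself; the rest is [moment_coef_rec]. *)
Lemma moment_sum_rec p (e : nat -> R) :
  \sum_(n < p.+2) moment_coef p.+1 n * Lambda N n * e n =
  Lambda N p.+1 * (\sum_(n < p.+2) moment_coef p.+1 n * e n) -
  p.+1%:R ^+ 2 / N%:R * \sum_(n < p.+1) moment_coef p n * e n.
Proof.
rewrite big_ord_recr [in RHS]big_ord_recr/= (mulrDr (Lambda N p.+1)) !mulr_sumr.
rewrite addrAC -sumrB; congr (_ + _); last by ring.
apply: eq_bigr => n _; have := moment_coef_rec (ltn_ord n : (n <= p)%N).
move=> h.
by rewrite [X in _ - X]mulrA -h; ring.
Qed.

(** The exponential at the earlier time, at most 1, is factored out; what remains is an inequality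
    in [x = l |s - t|] that follows from [1 + x <= expR x] and [1 - x <= expR (- x)]. *)
Lemma expR_quad (l s t : R) : 0 <= l -> 0 <= s -> 0 <= t ->
  `|expR (- l * s) - expR (- l * t) + l * (s - t) * expR (- l * t)| <=
  l ^+ 2 * (s - t) ^+ 2.
Proof.
move=> l0 s0 t0.
have e1 (x y : R) : 0 <= x -> 0 <= y -> expR (- x * y) <= 1.
  by move=> x0 y0; rewrite -expR0 ler_expR mulNr oppr_le0 mulr_ge0.
have [st|ts] := leP s t.
  have x0 : 0 <= l * (t - s) by rewrite mulr_ge0 ?subr_ge0.
  have -> : expR (- l * t) = expR (- l * s) * expR (- (l * (t - s))).
    by rewrite -expRD; congr expR; ring.
  have E0 := expR_ge0 (- l * s); have E1 := e1 l s l0 s0.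
  have F1 := e1 1 _ ler01 x0; have F2 := expR_ge1Dx (- (l * (t - s))).
  have F3 := expR_ge1Dx (l * (t - s)).
  rewrite mulN1r in F1.
  have FF : expR (l * (t - s)) * expR (- (l * (t - s))) = 1.
    by rewrite -expRD subrr expR0.
  have F0 := expR_ge0 (- (l * (t - s))).
  have -> : l ^+ 2 * (s - t) ^+ 2 = (l * (t - s)) ^+ 2 by ring.
  have -> : expR (- l * s) - expR (- l * s) * expR (- (l * (t - s))) +
     l * (s - t) * (expR (- l * s) * expR (- (l * (t - s)))) =
     expR (- l * s) * (1 - expR (- (l * (t - s))) * (1 + l * (t - s))) by ring.
  move: (l * (t - s)) x0 F1 F2 F3 F0 FF => x x0 F1 F2 F3 F0 FF.
  have G1 : 0 <= 1 - expR (- x) * (1 + x).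
    by rewrite subr_ge0 -[leRHS]FF mulrC ler_wpM2r.
  have G2 : 1 - expR (- x) * (1 + x) <= x ^+ 2.
    have : (1 - x) * (1 + x) <= expR (- x) * (1 + x) by rewrite ler_wpM2r// addr_ge0.
    lra.
  rewrite ger0_norm ?mulr_ge0//; apply: le_trans G2.
  by rewrite ler_piMl.
have x0 : 0 <= l * (s - t) by rewrite mulr_ge0// subr_ge0 ltW.
have -> : expR (- l * s) = expR (- l * t) * expR (- (l * (s - t))).
  by rewrite -expRD; congr expR; ring.
have E0 := expR_ge0 (- l * t); have E1 := e1 l t l0 t0.
have F2 := expR_ge1Dx (- (l * (s - t))); have F3 := expR_ge1Dx (l * (s - t)).
have FF : expR (l * (s - t)) * expR (- (l * (s - t))) = 1.
  by rewrite -expRD subrr expR0.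
have F0 := expR_ge0 (- (l * (s - t))).
rewrite -exprMn.
have -> : expR (- l * t) * expR (- (l * (s - t))) - expR (- l * t) +
   l * (s - t) * expR (- l * t) =
   expR (- l * t) * (expR (- (l * (s - t))) - 1 + l * (s - t)) by ring.
move: (l * (s - t)) x0 F2 F3 F0 FF => x x0 F2 F3 F0 FF.
have G1 : 0 <= expR (- x) - 1 + x by lra.
have G2 : expR (- x) - 1 + x <= x ^+ 2.
  have h : expR (- x) * (1 + x) <= 1 by rewrite -[leRHS]FF mulrC ler_wpM2r.
  have h2 : 0 <= x ^+ 3 by rewrite exprn_ge0.
  have : (1 + x) * expR (- x) <= (1 + x) * (1 - x + x ^+ 2) by lra.
  by rewrite ler_pM2l ?ltr_wpDr//; lra.
rewrite ger0_norm ?mulr_ge0//; apply: le_trans G2.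
by rewrite ler_piMl.
Qed.

Definition moment_drift_sol p (s : R) : R :=
  - Lambda N p * moment_sol p s + p%:R ^+ 2 / N%:R * moment_sol p.-1 s.

Lemma moment_sol_quad p : (0 < p)%N -> exists2 C, 0 <= C &
  forall s t, 0 <= s -> 0 <= t ->
  `|moment_sol p s - moment_sol p t - (s - t) * moment_drift_sol p t| <=
  C * (s - t) ^+ 2.
Proof.
case: p => // p _; exists (\sum_(n < p.+2) `|moment_coef p.+1 n| * Lambda N n ^+ 2).
  by apply: sumr_ge0 => n _; rewrite mulr_ge0 ?sqr_ge0.
move=> s t s0 t0.
have -> : moment_drift_sol p.+1 t =
    - \sum_(n < p.+2) moment_coef p.+1 n * Lambda N n * expR (- Lambda N n * t).
  rewrite (moment_sum_rec p (fun n => expR (- Lambda N n * t))).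
  by rewrite /moment_drift_sol /moment_sol /=; ring.
rewrite mulrN opprK mulr_sumr /moment_sol -sumrB -big_split/=.
apply: (le_trans (ler_norm_sum _ _ _)); rewrite mulr_suml; apply: ler_sum => n _.
have -> : moment_coef p.+1 n * expR (- Lambda N n * s) -
  moment_coef p.+1 n * expR (- Lambda N n * t) +
  (s - t) * (moment_coef p.+1 n * Lambda N n * expR (- Lambda N n * t)) =
  moment_coef p.+1 n * (expR (- Lambda N n * s) - expR (- Lambda N n * t) +
    Lambda N n * (s - t) * expR (- Lambda N n * t)) by ring.
rewrite normrM -[leRHS]mulrA ler_wpM2l//; apply: expR_quad => //.
exact: Lambda_ge0.
Qed.

Lemma moment_sol_derivative (p : nat) (y : R -> R) (t : R) : (0 < p)%N -> 0 <= t ->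
  (forall s, 0 <= s -> y s = moment_sol p s) ->
  derivative_within `[0, +oo[ y t (moment_drift_sol p t).
Proof.
move=> p0 t0 hy; have [C C0 hC] := moment_sol_quad p0.
apply/cvgrPdist_le => e e0.
have C1 : 0 < C + 1 by lra.
have : \forall s \near nbhs t, `|t - s| < e / (C + 1).
  by apply: nbhsx_ballx; rewrite divr_gt0.
apply: filterS => s st [/= s0 /eqP sNt].
move: s0; rewrite in_itv/= andbT => s0; rewrite !hy//.
have st0 : s - t != 0 by rewrite subr_eq0.
have n0 : 0 < `|s - t| by rewrite normr_gt0.
have -> : moment_drift_sol p t - (moment_sol p s - moment_sol p t) / (s - t) =
  - (moment_sol p s - moment_sol p t - (s - t) * moment_drift_sol p t) / (s - t).
  by field.
rewrite normrM normrN normfV ler_pdivrMr//.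
apply: (le_trans (hC s t s0 t0)); rewrite -(real_normK (num_real (s - t))) expr2 mulrA.
rewrite ler_wpM2r ?ltW//; move: st; rewrite distrC ltr_pdivlMr//; nra.
Qed.

End MomentSystem.

(** * The moments of unitary Brownian motion *)

Section UnitLimit.
Context {d : measure_display} {T : measurableType d} {R : realType}.
Variable P : probability T R.

Lemma rho_le_scaled c (Q Q' : T -> R) : 1 <= c ->
  measurable_fun setT Q -> measurable_fun setT Q' ->
  (forall w, 0 <= Q w) -> (forall w, 0 <= Q' w) ->
  (forall w, Q' w <= 1 -> Q w <= c * Q' w) -> rho P Q <= c * rho P Q'.
Proof.
move=> c1 mQ mQ' Q0 Q'0 h; rewrite /rho -ExZ; last exact: L1_min1.
apply: le_Ex => [||w]; [exact: L1_min1|by apply: L1Z; exact: L1_min1|].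
have [w1|w1] := leP (Q' w) 1.
  by rewrite ge_min h ?orbT.
by rewrite mulr1 (le_trans _ c1)// ge_min lexx.
Qed.

Lemma power_lipschitz p (x y : R) : 0 <= x <= 1 -> 0 <= y <= 1 ->
  `|x ^+ p - y ^+ p| <= p%:R * `|x - y|.
Proof.
move=> /andP[x0 x1] /andP[y0 y1]; elim: p => [|p IH].
  by rewrite !expr0 subrr normr0 mul0r.
have -> : x ^+ p.+1 - y ^+ p.+1 = x * (x ^+ p - y ^+ p) + y ^+ p * (x - y).
  by rewrite !exprS; ring.
rewrite (le_trans (ler_normD _ _))// -natr1 mulrDl mul1r lerD// normrM.
  by rewrite (ger0_norm x0) (le_trans _ IH)// ler_piMl.
by rewrite ger0_norm ?exprn_ge0// ler_piMl// exprn_ile1.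
Qed.

Variable D : nat.
Variables a b : 'I_D.
Hypothesis ab : a != b.
Variables (v : T -> 'cV[R]_D) (x : nat -> T -> 'cV[R]_D).
Hypothesis mv : mx_measurable v.
Hypothesis mx : forall n, mx_measurable (x n).
Hypothesis x1 : forall n w, nsq (x n w) = 1.
Hypothesis hvx : null_seq (fun n => rho P (fun w => nsq (v w - x n w))).

Let mdiff n : measurable_fun setT (fun w => nsq (v w - x n w)).
Proof. by apply: measurable_nsq; exact: mx_measurableB. Qed.

(** [Q = (|v|^2 - 1)^2] is at most [10 |v - x n|^2] whenever the latter distance is at most 1, and
    [Q] does not depend on [n]; hence [rho P Q = 0]. *)
Lemma nsq_limit : {ae P, forall w, nsq (v w) = 1}.
Proof.
pose Q w := (nsq (v w) - 1) ^+ 2.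
have mQ : measurable_fun setT Q.
  by apply: measurable_funX; apply: measurable_funB => //; exact: measurable_nsq.
have r0 : rho P Q = 0.
  apply/eqP; rewrite eq_le rho_ge0 ?andbT => [|w]; last exact: sqr_ge0.
  apply/ler_addgt0Pr => e e0; rewrite add0r.
  have [M /(_ M (leqnn _)) hM] := hvx (divr_gt0 e0 (ltr0n _ 10)).
  apply: le_trans (rho_le_scaled (ler1n _ 10) mQ (mdiff M) _ _ _) _.
  - by move=> w; exact: sqr_ge0.
  - by move=> w; exact: nsq_ge0.
  - by move=> w; apply: nsq_diff_sqr; exact: x1.
  by rewrite mulrC -ler_pdivlMr.
have := rho_eq0 mQ (fun w => sqr_ge0 _) r0.
by apply: filterS => w /eqP; rewrite sqrf_eq0 subr_eq0 => /eqP.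
Qed.

(** Truncated at 1 so as to be bounded for every [w]; [nsq_limit] shows that this changes it only on
    a null set. *)
Let X w := Num.min 1 (psq a b (v w)).
Let Y n w := psq a b (x n w).

Lemma measurable_psq (z : T -> 'cV[R]_D) : mx_measurable z ->
  measurable_fun setT (fun w => psq a b (z w)).
Proof. by move=> mz; apply: measurable_funD; apply: measurable_funX; exact: mz. Qed.

Let X01 w : 0 <= X w <= 1.
Proof. by rewrite le_min ler01 psq_ge0 ge_min lexx. Qed.
Let Y01 n w : 0 <= Y n w <= 1.
Proof. by rewrite psq_ge0 -(x1 n w) psq_le_nsq. Qed.

Let mX : measurable_fun setT X.
Proof. by apply: measurable_min1; exact: measurable_psq. Qed.

Let L1_pow (Z : T -> R) p : measurable_fun setT Z -> (forall w, 0 <= Z w <= 1) ->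
  L1 P (fun w => Z w ^+ p).
Proof.
move=> mZ Z01; apply: (@L1_bounded _ _ _ _ _ 1); first exact: measurable_funX.
move=> w; have /andP[z0 z1] := Z01 w.
by rewrite ger0_norm ?exprn_ge0// exprn_ile1.
Qed.

Lemma psq_limit p :
  null_seq (fun n => `|Ex P (fun w => X w ^+ p) - Ex P (fun w => Y n w ^+ p)|).
Proof.
move=> e e0; pose q : R := p%:R + 1; have q0 : 0 < q by rewrite ltr_wpDl.
(* [|X - Y| <= f / 2 + (X - Y)^2 / (2 f)]: a distance below [f^2 / 10] makes the mean of the second
   term at most [f / 2], and [p f <= e]. *)
pose f := e / q; have f0 : 0 < f by rewrite divr_gt0.
have g0 : 0 < f ^+ 2 / 10 by rewrite divr_gt0// exprn_gt0.
have [M hM] := hvx g0; exists M => n /hM {}hM.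
have mY : measurable_fun setT (Y n) by exact: measurable_psq.
pose Q w := 10 * Num.min 1 (nsq (v w - x n w)).
have lm : L1 P (fun w => Num.min 1 (nsq (v w - x n w))).
  by apply: L1_min1 => // w; exact: nsq_ge0.
have lQ : L1 P Q by exact: L1Z.
have diff w : (X w - Y n w) ^+ 2 <= Q w.
  have /andP[Xw0 Xw1] := X01 w; have /andP[Yw0 Yw1] := Y01 n w.
  have h1 : (X w - Y n w) ^+ 2 <= 1.
    by rewrite -(real_normK (num_real _)) exprn_ile1// ler_norml; lra.
  have h2 : (X w - Y n w) ^+ 2 <= (psq a b (v w) - Y n w) ^+ 2.
    rewrite /X; case: (leP 1 (psq a b (v w))) => // s1.
    by rewrite ler_sqr ?nnegrE ?subr_ge0// ?lerB// (le_trans Yw1).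
  rewrite /Q; have [d1|d1] := leP (nsq (v w - x n w)) 1.
    by apply: (le_trans h2); exact: psq_diff_sqr.
  by rewrite mulr1; apply: (le_trans h1); rewrite ler1n.
have amgm w : `|X w ^+ p - Y n w ^+ p| <= p%:R * (f / 2 + (2 * f)^-1 * Q w).
  apply: (le_trans (power_lipschitz p (X01 w) (Y01 n w))); rewrite ler_wpM2l//.
  have h : (2 * f)^-1 * (X w - Y n w) ^+ 2 <= (2 * f)^-1 * Q w.
    by rewrite ler_wpM2l ?diff// invr_ge0 mulr_ge0// ltW.
  apply: le_trans (lerD (lexx _) h).
  rewrite -(real_normK (num_real (X w - Y n w))); move: `| _ | => r.
  have -> : f / 2 + (2 * f)^-1 * r ^+ 2 = (2 * f)^-1 * (f - r) ^+ 2 + r.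
    by field; rewrite gt_eqF.
  by rewrite lerDr mulr_ge0 ?sqr_ge0// invr_ge0 mulr_ge0// ltW.
rewrite -ExB; [|exact: L1_pow|exact: L1_pow].
apply: le_trans (le_norm_Ex _) _; first by apply: L1B; exact: L1_pow.
have lS : L1 P (fun w => f / 2 + (2 * f)^-1 * Q w).
  by apply: L1D; [exact: L1_cst|exact: L1Z].
apply: (@le_trans _ _ (Ex P (fun w => p%:R * (f / 2 + (2 * f)^-1 * Q w)))).
  apply: le_Ex => //; last exact: L1Z.
  by apply: L1_norm; apply: L1B; exact: L1_pow.
rewrite ExZ// ExD ?Ex_cst; [|exact: L1_cst|exact: L1Z].
rewrite ExZ// ExZ//.
have h : (2 * f)^-1 * (10 * rho P (fun w => nsq (v w - x n w))) <= f / 2.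
  rewrite ler_pdivrMl; last exact: mulr_gt0.
  move: hM; rewrite ler_pdivlMr ?ltr0n// mulrC.
  by have -> : 2 * f * (f / 2) = f ^+ 2 by field.
apply: (@le_trans _ _ (p%:R * f)).
  by rewrite ler_wpM2l//; move: h; rewrite /rho; lra.
by rewrite /f mulrCA ler_piMr ?(ltW e0)// ler_pdivrMr// mul1r /q lerDl.
Qed.

End UnitLimit.

Section UnitaryMoments.
Context {d : measure_display} {T : measurableType d} {R : realType} {N : nat}.
Variable P : probability T R.
Hypothesis hN : (0 < N)%N.
Variables (F : R -> set (set T)) (H U : R -> T -> 'M[R[i]]_N) (V : 'M[R[i]]_N).
Hypothesis hF : is_filtration F.
Hypothesis hH : hermitian_BM_wrt P F H.
Hypothesis hV : V \is unitarymx.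
Hypothesis hU : unitary_BM P F H V U.
Variables (c j : 'I_N) (a : nat -> R).
Hypothesis ha : coef_system N (Normc.normc (V j c) ^+ 2) a.

Local Notation A := (fun t w => rmx (H t w)).
Local Notation la := (lshift N j).
Local Notation rb := (rshift N j).
Local Notation u := (fun t w => rvec c (U t w)).

Let driver := hermitian_antisym_driver hN hF hH.
Let adH : adapted F H. Proof. by case: hH. Qed.
Let cH w : mx_continuous_path (H ^~ w).
Proof. by case: hH => -[]. Qed.
Let sde := unitary_linear_sde hF adH cH driver hU c.
Let U0 w : U 0 w = V. Proof. by case: hU. Qed.

Lemma psq_rvec (M : 'M[R[i]]_N) : psq la rb (rvec c M) = Normc.normc (M j c) ^+ 2.
Proof.
have [e1 e2] := rvecP c M; rewrite /psq e1 e2 /mxcoord; case: (M j c) => x y /=.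
by rewrite sqr_sqrtr// addr_ge0 ?sqr_ge0.
Qed.

Lemma nsq_unitary : nsq (rvec c V) = 1.
Proof.
have /unitarymxP /mulmx1C /matrixP /(_ c c) := hV.
rewrite mxE [RHS]mxE eqxx => /(congr1 (@complex.Re R)); rewrite Re_sum /= => <-.
have [e1 e2] := rvecP c V.
rewrite /nsq big_split_ord/= -big_split/=; apply: eq_bigr => k _.
by rewrite e1 e2 /mxcoord !mxE; case: (V k c) => x y /=; ring.
Qed.

Lemma moment_sol0 p : moment_sol N a p 0 = psq la rb (rvec c V) ^+ p.
Proof.
have f0 : p`!%:R != 0 :> R by rewrite pnatr_eq0 -lt0n fact_gt0.
rewrite psq_rvec; have -> : (Normc.normc (V j c) ^+ 2) ^+ p =
    p`!%:R * ((Normc.normc (V j c) ^+ 2) ^+ p / p`!%:R) by field.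
rewrite -ha mulr_sumr /moment_sol; apply: eq_bigr => n _.
rewrite mulr0 expR0 mulr1 /moment_coef bin_sub; last by rewrite -ltnS.
by rewrite !mulrA [_ * a n]mulrAC.
Qed.

Lemma moment_sol_0 s : moment_sol N a 0 s = 1.
Proof.
have := moment_sol0 0; rewrite expr0 /moment_sol !big_ord_recl !big_ord0.
by rewrite Lambda0 oppr0 !mul0r.
Qed.

Section FixedTime.
Variable t : R.
Hypothesis t0 : 0 < t.
Local Notation tau n := (fun k => k%:R * (t / n%:R)).

Let x n k w := flow A (tau n) k w *m u 0 w.
Let m n p k := Ex P (fun w => psq la rb (x n k w) ^+ p).

Let tau0 n k : 0 <= tau n k.
Proof. by rewrite mulr_ge0// divr_ge0// ltW. Qed.
Let tauS n k : tau n k <= tau n k.+1.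
Proof. by rewrite ler_wpM2r ?ler_nat// divr_ge0// ltW. Qed.
Let tauD n k : tau n k.+1 - tau n k = t / n%:R.
Proof. by rewrite -mulrBl -natr1 addrAC subrr add0r mul1r. Qed.

Let x1 n k w : nsq (x n k w) = 1.
Proof.
by rewrite /x (nsq_flow driver (tau0 n)) U0 nsq_unitary.
Qed.

Let mx n k : mx_adapted (F (tau n k)) (x n k).
Proof.
apply: mx_measurableM; first exact: (flow_adapted hF driver (tau0 n) (tauS n)).
exact: (mx_adapted_le hF (lexx 0) (tau0 n k) (sde_mes sde (lexx 0))).
Qed.

Let weight_cst : R := (N + N)%:R ^+ 2 * @driver_cst R N.

Let moment_step n p k lam : (0 < p)%N -> 0 < lam -> lam <= 1 ->
  `|m n p k.+1 - ((1 - Lambda N p * (t / n%:R)) * m n p k +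
     p%:R ^+ 2 / N%:R * (t / n%:R) * m n p.-1 k)| <=
  moment_rem p * (weight_cst * (lam * (t / n%:R) + (t / n%:R) ^+ 2 / lam)).
Proof.
move=> p0 lam0 lam1.
have := Ex_cayley_moment hN hF hH (tau0 n k) (tauS n k) (@mx n k) (@x1 n k) j p0 lam0 lam1.
rewrite tauD; under [X in `|X - _| <= _ -> _]eq_Ex => w.
  have -> : cayley (rmx (hinc H (tau n k) (tau n k.+1) w)) *m x n k w = x n k.+1 w.
    by rewrite /x /= mulmxA /step /inc /hinc rmxB.
  over.
by [].
Qed.

(** Induction on [p], since moment [p - 1] forces moment [p]. As [0 <= 1 - Lambda h <= 1], earlier
    errors are not amplified, and the local errors of order [h dl] add up to at most
    [t (q + 2 r + C) dl] without a Gronwall factor. *)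
Lemma moment_error p e : 0 < e -> exists M, forall n, (M <= n)%N ->
  forall k, (k <= n)%N -> `|m n p k - moment_sol N a p (tau n k)| <= e.
Proof.
elim: p e => [|p IH] e e0.
  exists 0%N => n _ k _; rewrite moment_sol_0 /m.
  by under eq_Ex do rewrite expr0; rewrite Ex_cst subrr normr0 ltW.
have [C C0 hC] := moment_sol_quad hN a (ltn0Sn p).
pose q : R := p.+1%:R ^+ 2 / N%:R.
pose r : R := moment_rem p.+1 * weight_cst.
have q0 : 0 <= q by rewrite divr_ge0// exprn_ge0.
have r0 : 0 <= r.
  rewrite mulr_ge0//; first by rewrite /moment_rem mulr_ge0// !addr_ge0.
  by rewrite mulr_ge0 ?exprn_ge0//; exact: drv_K driver.
pose K := t * (q + 2 * r + C).
have K0 : 0 <= K by rewrite mulr_ge0 ?(ltW t0)//; lra.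
(* [dl] is both the accuracy asked of the moments of order [p] and the parameter [lam] of the
   one-step estimate. *)
pose dl := Num.min 1 (e / (K + 1)).
have K1 : 0 < K + 1 by lra.
have dl0 : 0 < dl by rewrite lt_min ltr01 divr_gt0.
have dl1 : dl <= 1 by rewrite ge_min lexx.
have hdl : K * dl <= e.
  have h : dl <= e / (K + 1) by rewrite ge_min lexx orbT.
  have : dl * (K + 1) <= e by rewrite -ler_pdivlMr.
  by nra.
have L0 := @Lambda_ge0 R N p.+1.
have [M1 hM1] := IH dl dl0.
(* [h <= dl^2] makes [h^2 / dl <= h dl], and [h <= 1 / (Lambda + 1)] keeps [1 - Lambda h]
   nonnegative. *)
have d1 : 0 < Num.min (dl ^+ 2) (Lambda N p.+1 + 1)^-1.
  by rewrite lt_min exprn_gt0// invr_gt0; lra.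
have [M2 hM2] := small_mesh (ltW t0) d1.
exists (maxn M1 M2) => n; rewrite geq_max => /andP[/hM1 {}hM1 /hM2[n0]].
set h := t / n%:R => hh.
have h0 : 0 <= h by rewrite divr_ge0// ltW.
have hd2 : h <= dl ^+ 2 by apply: (le_trans hh); rewrite ge_min lexx.
have hL : h <= (Lambda N p.+1 + 1)^-1.
  by apply: (le_trans hh); rewrite ge_min lexx orbT.
have hLh : Lambda N p.+1 * h <= 1.
  have : h * (Lambda N p.+1 + 1) <= 1 by rewrite -ler_pdivlMr ?mul1r//; lra.
  by lra.
have hdl2 : h ^+ 2 / dl <= h * dl.
  by rewrite ler_pdivrMr// -mulrA -expr2 [h ^+ 2]expr2 ler_wpM2l.
have hh2 : h ^+ 2 <= h * dl.
  rewrite expr2 ler_wpM2l//; apply: (le_trans hd2).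
  by rewrite expr2 ler_piMl// ltW.
suff step k : (k <= n)%N ->
    `|m n p.+1 k - moment_sol N a p.+1 (tau n k)| <= k%:R * h * (q + 2 * r + C) * dl.
  move=> k kn; apply: (le_trans (step k kn)); apply: le_trans hdl.
  rewrite ler_wpM2r ?ler_wpM2r ?(ltW dl0)//; first by lra.
  by rewrite /h mulrA ler_pdivrMr ?ltr0n// mulrC ler_wpM2l ?ler_nat// ltW.
elim: k => [_|k IHk kn].
  rewrite !mul0r moment_sol0 /m.
  under eq_Ex => w do rewrite /x /= mul1mx U0.
  by rewrite Ex_cst subrr normr0.
have {}IHk := IHk (ltnW kn).
have s1 := @moment_step n p.+1 k dl (ltn0Sn p) dl0 dl1.
have s2 := hC _ _ (tau0 n k.+1) (tau0 n k).
rewrite tauD -/h in s1 s2.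
have s3 := hM1 k (ltnW kn).
set X' := m n p.+1 k.+1 in s1 *; set X := m n p.+1 k in s1 IHk.
set Z' := moment_sol N a p.+1 (tau n k.+1) in s2 *.
set Z := moment_sol N a p.+1 (tau n k) in s2 IHk.
rewrite /moment_drift_sol -/Z -/q /= in s1 s2.
set x0 := m n p k in s1 s3; set z0 := moment_sol N a p (tau n k) in s2 s3.
have E : X' - Z' = (X' - ((1 - Lambda N p.+1 * h) * X + q * h * x0)) -
   (Z' - Z - h * (- Lambda N p.+1 * Z + q * z0)) +
   ((1 - Lambda N p.+1 * h) * (X - Z) + q * h * (x0 - z0)) by ring.
have t1 : `|(1 - Lambda N p.+1 * h) * (X - Z)| <= k%:R * h * (q + 2 * r + C) * dl.
  rewrite normrM ger0_norm ?subr_ge0//; apply: le_trans IHk.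
  by rewrite ler_piMl// gerBl mulr_ge0.
have t2 : `|q * h * (x0 - z0)| <= q * h * dl.
  rewrite normrM (ger0_norm (mulr_ge0 q0 h0)); apply: ler_wpM2l => //.
  exact: mulr_ge0.
have t3 : moment_rem p.+1 * (weight_cst * (dl * h + h ^+ 2 / dl)) <= 2 * r * (h * dl).
  have -> : 2 * r * (h * dl) = r * (h * dl + h * dl) by ring.
  by rewrite [leLHS]mulrA (mulrC dl); apply: ler_wpM2l => //; rewrite lerD2l.
have t4 : C * h ^+ 2 <= C * (h * dl) by rewrite ler_wpM2l.
rewrite E (le_trans (ler_normD _ _))//.
apply: le_trans (lerD (le_trans (ler_normB _ _) (lerD (le_trans s1 t3) (le_trans s2 t4)))
  (le_trans (ler_normD _ _) (lerD t1 t2))) _.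
by rewrite -(natr1 k) le_eqVlt; apply/orP; left; apply/eqP; ring.
Qed.

Let flow_limit : null_seq (fun n => rho P (fun w => nsq (u t w - x n n w))).
Proof. exact: (flow_cvg hF driver sde (ltW t0)). Qed.

Let mu : mx_measurable (u t).
Proof. exact: (mx_adapted_measurable hF (ltW t0) (sde_mes sde (ltW t0))). Qed.

Let mxx n : mx_measurable (x n n).
Proof. exact: (mx_adapted_measurable hF (tau0 n n) (@mx n n)). Qed.

Lemma nsq_unitary_BM : {ae P, forall w, nsq (u t w) = 1}.
Proof. exact: (nsq_limit mu mxx (fun n w => @x1 n n w) flow_limit). Qed.

Lemma Ex_psq_unitary_BM p :
  Ex P (fun w => Num.min 1 (psq la rb (u t w)) ^+ p) = moment_sol N a p t.
Proof.
apply/eqP; rewrite -subr_eq0 -normr_le0; apply/ler_addgt0Pr => e e0; rewrite add0r.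
have e2 : 0 < e / 2 by rewrite divr_gt0.
have [M1 hM1] := psq_limit (pair_neq j) mu mxx (fun n w => @x1 n n w) flow_limit p e2.
have [M2 hM2] := moment_error p e2.
pose n := (maxn M1 M2).+1.
have {}hM1 := hM1 n (leqW (leq_maxl _ _)).
have {}hM2 := hM2 n (leqW (leq_maxr _ _)) n (leqnn n).
have nt : n%:R * (t / n%:R) = t by rewrite mulrC divfK// pnatr_eq0.
rewrite nt in hM2.
rewrite -(subrK (m n p n) (Ex _ _)) -addrA (le_trans (ler_normD _ _))//.
by rewrite [e]splitr lerD.
Qed.

End FixedTime.

Let Y p t : \bar R :=
  ('E_P[fun w => (Normc.normc (U t w j c) ^+ (2 * p))%R])%E.

(** At positive times [|u t| = 1] almost surely, which removes the truncation; finiteness of the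
    untruncated moment is obtained here as well. *)
Lemma moment_unitary_BM p t : 0 <= t -> Y p t = (moment_sol N a p t)%:E.
Proof.
have E w s : Normc.normc (U s w j c) ^+ (2 * p) = psq la rb (u s w) ^+ p.
  by rewrite psq_rvec exprM.
rewrite le_eqVlt => /predU1P[<-|t0].
  rewrite /Y unlock; under eq_integral do rewrite E U0.
  by rewrite moment_sol0 Ex_EFin ?Ex_cst//; exact: L1_cst.
have m0 : mx_measurable (u t).
  exact: (mx_adapted_measurable hF (ltW t0) (sde_mes sde (ltW t0))).
have mq := measurable_psq la rb m0.
rewrite /Y unlock -Ex_psq_unitary_BM// -Ex_EFin; last first.
  apply: (@L1_bounded _ _ _ _ _ 1); first exact/measurable_funX/measurable_min1.
  move=> w; have q0 : 0 <= Num.min 1 (psq la rb (u t w)) by rewrite le_min ler01 psq_ge0.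
  by rewrite ger0_norm ?exprn_ge0// exprn_ile1// ge_min lexx.
apply: ae_eq_integral => //.
- by apply/measurable_EFinP; under eq_fun do rewrite E; exact: measurable_funX.
- by apply/measurable_EFinP; exact/measurable_funX/measurable_min1.
apply: filterS (nsq_unitary_BM t0) => w n1 _; rewrite E; congr (_ ^+ _)%:E.
by rewrite min_r// -n1; exact: psq_le_nsq (pair_neq j) _.
Qed.

End UnitaryMoments.

Theorem proposition5p1 (d : measure_display) (T : measurableType d)
    (R : realType) (P : probability T R) (N : nat) (hN : (0 < N)%N)
    (F : R -> set (set T)) (H U : R -> T -> 'M[R[i]]_N) (V : 'M[R[i]]_N)
    (hF : is_filtration F) (hH : hermitian_BM_wrt P F H)
    (hV : V \is unitarymx) (hU : unitary_BM P F H V U)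
    (j : 'I_N) (a : nat -> R)
    (ha : coef_system N (Normc.normc (V j (Ordinal hN)) ^+ 2) a) :
  let Y (p : nat) (t : R) : \bar R :=
    ('E_P[fun w => (Normc.normc (U t w j (Ordinal hN)) ^+ (2 * p))%R])%E in
  let y (p : nat) (t : R) : R := if p == 0%N then 1 else fine (Y p t) in
  (forall (p : nat) (t : R), (0 < p)%N -> 0 <= t -> Y p t \is a fin_num) /\
  (forall (p : nat) (t : R), (0 < p)%N -> 0 <= t ->
     derivative_within `[0, +oo[ (y p) t
       (- Lambda N p * y p t + p%:R ^+ 2 / N%:R * y p.-1 t)) /\
  (forall (p : nat) (t : R), 0 <= t ->
     y p t = p`!%:R * \sum_(n < p.+1)
       'C(p, p - n)%:R * (a n / pochhammer (N%:R + 2 * n%:R) (p - n))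
         * expR (- Lambda N n * t)).
Proof.
move=> Y y.
have YE p t : 0 <= t -> Y p t = (moment_sol N a p t)%:E.
  exact: (moment_unitary_BM hN hF hH hV hU ha).
have yE p t : 0 <= t -> y p t = moment_sol N a p t.
  move=> t0; rewrite /y; case: p => [|p] /=; last by rewrite YE.
  by rewrite (moment_sol_0 ha).
split=> [p t p0 t0|]; first by rewrite YE.
split=> [p t p0 t0|p t t0].
  rewrite !yE//; apply: moment_sol_derivative => // s s0; exact: yE.
rewrite yE// /moment_sol mulr_sumr; apply: eq_bigr => n _.
by rewrite /moment_coef !mulrA.
Qed.
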